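(* For all integers $n$ and $t$ such that $n \geq 5$, $0 \leq t \leq n-4$, and $t \equiv \frac{1}{2}n(n-5) \pmod{4}$, there exists an orientable $(n,t)$-quadrangulation whose underlying graph has a vertex adjacent to every other vertex.
   Context: Graphs are finite, and surfaces are connected closed surfaces (compact 2-manifolds without boundary). An embedding of a graph in a surface is cellular if every face (connected component of the complement of the embedded graph) is homeomorphic to an open disk; the length of a face is the length of its boundary walk. A quadrangular embedding is a cellular embedding in which every face has length 4. An $(n,t)$-quadrangulation is a quadrangular embedding, in some surface, of a simple graph (no loops, no parallel edges) on $n$ vertices and $\binom{n}{2}-t$ edges. It is called orientable if the surface is orientable. *)

(* Defs.v *)
From HB Require Import structures.
From mathcomp Require Import all_boot all_order all_algebra.
From mathcomp Require Import all_classical all_reals all_analysis.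

Set Implicit Arguments.
Unset Strict Implicit.
Unset Printing Implicit Defensive.

Import Order.TTheory GRing.Theory Num.Theory.
Import numFieldNormedType.Exports.

Local Open Scope classical_set_scope.
Local Open Scope ring_scope.

Record sgraph := SGraph {
  vertex :> finType;
  adj : rel vertex;
  adj_sym : symmetric adj;
  adj_irrefl : irreflexive adj
}.

Definition edges (G : sgraph) : {set {set G}} :=
  [set [set x; y]%SET | x in G, y in G & adj x y]%SET.

Definition dominating_vertex (G : sgraph) (v : G) : Prop :=
  forall w : G, w != v -> adj v w.

(* f and g restrict to mutually inverse homeomorphisms between A and B. *)
Definition homeomorphism (T U : topologicalType) (A : set T) (B : set U)
    (f : T -> U) (g : U -> T) : Prop :=
  [/\ {within A, continuous f} /\ {within B, continuous g},
      {homo f : x / A x >-> B x}, {homo g : y / B y >-> A y},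
      (forall x, A x -> g (f x) = x) & (forall y, B y -> f (g y) = y)].

Definition homeomorphic (T U : topologicalType) (A : set T) (B : set U) : Prop :=
  exists f g, homeomorphism A B f g.

Definition plane (R : realType) : topologicalType := (R * R)%type.

Definition open_disk (R : realType) : set (plane R) :=
  [set p | p.1 ^+ 2 + p.2 ^+ 2 < 1].

Definition closed_disk (R : realType) : set (plane R) :=
  [set p | p.1 ^+ 2 + p.2 ^+ 2 <= 1].

(* The point p + r e^(2 i pi s). *)
Definition circle_pt (R : realType) (p : plane R) (r s : R) : plane R :=
  (p.1 + r * cos (2 * pi * s), p.2 + r * sin (2 * pi * s)).

Record chart (R : realType) (S : topologicalType) := Chart {
  chart_dom : set S;
  chart_cod : set (plane R);
  chart_to : S -> plane R;
  chart_from : plane R -> S;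
  chart_dom_open : open chart_dom;
  chart_cod_open : open chart_cod;
  chart_homeo : homeomorphism chart_dom chart_cod chart_to chart_from
}.

(* Second countability is automatic for compact, locally Euclidean spaces. *)
Definition closed_surface (R : realType) (S : topologicalType) : Prop :=
  [/\ hausdorff_space S, compact [set: S], connected [set: S], [set: S] !=set0
    & forall x : S, exists c : chart R S, chart_dom c x].

(* The curve c : [0, 1] -> R^2 avoids q and has winding number 1 around q:
   in polar coordinates (rho, theta) centred at q, with theta a continuous
   determination of the angle, theta increases by exactly 2 pi. *)
Definition winds_once (R : realType) (c : R -> plane R) (q : plane R) : Prop :=
  exists rho theta : R -> R,
    [/\ {within `[0, 1]%classic, continuous theta},
        theta 1 = theta 0 + 2 * pi
      & forall s, 0 <= s <= 1 ->
          0 < rho s /\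
          c s = (q.1 + rho s * cos (theta s), q.2 + rho s * sin (theta s))].

(* For a local homeomorphism f of the plane: local degree 1 at p. *)
Definition orientation_preserving_at (R : realType) (f : plane R -> plane R)
    (p : plane R) : Prop :=
  \forall r \near (0 : R)^'+, winds_once (fun s => f (circle_pt p r s)) (f p).

(* Existence of an atlas whose transition maps preserve orientation. *)
Definition orientable (R : realType) (S : topologicalType) : Prop :=
  exists atlas : set (chart R S),
    (forall x : S, exists2 c, atlas c & chart_dom c x) /\
    (forall c d, atlas c -> atlas d ->
       forall x, chart_dom c x -> chart_dom d x ->
         orientation_preserving_at (chart_to d \o chart_from c) (chart_to c x)).

(* Each edge xy is drawn as a simple arc, parametrized on [0, 1] from x to y
   by emb_arc x y and from y to x by emb_arc y x; values of emb_arc at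
   non-adjacent pairs or outside [0, 1] are irrelevant. *)
Record embedding (R : realType) (G : sgraph) (S : topologicalType) := Embedding {
  emb_vertex : G -> S;
  emb_arc : G -> G -> R -> S;
  emb_vertex_inj : injective emb_vertex;
  emb_arc_continuous : forall x y, adj x y ->
    {within `[0, 1]%classic, continuous (emb_arc x y)};
  emb_arc_start : forall x y, adj x y -> emb_arc x y 0 = emb_vertex x;
  emb_arc_rev : forall x y, adj x y ->
    forall s, 0 <= s <= 1 -> emb_arc y x s = emb_arc x y (1 - s);
  emb_arc_inj : forall x y, adj x y ->
    forall s s', 0 <= s <= 1 -> 0 <= s' <= 1 ->
      emb_arc x y s = emb_arc x y s' -> s = s';
  emb_arc_vertex : forall x y, adj x y ->
    forall s z, 0 < s < 1 -> emb_arc x y s <> emb_vertex z;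
  emb_arc_disjoint : forall x y x' y', adj x y -> adj x' y' ->
    [set x; y]%SET != [set x'; y']%SET ->
    forall s s', 0 < s < 1 -> 0 < s' < 1 -> emb_arc x y s <> emb_arc x' y' s'
}.

Section Faces.
Context (R : realType) (G : sgraph) (S : topologicalType) (m : embedding R G S).

Definition emb_image : set S :=
  [set p | (exists x, p = emb_vertex m x) \/
           (exists x y s, [/\ adj x y, 0 <= s <= 1 & p = emb_arc m x y s])].

Definition is_face (F : set S) : Prop :=
  exists2 p, ~ emb_image p & F = connected_component (~` emb_image) p.

Definition cellular : Prop :=
  forall F, is_face F -> homeomorphic F (@open_disk R).

(* F is the homeomorphic image of the open unit disk under a map phi that
   extends continuously to the closed disk, and, as one goes once around the
   unit circle, phi runs successively along the edges w_0 w_1, w_1 w_2, ...,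
   w_(k-1) w_0, each being traversed on an arc of length 2 pi / k. *)
Definition boundary_walk (F : set S) (k : nat) (w : 'I_k -> G) : Prop :=
  (forall i, adj (w i) (w (ordS i))) /\
  exists phi : plane R -> S,
    [/\ {within @closed_disk R, continuous phi},
        exists psi, homeomorphism (@open_disk R) F phi psi
      & forall (i : 'I_k) s, 0 <= s <= 1 ->
          phi (circle_pt (0, 0) 1 ((i%:R + s) / k%:R)) =
          emb_arc m (w i) (w (ordS i)) s].

Definition face_length (F : set S) (k : nat) : Prop :=
  exists w : 'I_k -> G, boundary_walk F w.

Definition quadrangular : Prop :=
  cellular /\ forall F, is_face F -> face_length F 4.

End Faces.

(* The embedded graph m has n vertices and 'C(n, 2) - t edges. *)
Definition nt_quadrangulation (R : realType) (n t : nat) (G : sgraph)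
    (S : topologicalType) (m : embedding R G S) : Prop :=
  [/\ closed_surface R S, #|G| = n, (#|edges G| + t = 'C(n, 2))%N
    & quadrangular m].

(* Main.v *)
(** Two faces a x b y and c z d w such that no edge joins {a, b} to {c, d} can
    be replaced by the faces a x b c, c z d a, b y a d, d w c b: this inserts a
    tube that carries the four missing edges, and {a, b} and {c, d} are again
    diagonals of faces. Suppose that the vertices (all but the dominating one
    when n is odd) are matched into diagonals of distinct faces. Add a small
    quadrangulation matched in the same way, glued along a path of two edges or
    disjoint from the first, and join every old pair to every new pair; the
    result is matched again. Skipping one of the joins leaves out four more
    edges. Pieces with 2, 4 or 8 new vertices give an induction on n that starts
    from quadrangulations on 5, 7, 8 and 11 vertices.

    The surface is the geometric realization, in barycentric coordinates, of
    the triangulation that has a further vertex in every face. The open star of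
    a vertex v is a plane in which the neighbours of v lie in evenly spaced
    directions. A transition map sends a circle around a point to a closed curve
    that meets a suitable line through the image point in the same cyclic
    pattern as the circle does, so it winds once, which is orientability. *)

Require Import Defs.
From HB Require Import structures.
From mathcomp Require Import all_boot all_order all_algebra.
From mathcomp Require Import all_classical all_reals all_analysis.
From mathcomp Require Import zify ring lra.

Set Implicit Arguments.
Unset Strict Implicit.
Unset Printing Implicit Defensive.

Import Order.TTheory GRing.Theory Num.Theory.
Import numFieldNormedType.Exports.

(** Neither the genus nor the Euler characteristic is ever computed. A list of oriented faces in
    which every directed edge occurs once, together with its reverse, and in which all vertex links
    are cycles already describes an oriented closed surface, connected through the vertex 0. Each
    face has four directed edges, so the prescribed number of edges becomes a prescribed number of
    faces. Vertex 0 stays dominating because it lies on the glued path: as an end for even n, where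
    it is paired, and as the middle for odd n, where it is not. A skipped join therefore never
    concerns 0. The bound t <= n - 4 shapes the induction. Adding 2 vertices (n even) or 4 vertices
    (n odd) raises the bound by 2 or 4 but t only by 1 or 2, so the top values of t are reached only
    by skipping one join, which changes t by 4 and keeps its residue. When t is too small to be
    lowered, 8 vertices are added at once and t is kept. *)

(** * Oriented quadrangulations as lists of faces *)

Definition face := seq nat.

Definition face_darts (f : face) : seq (nat * nat) :=
  if f is [:: a; b; c; d] then [:: (a, b); (b, c); (c, d); (d, a)] else [::].

(* A corner (v, (x, y)) of a counterclockwise face: x follows v and y precedes
   it, so y is the neighbour of v next to x in the rotation at v. *)
Definition face_corners (f : face) : seq (nat * (nat * nat)) :=
  if f is [:: a; b; c; d]
  then [:: (a, (b, d)); (b, (c, a)); (c, (d, b)); (d, (a, c))] else [::].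

Definition darts (fs : seq face) := flatten (map face_darts fs).
Definition corners (fs : seq face) := flatten (map face_corners fs).

Definition quadface (f : face) := (size f == 4) && uniq f.

(* The link of every vertex is a single cycle. *)
Definition linked (fs : seq face) := forall v (P : pred nat),
  (forall x y, (v, (x, y)) \in corners fs -> P x -> P y) ->
  forall x y, (v, x) \in darts fs -> (v, y) \in darts fs -> P x -> P y.

(** Every edge is traversed exactly once in each direction by the face boundaries; this is how the
    orientation of the surface is encoded. Connectedness is not part of the notion and will come
    from the dominating vertex. *)
Definition quad (fs : seq face) :=
  [/\ all quadface fs, uniq (darts fs),
      forall x y, (x, y) \in darts fs -> (y, x) \in darts fs & linked fs].

(** Two concatenations of the same blocks are compared by counting: for an arbitrary predicate, the
    count on each block becomes a natural number and linear arithmetic concludes. *)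
Ltac perm_count := apply/permP => ?; rewrite /= ?count_cat /= ?count_cat /= ?count_cat;
  repeat match goal with
    |- context [nat_of_bool ?b] => move: (nat_of_bool b)
  | |- context [count ?b ?l] => move: (count b l) end;
  clear; move=> *; lia.

Lemma darts_cat fs gs : darts (fs ++ gs) = darts fs ++ darts gs.
Proof. by rewrite /darts map_cat flatten_cat. Qed.

Lemma corners_cat fs gs : corners (fs ++ gs) = corners fs ++ corners gs.
Proof. by rewrite /corners map_cat flatten_cat. Qed.

Lemma darts_cons f fs : darts (f :: fs) = face_darts f ++ darts fs.
Proof. by []. Qed.

Lemma corners_cons f fs : corners (f :: fs) = face_corners f ++ corners fs.
Proof. by []. Qed.

Lemma perm_darts fs gs : perm_eq fs gs -> perm_eq (darts fs) (darts gs).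
Proof. by move=> h; apply/perm_flatten/perm_map. Qed.

Lemma perm_corners fs gs : perm_eq fs gs -> perm_eq (corners fs) (corners gs).
Proof. by move=> h; apply/perm_flatten/perm_map. Qed.

Lemma quad_perm fs gs : perm_eq fs gs -> quad fs -> quad gs.
Proof.
move=> h [f4 un sy ln]; have hd := perm_darts h; have hc := perm_corners h.
split.
- by rewrite -(perm_all _ h).
- by rewrite -(perm_uniq hd).
- by move=> x y; rewrite -!(perm_mem hd); apply: sy.
- move=> v P cl x y; rewrite -!(perm_mem hd); apply: ln => {}x {}y.
  by rewrite (perm_mem hc); apply: cl.
Qed.

Lemma quadfaceE f : quadface f -> exists a b c d, f = [:: a; b; c; d].
Proof.
by case: f => [|a [|b [|c [|d []]]]] //= _; exists a, b, c, d.
Qed.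

Lemma quad_neq fs x y : quad fs -> (x, y) \in darts fs -> x != y.
Proof.
move=> [/allP f4 _ _ _] /flatten_mapP [f /f4 hf].
have [a [b [c [d ef]]]] := quadfaceE hf; move: hf.
rewrite ef /quadface /= !inE !negb_or -!andbA => /and5P [ab _ ad bc /and3P [_ cd _]].
by rewrite !xpair_eqE => /or4P [] /andP [/eqP -> /eqP ->] //; rewrite eq_sym.
Qed.

(** * Joining two faces by a tube *)

(** The order of the entries matters: the first two faces keep the first three vertices of the old
    faces, so both diagonals survive and can be joined again. *)
Definition faces_join (a x b y c z d w : nat) : seq face :=
  [:: [:: a; x; b; c]; [:: c; z; d; a]; [:: b; y; a; d]; [:: d; w; c; b]].

Definition cross (A B : seq nat) (e : nat * nat) :=
  (e.1 \in A) && (e.2 \in B) || (e.2 \in A) && (e.1 \in B).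

Lemma crossU A B C e : cross A (B ++ C) e = cross A B e || cross A C e.
Proof.
rewrite /cross !mem_cat.
by do !case: (_ \in _) => //=.
Qed.

Lemma crossUl A B C e : cross (A ++ B) C e = cross A C e || cross B C e.
Proof.
rewrite /cross !mem_cat.
by do !case: (_ \in _) => //=.
Qed.

Lemma join_darts a x b y c z d w fs :
  perm_eq (darts (faces_join a x b y c z d w ++ fs))
    ([:: (a, c); (c, a); (a, d); (d, a); (b, c); (c, b); (b, d); (d, b)] ++
     darts ([:: a; x; b; y] :: [:: c; z; d; w] :: fs)).
Proof.
rewrite darts_cat !darts_cons; perm_count.
Qed.

(** In the rotation at [a] the old step from [x] to [y] is refined to [x], [c], [d], [y], and
    similarly at [b], [c] and [d]. Hence a set of neighbours closed under the new steps is closed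
    under the old ones, and every new neighbour sits on such a chain between old neighbours. *)
Lemma join_quad a x b y c z d w fs :
  let fs0 := [:: a; x; b; y] :: [:: c; z; d; w] :: fs in
  quad fs0 -> uniq [:: a; b; c; d] ->
  (forall e, cross [:: a; b] [:: c; d] e -> e \notin darts fs0) ->
  quad (faces_join a x b y c z d w ++ fs).
Proof.
move=> fs0 [f4 un sy ln] uabcd nocr.
have hd := join_darts a x b y c z d w fs; rewrite -/fs0 in hd.
have nn u v : (u, v) \in face_darts [:: a; x; b; y] ++ face_darts [:: c; z; d; w] ->
    ~~ cross [:: a; b] [:: c; d] (u, v).
  move=> he; apply/negP => /nocr; rewrite !darts_cons mem_cat negb_or mem_cat.
  by move: he; rewrite mem_cat => /orP [] ->; rewrite ?andbF.
have un4 : [/\ a != b, a != c & a != d] /\ [/\ b != c, b != d & c != d].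
  by move: uabcd; rewrite /= !inE !negb_or -!andbA => /and5P [-> -> -> ->] /and3P [-> ->].
split.
(* If [x] were [c], the old dart from [a] to [x] would be one of the four edges to be added. *)
- have xc : x != c.
    by apply: contraTneq (nn a x _) => [->|]; rewrite /cross !inE ?eqxx ?orbT.
  have za : z != a.
    by apply: contraTneq (nn c z _) => [->|]; rewrite /cross !inE ?eqxx ?orbT.
  have yd : y != d.
    by apply: contraTneq (nn b y _) => [->|]; rewrite /cross !inE ?eqxx ?orbT.
  have wb : w != b.
    by apply: contraTneq (nn d w _) => [->|]; rewrite /cross !inE ?eqxx ?orbT.
  have [[ab ac ad] [bc bd cd]] := un4.
  move: f4; rewrite /= /quadface /= !inE !negb_or -!andbA => /and3P [].
  move=> ax _ /andP [ay /andP [xb /andP [xy /andP [by_ /andP [_]]]]].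
  move=> /and5P [cz _ cw zd /andP [zw /andP [dw /andP [_ ->]]]].
  rewrite ax ab ac xb xc bc cz cd (eq_sym c a) ac zd za (eq_sym d a) ad by_.
  by rewrite (eq_sym b a) ab bd (eq_sym y a) ay yd dw (eq_sym d c) (eq_sym d b)
    bd (eq_sym w c) cw wb (eq_sym c b) bc cd.
- rewrite (perm_uniq hd) cat_uniq un andbT; apply/andP; split.
    have [[ab ac ad] [bc bd cd]] := un4.
    have sy2 (u v : nat) : u != v -> v != u by rewrite eq_sym.
    rewrite /= !inE !xpair_eqE (negbTE ab) (negbTE ac) (negbTE ad) (negbTE bc).
    rewrite ?(negbTE bd) ?(negbTE cd) ?(negbTE (sy2 _ _ ab)) ?(negbTE (sy2 _ _ ac)).
    rewrite ?(negbTE (sy2 _ _ ad)) ?(negbTE (sy2 _ _ bc)) ?(negbTE (sy2 _ _ bd)).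
    by rewrite ?(negbTE (sy2 _ _ cd)) ?andbF.
  apply/hasPn => e he; apply: contraL he => he8; apply: nocr; move: he8; case: e => u v.
  rewrite !inE !xpair_eqE /cross /= !inE.
  by repeat case/orP; move=> /andP [-> ->]; rewrite ?orbT.
- move=> u v; rewrite !(perm_mem hd) (mem_cat (u, v)) (mem_cat (v, u)) => /orP [|h];
    last by rewrite (sy _ _ h) orbT.
  rewrite !inE !xpair_eqE => h; apply/orP; left; move: h.
  by repeat case/orP; move=> /andP [-> ->]; rewrite ?orbT.
- move=> v P cl.
  have mj s t u : (u, (s, t)) \in corners (faces_join a x b y c z d w) ->
      v = u -> P s -> P t.
    by move=> hc ev; apply: cl; rewrite ev corners_cat mem_cat hc.
  have k1 : v = a -> P x -> P c by apply: mj; rewrite !inE eqxx ?orbT.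
  have k2 : v = b -> P c -> P x by apply: mj; rewrite !inE eqxx ?orbT.
  have k3 : v = c -> P a -> P b by apply: mj; rewrite !inE eqxx ?orbT.
  have k4 : v = c -> P z -> P a by apply: mj; rewrite !inE eqxx ?orbT.
  have k5 : v = d -> P a -> P z by apply: mj; rewrite !inE eqxx ?orbT.
  have k6 : v = a -> P c -> P d by apply: mj; rewrite !inE eqxx ?orbT.
  have k7 : v = b -> P y -> P d by apply: mj; rewrite !inE eqxx ?orbT.
  have k8 : v = a -> P d -> P y by apply: mj; rewrite !inE eqxx ?orbT.
  have k9 : v = d -> P b -> P a by apply: mj; rewrite !inE eqxx ?orbT.
  have k10 : v = d -> P w -> P b by apply: mj; rewrite !inE eqxx ?orbT.
  have k11 : v = c -> P b -> P w by apply: mj; rewrite !inE eqxx ?orbT.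
  have k12 : v = b -> P d -> P c by apply: mj; rewrite !inE eqxx ?orbT.
  (* The refinement of the old steps, so that the link condition [ln] of the old faces applies to
     [P]. *)
  have cl0 s t : (v, (s, t)) \in corners fs0 -> P s -> P t.
    rewrite !corners_cons !mem_cat => /or3P [||hs]; last first.
    - by apply: cl; rewrite corners_cat mem_cat hs orbT.
    - rewrite !inE => /or4P [] /eqP [ev -> ->].
      + by move/(k4 ev)/(k3 ev)/(k11 ev).
      + by apply: (mj _ _ z _ ev); rewrite !inE eqxx ?orbT.
      + by move/(k10 ev)/(k9 ev)/(k5 ev).
      + by apply: (mj _ _ w _ ev); rewrite !inE eqxx ?orbT.
    - rewrite !inE => /or4P [] /eqP [ev -> ->].
      + by move/(k1 ev)/(k6 ev)/(k8 ev).
      + by apply: (mj _ _ x _ ev); rewrite !inE eqxx ?orbT.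
      + by move/(k7 ev)/(k12 ev)/(k2 ev).
      + by apply: (mj _ _ y _ ev); rewrite !inE eqxx ?orbT.
  (* [n1] is an old neighbour reached from [s], and [n2] an old neighbour from which [s] is
     reached. *)
  have old s : (v, s) \in darts (faces_join a x b y c z d w ++ fs) ->
      exists n1 n2, [/\ (v, n1) \in darts fs0, (v, n2) \in darts fs0,
        P s -> P n1 & P n2 -> P s].
    rewrite (perm_mem hd) mem_cat => /orP [|hs]; last by exists s, s.
    have da s1 t1 : (s1, t1) \in face_darts [:: a; x; b; y] ->
        (s1, t1) \in darts fs0 by move=> h; rewrite !darts_cons mem_cat h.
    have dc s1 t1 : (s1, t1) \in face_darts [:: c; z; d; w] ->
        (s1, t1) \in darts fs0.
      by move=> h; rewrite !darts_cons mem_cat mem_cat h orbT.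
    rewrite !inE !xpair_eqE => /orP [/andP [/eqP ev /eqP ->]|].
      exists y, x; split.
      - by rewrite ev; apply/sy/da; rewrite !inE eqxx ?orbT.
      - by rewrite ev; apply/da; rewrite !inE eqxx ?orbT.
      - by move/(k6 ev)/(k8 ev).
      - by move/(k1 ev).
    move=> /orP [/andP [/eqP ev /eqP ->]|].
      exists w, z; split.
      - by rewrite ev; apply/sy/dc; rewrite !inE eqxx ?orbT.
      - by rewrite ev; apply/dc; rewrite !inE eqxx ?orbT.
      - by move/(k3 ev)/(k11 ev).
      - by move/(k4 ev).
    move=> /orP [/andP [/eqP ev /eqP ->]|].
      exists y, x; split.
      - by rewrite ev; apply/sy/da; rewrite !inE eqxx ?orbT.
      - by rewrite ev; apply/da; rewrite !inE eqxx ?orbT.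
      - by move/(k8 ev).
      - by move/(k1 ev)/(k6 ev).
    move=> /orP [/andP [/eqP ev /eqP ->]|].
      exists z, w; split.
      - by rewrite ev; apply/sy/dc; rewrite !inE eqxx ?orbT.
      - by rewrite ev; apply/dc; rewrite !inE eqxx ?orbT.
      - by move/(k5 ev).
      - by move/(k10 ev)/(k9 ev).
    move=> /orP [/andP [/eqP ev /eqP ->]|].
      exists x, y; split.
      - by rewrite ev; apply/sy/da; rewrite !inE eqxx ?orbT.
      - by rewrite ev; apply/da; rewrite !inE eqxx ?orbT.
      - by move/(k2 ev).
      - by move/(k7 ev)/(k12 ev).
    move=> /orP [/andP [/eqP ev /eqP ->]|].
      exists w, z; split.
      - by rewrite ev; apply/sy/dc; rewrite !inE eqxx ?orbT.
      - by rewrite ev; apply/dc; rewrite !inE eqxx ?orbT.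
      - by move/(k11 ev).
      - by move/(k4 ev)/(k3 ev).
    move=> /orP [/andP [/eqP ev /eqP ->]|/andP [/eqP ev /eqP ->]].
      exists x, y; split.
      - by rewrite ev; apply/sy/da; rewrite !inE eqxx ?orbT.
      - by rewrite ev; apply/da; rewrite !inE eqxx ?orbT.
      - by move/(k12 ev)/(k2 ev).
      - by move/(k7 ev).
    exists z, w; split.
    - by rewrite ev; apply/sy/dc; rewrite !inE eqxx ?orbT.
    - by rewrite ev; apply/dc; rewrite !inE eqxx ?orbT.
    - by move/(k9 ev)/(k5 ev).
    - by move/(k10 ev).
  move=> s t hs ht Ps; have [n1 [n2 [h1 _ so1 _]]] := old s hs.
  have [n3 [n4 [_ h4 _ o4t]]] := old t ht.
  by apply: o4t; apply: (ln v P cl0 n1 n4) => //; apply: so1.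
Qed.

(* The first and third vertices of a face are its diagonal pair; the key also
   records a second vertex, which the joining operation preserves. *)
Definition diagonal (f : face) := [:: nth 0 f 0; nth 0 f 2].
Definition key (f : face) := take 3 f.
Definition diagonals (fs : seq face) := flatten (map diagonal fs).

Lemma key_diagonal f g : key f = key g -> diagonal f = diagonal g.
Proof.
move=> h; have e i : i < 3 -> nth 0 f i = nth 0 g i.
  by move=> i3; rewrite -(nth_take 0 i3 f) -(nth_take 0 i3 g) -/(key f) h.
by rewrite /diagonal !e.
Qed.

Lemma diagonals_cat fs gs : diagonals (fs ++ gs) = diagonals fs ++ diagonals gs.
Proof. by rewrite /diagonals map_cat flatten_cat. Qed.

Lemma diagonals_cons f fs : diagonals (f :: fs) = diagonal f ++ diagonals fs.
Proof. by []. Qed.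

Lemma keys_diagonals fs gs : map key fs = map key gs -> diagonals fs = diagonals gs.
Proof.
elim: fs gs => [|f fs IH] [|g gs] //= [h /IH {}IH].
by rewrite !diagonals_cons (key_diagonal h) IH.
Qed.

(** After a join the face that replaces [p] has the same key and is joined to the next pair, while
    the face that replaces the current [q] waits in [rest]. Every join turns two faces into four. *)
Lemma join_one p qs rest : quad (p :: qs ++ rest) ->
  uniq (diagonal p ++ diagonals qs) ->
  (forall e, cross (diagonal p) (diagonals qs) e ->
     e \notin darts (p :: qs ++ rest)) ->
  exists p' qs' ex,
    [/\ quad (p' :: qs' ++ ex ++ rest), key p' = key p, map key qs' = map key qs,
        size ex = 2 * size qs
      & forall e, (e \in darts (p' :: qs' ++ ex ++ rest)) =
          (e \in darts (p :: qs ++ rest)) || cross (diagonal p) (diagonals qs) e].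
Proof.
elim: qs p rest => [|q qs IH] p rest hq un nocr.
  by exists p, [::], [::]; split => // e; rewrite /cross /= !in_nil !andbF !orbF.
have [/allP f4 _ _ _] := hq.
have /quadfaceE [a [x [b [y ep]]]] : quadface p by apply: f4; rewrite mem_head.
have /quadfaceE [c [z [d [w eq]]]] : quadface q.
  by apply: f4; rewrite !inE eqxx orbT.
move: hq un nocr {f4}; rewrite ep eq {ep eq p q} => hq un nocr.
have un4 : uniq [:: a; b; c; d].
  have : uniq ([:: a; b; c; d] ++ diagonals qs) := un.
  by rewrite cat_uniq => /andP [].
have := join_quad (fs := qs ++ rest) hq un4 _.
have nocr4 e : cross [:: a; b] [:: c; d] e ->
    e \notin darts [:: [:: a; x; b; y], [:: c; z; d; w] & qs ++ rest].
  by move=> he; apply: nocr; rewrite diagonals_cons crossU he.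
move=> /(_ nocr4) hj.
have hd := join_darts a x b y c z d w (qs ++ rest).
pose p1 := [:: a; x; b; c]; pose q1 := [:: c; z; d; a].
pose rest1 := [:: q1; [:: b; y; a; d]; [:: d; w; c; b]] ++ rest.
have hp : perm_eq (faces_join a x b y c z d w ++ (qs ++ rest)) (p1 :: qs ++ rest1).
  by rewrite /rest1 /q1 /p1; perm_count.
have hd' e : (e \in darts (p1 :: qs ++ rest1)) =
    (e \in darts [:: [:: a; x; b; y], [:: c; z; d; w] & qs ++ rest])
    || cross [:: a; b] [:: c; d] e.
  rewrite -(perm_mem (perm_darts hp)) (perm_mem hd) mem_cat orbC; congr (_ || _).
  by case: e => u v; rewrite /cross !inE !xpair_eqE /=; do !case: (_ == _).
have un1 : uniq (diagonal p1 ++ diagonals qs).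
  move: un; rewrite diagonals_cons !cat_uniq => /and3P [-> h /and3P [_ _ ->]].
  by move: h; rewrite has_cat negb_or andbT => /andP [].
have := IH p1 rest1 (quad_perm hp hj) un1.
case=> [e he|p' [qs' [ex [hq' kp kqs sz hm]]]].
  rewrite hd' negb_or; apply/andP; split.
    by apply: nocr; rewrite diagonals_cons crossU he orbT.
  (* The pairs are disjoint, so an edge just added is not among those still to be added. *)
  apply/negP => he4; move: un he he4; case: e => u v.
  rewrite diagonals_cons catA cat_uniq => /and3P [_ /hasPn h _].
  rewrite /cross /=; move: (h u) (h v); rewrite !mem_cat /= !inE.
  by do !case: (_ \in _); do !case: (_ == _) => //=; intuition.
exists p', (q1 :: qs'), ([:: [:: b; y; a; d]; [:: d; w; c; b]] ++ ex).
have hp2 : perm_eq (p' :: qs' ++ ex ++ rest1) (p' :: (q1 :: qs') ++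
    ([:: [:: b; y; a; d]; [:: d; w; c; b]] ++ ex) ++ rest).
  by rewrite ?/rest1 ?/q1; perm_count.
split => //.
- exact: quad_perm hp2 hq'.
- by rewrite /= kqs.
- by rewrite size_cat sz /=; lia.
- move=> e; rewrite -(perm_mem (perm_darts hp2)) hm hd' diagonals_cons crossU.
  by rewrite -orbA.
Qed.

(** The faces of [qs] keep their keys, so each face of [ps] in turn can be joined to all of them; a
    finished face of [ps] waits in [rest]. *)
Lemma join_all ps qs rest : quad (ps ++ qs ++ rest) ->
  uniq (diagonals ps ++ diagonals qs) ->
  (forall e, cross (diagonals ps) (diagonals qs) e ->
     e \notin darts (ps ++ qs ++ rest)) ->
  exists ps' qs' ex,
    [/\ quad (ps' ++ qs' ++ ex ++ rest), map key ps' = map key ps,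
        map key qs' = map key qs, size ex = 2 * (size ps * size qs)
      & forall e, (e \in darts (ps' ++ qs' ++ ex ++ rest)) =
          (e \in darts (ps ++ qs ++ rest)) || cross (diagonals ps) (diagonals qs) e].
Proof.
elim: ps qs rest => [|p ps IH] qs rest hq un nocr.
  by exists [::], qs, [::]; split => // e; rewrite /cross /= ?in_nil ?andbF ?orbF.
have hp : perm_eq ((p :: ps) ++ qs ++ rest) (p :: qs ++ (ps ++ rest)).
  by rewrite /= perm_cons perm_catCA.
have unp : uniq (diagonal p ++ diagonals qs).
  apply: subseq_uniq un; rewrite diagonals_cons.
  exact: cat_subseq (prefix_subseq _ _) (subseq_refl _).
have [|p1 [qs1 [ex1 [hq1 kp1 kqs1 sz1 hm1]]]] :=
  @join_one p qs (ps ++ rest) (quad_perm hp hq) unp.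
  move=> e he; rewrite -(perm_mem (perm_darts hp)); apply: nocr.
  by rewrite diagonals_cons crossUl he.
have hp1 : perm_eq (p1 :: qs1 ++ ex1 ++ ps ++ rest) (ps ++ qs1 ++ (p1 :: ex1 ++ rest)).
  by rewrite ?/rest1 ?/q1; perm_count.
have dqs1 : diagonals qs1 = diagonals qs by apply: keys_diagonals.
have un1 : uniq (diagonals ps ++ diagonals qs1).
  by move: un; rewrite dqs1 diagonals_cons -catA cat_uniq => /and3P [].
have hm1' e : (e \in darts (ps ++ qs1 ++ (p1 :: ex1 ++ rest))) =
    (e \in darts ((p :: ps) ++ qs ++ rest)) || cross (diagonal p) (diagonals qs) e.
  by rewrite -(perm_mem (perm_darts hp1)) hm1 (perm_mem (perm_darts hp)).
have [|ps2 [qs2 [ex2 [hq2 kps2 kqs2 sz2 hm2]]]] :=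
  IH qs1 (p1 :: ex1 ++ rest) (quad_perm hp1 hq1) un1.
  move=> e; rewrite dqs1 => he; rewrite hm1' negb_or; apply/andP; split.
    by apply: nocr; rewrite diagonals_cons crossUl he orbT.
  apply/negP => he4; move: un he he4; case: e => u v.
  rewrite diagonals_cons -catA cat_uniq => /and3P [_ /hasPn h].
  rewrite cat_uniq => /and3P [_ /hasPn h2 _].
  rewrite /cross /=; move: (h u) (h v) (h2 u) (h2 v); rewrite !mem_cat.
  by do !case: (_ \in _) => //=; intuition.
exists (p1 :: ps2), qs2, (ex2 ++ ex1).
have hp2 : perm_eq (ps2 ++ qs2 ++ ex2 ++ p1 :: ex1 ++ rest)
    ((p1 :: ps2) ++ qs2 ++ (ex2 ++ ex1) ++ rest).
  by perm_count.
split => //.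
- exact: quad_perm hp2 hq2.
- by rewrite /= kp1 kps2.
- by rewrite kqs2.
- by rewrite size_cat sz1 sz2 -(size_map key qs1) kqs1 size_map /=; lia.
- move=> e; rewrite -(perm_mem (perm_darts hp2)) hm2 hm1' dqs1 diagonals_cons crossUl.
  by rewrite -orbA.
Qed.

(** * Gluing along a path, disjoint unions and relabelling *)

Lemma mem_darts_cons f fs e :
  (e \in darts (f :: fs)) = (e \in face_darts f) || (e \in darts fs).
Proof. by rewrite darts_cons mem_cat. Qed.

(* Two surfaces are glued along the path c z d of a face of each. *)
Lemma glue_quad c z d w p fs gs :
  quad ([:: c; z; d; w] :: fs) -> quad ([:: d; z; c; p] :: gs) ->
  (forall e, e \in darts ([:: c; z; d; w] :: fs) ->
     e \in darts ([:: d; z; c; p] :: gs) ->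
     e \in [:: (c, z); (z, c); (d, z); (z, d)]) ->
  (forall v x y, (v, x) \in darts ([:: c; z; d; w] :: fs) ->
     (v, y) \in darts ([:: d; z; c; p] :: gs) -> v \in [:: c; z; d]) ->
  let hs := [:: c; p; d; w] :: fs ++ gs in
  quad hs /\ forall e, (e \in darts hs) =
    (e \in darts ([:: c; z; d; w] :: fs)) || (e \in darts ([:: d; z; c; p] :: gs)).
Proof.
move=> hA hB sh sv hs.
have [f4A unA syA lnA] := hA; have [f4B unB syB lnB] := hB.
have inA e : e \in face_darts [:: c; z; d; w] ->
  e \in darts ([:: c; z; d; w] :: fs) by rewrite mem_darts_cons => ->.
have inB e : e \in face_darts [:: d; z; c; p] ->
  e \in darts ([:: d; z; c; p] :: gs) by rewrite mem_darts_cons => ->.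
move: (f4A) (f4B); rewrite /= /quadface /= !inE !negb_or -!andbA.
move=> /and5P [cz cd cw zd /and4P [zw dw _ f4fs]].
move=> /and5P [dz _ dp zc /and4P [zp cp _ f4gs]].
have pw : p != w.
  apply/eqP => epw; have hA1 : (c, w) \in darts ([:: c; z; d; w] :: fs).
    by apply/syA/inA; rewrite !inE eqxx !orbT.
  have hB1 : (c, w) \in darts ([:: d; z; c; p] :: gs).
    by apply: inB; rewrite epw !inE eqxx !orbT.
  have := sh _ hA1 hB1; rewrite !inE !xpair_eqE (negbTE cz) (negbTE cd) eqxx.
  by rewrite (eq_sym w z) (negbTE zw).
have mem e : (e \in darts hs) = (e \in darts ([:: c; z; d; w] :: fs)) ||
    (e \in darts ([:: d; z; c; p] :: gs)).
  rewrite mem_darts_cons darts_cat mem_cat.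
  apply/idP/idP.
    rewrite !mem_darts_cons !inE => /or3P [/or4P [] /eqP -> | -> | ->];
      by rewrite ?eqxx ?orbT.
  (* The darts [(d, z)] and [(z, c)] of the face deleted from the second surface are not lost: their
     reverses bound the face deleted from the first one, so they themselves bound faces of [fs]. *)
  have fA u v : (u, v) \in [:: (z, c); (d, z)] -> (u, v) \in darts fs.
    move=> h; have : (u, v) \in darts ([:: c; z; d; w] :: fs).
      by apply: syA; apply: inA; move: h; rewrite !inE => /orP [] /eqP [-> ->]; rewrite eqxx ?orbT.
    rewrite mem_darts_cons => /orP [] //; move: h; rewrite !inE !xpair_eqE.
    by move=> /orP [] /andP [/eqP -> /eqP ->]; rewrite ?(eq_sym z c) ?(eq_sym d z) ?(eq_sym d c)
       ?(negbTE cz) ?(negbTE cd) ?(negbTE cw) ?(negbTE zd) ?(negbTE zw) ?(negbTE dw) ?andbF ?orbF //=.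
  have fB u v : (u, v) \in [:: (c, z); (z, d)] -> (u, v) \in darts gs.
    move=> h; have : (u, v) \in darts ([:: d; z; c; p] :: gs).
      by apply: syB; apply: inB; move: h; rewrite !inE => /orP [] /eqP [-> ->]; rewrite eqxx ?orbT.
    rewrite mem_darts_cons => /orP [] //; move: h; rewrite !inE !xpair_eqE.
    by move=> /orP [] /andP [/eqP -> /eqP ->]; rewrite ?(eq_sym z d) ?(eq_sym c z) ?(eq_sym d c)
       ?(negbTE dz) ?(negbTE dp) ?(negbTE zc) ?(negbTE zp) ?(negbTE cp) ?(negbTE cd) ?andbF ?orbF //=.
  rewrite !mem_darts_cons => /orP [] /orP [] h; rewrite ?h ?orbT //.
    move: h; rewrite !inE => /or4P [] /eqP ->; rewrite ?eqxx ?orbT //.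
      by rewrite (fB c z) ?inE ?eqxx ?orbT.
    by rewrite (fB z d) ?inE ?eqxx ?orbT.
  move: h; rewrite !inE => /or4P [] /eqP ->; rewrite ?eqxx ?orbT //.
    by rewrite (fA d z) ?inE ?eqxx ?orbT.
  by rewrite (fA z c) ?inE ?eqxx ?orbT.
split => //; split.
- by rewrite /= /quadface /= all_cat f4fs f4gs /= !inE !negb_or cp cd cw
    (eq_sym p d) dp pw dw.
- have pe : perm_eq (darts hs) (([:: (d, w); (w, c)] ++ darts fs) ++
      ([:: (c, p); (p, d)] ++ darts gs)).
    by rewrite /hs darts_cons darts_cat; perm_count.
  rewrite (perm_uniq pe); have := unB; rewrite darts_cons cat_uniq => /and3P [uB0 uB1 uB2].
  have := unA; rewrite darts_cons cat_uniq => /and3P [uA0 uA1 uA2].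
  rewrite cat_uniq; apply/and3P; split.
  + rewrite cat_uniq uA2 andbT; apply/andP; split.
      by rewrite /= !inE xpair_eqE (negbTE dw).
    apply/hasPn => e /(hasPn uA1); apply: contraNN.
    by rewrite !inE => /orP [] ->; rewrite ?orbT.
  + apply/hasPn => e eB; apply/negP => eA.
    have eB' : e \in darts ([:: d; z; c; p] :: gs).
      move: eB; rewrite mem_darts_cons mem_cat !inE.
      by case/orP => [/orP []|] ->; rewrite ?orbT.
    have eA' : e \in darts ([:: c; z; d; w] :: fs).
      move: eA; rewrite mem_darts_cons mem_cat !inE.
      by case/orP => [/orP []|] ->; rewrite ?orbT.
    have := sh e eA' eB'; rewrite !inE => h.
    have nA v : v \in [:: (c, z); (z, d)] -> v \in [:: (d, w); (w, c)] ++ darts fs -> False.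
      move=> hv; rewrite mem_cat => /orP [|/(hasPn uA1)].
        move: hv; rewrite !inE => /orP [] /eqP ->;
        by rewrite !xpair_eqE ?(eq_sym z c) ?(eq_sym d z) ?(negbTE cz)
          ?(negbTE zd) ?(eq_sym d c) ?(negbTE cd) ?andbF.
      by move: hv; rewrite !inE => /orP [] ->; rewrite ?orbT.
    have nB v : v \in [:: (d, z); (z, c)] -> v \in [:: (c, p); (p, d)] ++ darts gs -> False.
      move=> hv; rewrite mem_cat => /orP [|/(hasPn uB1)].
        move: hv; rewrite !inE => /orP [] /eqP ->;
        by rewrite !xpair_eqE ?(eq_sym z c) ?(eq_sym d z) ?(negbTE cz)
          ?(negbTE zd) ?(eq_sym d c) ?(negbTE cd) ?andbF.
      by move: hv; rewrite !inE => /orP [] ->; rewrite ?orbT.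
    by case/or4P: h => h; [apply: (nA e)|apply: (nB e)|apply: (nB e)|apply: (nA e)];
      rewrite // !inE h ?orbT.
  + rewrite cat_uniq uB2 andbT; apply/andP; split.
      by rewrite /= !inE xpair_eqE (negbTE cp).
    apply/hasPn => e /(hasPn uB1); apply: contraNN.
    by rewrite !inE => /orP [] ->; rewrite ?orbT.
- by move=> x y; rewrite !mem => /orP [/syA|/syB] ->; rewrite ?orbT.
- move=> v P cl.
  have cA s t : (v, (s, t)) \in corners fs -> P s -> P t.
    by move=> h; apply: cl; rewrite corners_cons corners_cat !mem_cat h orbT.
  have cB s t : (v, (s, t)) \in corners gs -> P s -> P t.
    by move=> h; apply: cl; rewrite corners_cons corners_cat !mem_cat h !orbT.
  have mj s t u : (u, (s, t)) \in face_corners [:: c; p; d; w] ->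
      v = u -> P s -> P t.
    by move=> h ev; apply: cl; rewrite ev corners_cons mem_cat h.
  have k1 : v = c -> P p -> P w by apply: mj; rewrite !inE eqxx ?orbT.
  have k2 : v = p -> P d -> P c by apply: mj; rewrite !inE eqxx ?orbT.
  have k3 : v = d -> P w -> P p by apply: mj; rewrite !inE eqxx ?orbT.
  have k4 : v = w -> P c -> P d by apply: mj; rewrite !inE eqxx ?orbT.
  (* [okA] and [okB] are the rotation steps at the corners [c], [z], [d] of the two deleted faces.
     In the glued surface each of them becomes a detour through the rotation of the other
     surface. *)
  pose okA := [/\ v = c -> P z -> P w, v = z -> P d -> P c & v = d -> P w -> P z].
  pose okB := [/\ v = d -> P z -> P p, v = z -> P c -> P d & v = c -> P p -> P z].
  have hokA : okA -> forall x y, (v, x) \in darts ([:: c; z; d; w] :: fs) ->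
      (v, y) \in darts ([:: c; z; d; w] :: fs) -> P x -> P y.
    move=> [a1 a2 a3]; apply: lnA => x y; rewrite corners_cons mem_cat => /orP [|/cA //].
    by rewrite !inE => /or4P [] /eqP [ev -> ->]; [exact: a1|exact: a2|exact: a3|exact: k4].
  have hokB : okB -> forall x y, (v, x) \in darts ([:: d; z; c; p] :: gs) ->
      (v, y) \in darts ([:: d; z; c; p] :: gs) -> P x -> P y.
    move=> [a1 a2 a3]; apply: lnB => x y; rewrite corners_cons mem_cat => /orP [|/cB //].
    by rewrite !inE => /or4P [] /eqP [ev -> ->]; [exact: a1|exact: a2|exact: a3|exact: k2].
  have dA s t : (s, t) \in face_darts [:: c; z; d; w] ->
      (s, t) \in darts ([:: c; z; d; w] :: fs) by exact: inA.
  have dB s t : (s, t) \in face_darts [:: d; z; c; p] ->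
      (s, t) \in darts ([:: d; z; c; p] :: gs) by exact: inB.
  have [dcz dcw] : (c, z) \in darts ([:: c; z; d; w] :: fs) /\
      (c, w) \in darts ([:: c; z; d; w] :: fs).
    by split; [apply: dA|apply/syA/dA]; rewrite !inE eqxx ?orbT.
  have [ddz ddw] : (d, z) \in darts ([:: c; z; d; w] :: fs) /\
      (d, w) \in darts ([:: c; z; d; w] :: fs).
    by split; [apply/syA/dA|apply/dA]; rewrite !inE eqxx ?orbT.
  have [dzc dzd] : (z, c) \in darts ([:: c; z; d; w] :: fs) /\
      (z, d) \in darts ([:: c; z; d; w] :: fs).
    by split; [apply/syA/dA|apply/dA]; rewrite !inE eqxx ?orbT.
  have [ecz ecp] : (c, z) \in darts ([:: d; z; c; p] :: gs) /\
      (c, p) \in darts ([:: d; z; c; p] :: gs).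
    by split; [apply/syB/dB|apply/dB]; rewrite !inE eqxx ?orbT.
  have [edz edp] : (d, z) \in darts ([:: d; z; c; p] :: gs) /\
      (d, p) \in darts ([:: d; z; c; p] :: gs).
    by split; [apply/dB|apply/syB/dB]; rewrite !inE eqxx ?orbT.
  have [ezc ezd] : (z, c) \in darts ([:: d; z; c; p] :: gs) /\
      (z, d) \in darts ([:: d; z; c; p] :: gs).
    by split; [apply/dB|apply/syB/dB]; rewrite !inE eqxx ?orbT.
  (* The detours depend on each other. The truth value of [P] at a shared neighbour ([z], or [c]
     when [v] is [z]) makes one of [okA] and [okB] trivial; closure in that surface then yields the
     other. *)
  have [oA oB] : okA /\ okB.
    have [ev|vc] := eqVneq v c.
      have vd : v <> d by rewrite ev; apply/eqP.
      have vz : v <> z by rewrite ev; apply/eqP.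
      have := hokA; have := hokB; rewrite ev => hB0 hA0.
      case Pz: (P z).
        have oB : okB by split.
        have Pp : P p by apply: hB0 oB z p ecz ecp Pz.
        by split => //; split => // _ _; apply: k1.
      have oA : okA by split => //; rewrite Pz.
      split => //; split => // _ Pp.
      by apply: (hA0 oA w z dcw dcz); apply: k1.
    have [ev|vd] := eqVneq v d.
      have vc' : v <> c by apply/eqP.
      have vz : v <> z by rewrite ev; apply/eqP.
      have := hokA; have := hokB; rewrite ev => hB0 hA0.
      case Pz: (P z).
        have oA : okA by split.
        have Pw : P w by apply: hA0 oA z w ddz ddw Pz.
        by split => //; split => // _ _; apply: k3.
      have oB : okB by split => //; rewrite Pz.
      split => //; split => // _ Pw.
      by apply: (hB0 oB p z edp edz); apply: k3.
    have vc' : v <> c by apply/eqP.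
    have vd' : v <> d by apply/eqP.
    have [ev|vz] := eqVneq v z; last first.
      by split; split => // ev; move: vz; rewrite ev eqxx.
    have := hokA; have := hokB; rewrite ev => hB0 hA0.
    case Pc: (P c).
      have oA : okA by split; rewrite ?Pc.
      split => //; split => // _ _.
      exact: hA0 oA c d dzc dzd Pc.
    have oB : okB by split; rewrite ?Pc.
    split => //; split => // _ Pd.
    by have := hB0 oB d c ezd ezc Pd; rewrite Pc.
  have {}hokA := hokA oA; have {}hokB := hokB oB.
  (* A vertex of both surfaces lies on the glued path and thus has a common neighbour, through which
     [P] passes from one surface to the other. *)
  have common x y : (v, x) \in darts ([:: c; z; d; w] :: fs) ->
      (v, y) \in darts ([:: d; z; c; p] :: gs) ->
      exists2 m, (v, m) \in darts ([:: c; z; d; w] :: fs)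
        & (v, m) \in darts ([:: d; z; c; p] :: gs).
    move=> hx hy; have := sv _ _ _ hx hy; rewrite !inE => /or3P [] /eqP ->.
    - by exists z.
    - by exists c.
    - by exists z.
  move=> x y; rewrite !mem => /orP [] hx /orP [] hy Px.
  - exact: hokA hx hy Px.
  - have [m mA mB] := common _ _ hx hy.
    by apply: hokB mB hy _; apply: hokA hx mA Px.
  - have [m mA mB] := common _ _ hy hx.
    by apply: hokA mA hy _; apply: hokB hx mB Px.
  - exact: hokB hx hy Px.
Qed.

Lemma disjoint_quad fs gs : quad fs -> quad gs ->
  (forall v x y, (v, x) \in darts fs -> (v, y) \notin darts gs) -> quad (fs ++ gs).
Proof.
move=> [f4A unA syA lnA] [f4B unB syB lnB] dis; split.
- by rewrite all_cat f4A f4B.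
- rewrite darts_cat cat_uniq unA unB andbT; apply/hasPn => -[u v] h.
  by apply/negP => /dis h2; have := h2 v; rewrite h.
- by move=> x y; rewrite !darts_cat !mem_cat => /orP [/syA|/syB] ->; rewrite ?orbT.
- move=> v P cl x y; rewrite !darts_cat !mem_cat => /orP [] hx /orP [] hy.
  + apply: lnA hx hy => {}x {}y h; apply: cl.
    by rewrite corners_cat mem_cat h.
  + by have := dis _ _ y hx; rewrite hy.
  + by have := dis _ _ x hy; rewrite hx.
  + apply: lnB hx hy => {}x {}y h; apply: cl.
    by rewrite corners_cat mem_cat h orbT.
Qed.

Definition relabel (s : nat -> nat) (fs : seq face) := map (map s) fs.

Lemma relabel_darts s fs : all quadface fs ->
  darts (relabel s fs) = [seq (s e.1, s e.2) | e <- darts fs].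
Proof.
elim: fs => //= f fs IH /andP [/quadfaceE [a [b [c [d ->]]]] /IH h].
by rewrite !darts_cons map_cat h.
Qed.

Lemma relabel_corners s fs : all quadface fs ->
  corners (relabel s fs) = [seq (s e.1, (s e.2.1, s e.2.2)) | e <- corners fs].
Proof.
elim: fs => //= f fs IH /andP [/quadfaceE [a [b [c [d ->]]]] /IH h].
by rewrite !corners_cons map_cat h.
Qed.

Lemma mem_face_dart f x : quadface f -> x \in f -> exists y, (x, y) \in face_darts f.
Proof.
move=> /quadfaceE [a [b [c [d ->]]]]; rewrite !inE => /or4P [] /eqP ->.
- by exists b; rewrite !inE eqxx.
- by exists c; rewrite !inE eqxx !orbT.
- by exists d; rewrite !inE eqxx !orbT.
- by exists a; rewrite !inE eqxx !orbT.
Qed.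

Definition labels_lt n (fs : seq face) := all (all (fun v => v < n)) fs.

Lemma labels_darts n fs x y : labels_lt n fs -> all quadface fs ->
  (x, y) \in darts fs -> (x < n) && (y < n).
Proof.
move=> /allP ln /allP f4 /flatten_mapP [f hf]; have /allP lf := ln f hf.
have [a [b [c [d ef]]]] := quadfaceE (f4 _ hf).
by rewrite ef !inE => /or4P [] /eqP [-> ->]; rewrite !lf // ef !inE eqxx ?orbT.
Qed.

Lemma corner_darts fs v x y : all quadface fs -> (v, (x, y)) \in corners fs ->
  (v, x) \in darts fs /\ (y, v) \in darts fs.
Proof.
move=> /allP f4 /flatten_mapP [f hf]; have [a [b [c [d ef]]]] := quadfaceE (f4 _ hf).
have dj u w : (u, w) \in face_darts f -> (u, w) \in darts fs.
  by move=> h; apply/flatten_mapP; exists f.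
by rewrite ef !inE => /or4P [] /eqP [-> -> ->]; split; apply: dj;
  rewrite ef !inE eqxx ?orbT.
Qed.

Lemma relabel_quad n s fs : quad fs -> labels_lt n fs ->
  {in gtn n &, injective s} -> quad (relabel s fs).
Proof.
move=> [f4 un sy ln] lab sinj; have f4' := f4.
have labd x y : (x, y) \in darts fs -> x \in gtn n /\ y \in gtn n.
  by move=> /(labels_darts lab f4) /andP [].
split.
- rewrite all_map; apply/allP => f hf /=; have /andP [sf uf] := allP f4 _ hf.
  rewrite /quadface size_map sf map_inj_in_uniq ?uf // => x y hx hy.
  by apply: sinj; have /allP := allP lab _ hf; apply.
- rewrite relabel_darts // map_inj_in_uniq // => -[x y] [u v] /labd [hx hy] /labd [hu hv].
  by move=> [] /(sinj _ _ hx hu) -> /(sinj _ _ hy hv) ->.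
- move=> x y; rewrite relabel_darts // => /mapP [[u v] h [-> ->]].
  by apply/mapP; exists (v, u) => //; apply: sy.
- move=> v P cl x y; rewrite relabel_darts // => /mapP [[u x0] hx [ev ->]].
  move=> /mapP [[u' y0] hy [ev' ->]].
  have eu : u' = u by apply: sinj; rewrite -?ev -?ev' //; [case: (labd _ _ hy)|case: (labd _ _ hx)].
  move: hy; rewrite {u' ev'}eu => hy; apply: (ln u (fun z => P (s z))) hx hy => x1 y1 h1.
  apply: cl; rewrite relabel_corners // ev.
  by apply/mapP; exists (u, (x1, y1)).
Qed.

(** * Checking explicit lists of faces *)

Definition rotation_step (cs : seq (nat * (nat * nat))) v x :=
  (nth (0, (0, 0)) cs (find (fun c => (c.1 == v) && (c.2.1 == x)) cs)).2.2.

(** The link condition becomes decidable by following the rotation from each neighbour; [n] entries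
    suffice because a vertex has fewer than [n] neighbours. *)
Definition quadb (n : nat) (fs : seq face) :=
  [&& all quadface fs, labels_lt n fs, uniq (darts fs),
      all (fun e => (e.2, e.1) \in darts fs) (darts fs)
    & all (fun e => all (fun g => (g.1 != e.1) ||
        (g.2 \in traject (rotation_step (corners fs) e.1) e.2 n)) (darts fs))
      (darts fs)].

Lemma quadbP n fs : quadb n fs -> quad fs /\ labels_lt n fs.
Proof.
move=> /and5P [f4 lab un /allP sy /allP ln]; split => //; split => //.
  by move=> x y /sy.
move=> v P cl x y hx hy Px.
have /allP /(_ _ hy) := ln _ hx; rewrite /= eqxx /=.
set r := rotation_step _ v.
have ok k : (v, iter k r x) \in darts fs /\ P (iter k r x).
  elim: k => [|k [IH1 IH2]] //=.
  set z := iter k r x in IH1 IH2 *.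
  have hs : has (fun c => (c.1 == v) && (c.2.1 == z)) (corners fs).
    have /flatten_mapP [f hf hz] := IH1; apply/hasP.
    have [a [b [c [d ef]]]] := quadfaceE (allP f4 _ hf).
    have cj u : u \in face_corners f -> u \in corners fs.
      by move=> h; apply/flatten_mapP; exists f.
    move: hz; rewrite ef !inE => /or4P [] /eqP [-> ->].
    - by exists (a, (b, d)); rewrite /= ?eqxx //; apply: cj; rewrite ef !inE eqxx ?orbT.
    - by exists (b, (c, a)); rewrite /= ?eqxx //; apply: cj; rewrite ef !inE eqxx ?orbT.
    - by exists (c, (d, b)); rewrite /= ?eqxx //; apply: cj; rewrite ef !inE eqxx ?orbT.
    - by exists (d, (a, c)); rewrite /= ?eqxx //; apply: cj; rewrite ef !inE eqxx ?orbT.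
  have := nth_find (0, (0, 0)) hs; have := hs; rewrite has_find => /(mem_nth (0, (0, 0))).
  rewrite /r /rotation_step; case: (nth _ _ _) => v1 [z1 z2] /= hc /andP [/eqP e1 /eqP e2].
  rewrite e1 e2 in hc; have [_ h2] := corner_darts f4 hc.
  split; first by apply: sy h2.
  exact: cl hc IH2.
by move=> /trajectP [k _ ->]; case: (ok k).
Qed.

(** * Partial joins and extension by a glued piece *)

(** With [skip] the heads of [ps] and [qs] are not joined to each other: the tail of [ps] is joined
    to all of [qs], and then the head of [ps] to the tail of [qs]. The darts are only bounded from
    both sides, so that both values of [skip] share one statement; the size of [ex] carries the
    exact count. *)
Lemma join_some (skip : bool) ps qs rest : quad (ps ++ qs ++ rest) ->
  uniq (diagonals ps ++ diagonals qs) ->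
  (forall e, cross (diagonals ps) (diagonals qs) e ->
     e \notin darts (ps ++ qs ++ rest)) ->
  (skip -> ps != [::] /\ qs != [::]) ->
  exists ps' qs' ex,
    [/\ quad (ps' ++ qs' ++ ex ++ rest), map key ps' = map key ps,
        map key qs' = map key qs, size ex = 2 * (size ps * size qs - skip)
      & forall e, (e \in darts (ps ++ qs ++ rest) ->
           e \in darts (ps' ++ qs' ++ ex ++ rest)) /\
         (e \in darts (ps' ++ qs' ++ ex ++ rest) ->
           (e \in darts (ps ++ qs ++ rest)) || cross (diagonals ps) (diagonals qs) e)].
Proof.
move=> hq un nocr; case: skip => [/(_ isT) [] |_]; last first.
  have [ps' [qs' [ex [h1 h2 h3 h4 h5]]]] := join_all hq un nocr.
  exists ps', qs', ex; split => //; first by rewrite subn0.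
  by move=> e; rewrite h5; split => // ->.
case: ps hq un nocr => // p ps; case: qs => // q qs hq un nocr _ _.
have hp : perm_eq ((p :: ps) ++ (q :: qs) ++ rest) (ps ++ (q :: qs) ++ p :: rest).
  by perm_count.
have un1 : uniq (diagonals ps ++ diagonals (q :: qs)).
  by move: un; rewrite diagonals_cons -catA cat_uniq => /and3P [].
have [|ps1 [qs1 [ex1 [hq1 kps1 kqs1 sz1 hm1]]]] := join_all (quad_perm hp hq) un1.
  move=> e he; rewrite -(perm_mem (perm_darts hp)); apply: nocr.
  by rewrite diagonals_cons crossUl he orbT.
case: qs1 hq1 kqs1 hm1 => // q1 qs1 hq1 [kq1 kqs1] hm1.
have hp1 : perm_eq (ps1 ++ (q1 :: qs1) ++ ex1 ++ p :: rest)
    (p :: qs1 ++ q1 :: ps1 ++ ex1 ++ rest) by perm_count.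
have dqs1 : diagonals qs1 = diagonals qs by apply: keys_diagonals.
have un2 : uniq (diagonal p ++ diagonals qs1).
  apply: subseq_uniq un; rewrite dqs1 !diagonals_cons -catA.
  by apply: cat_subseq => //; rewrite catA; apply: suffix_subseq.
have hm1' e : (e \in darts (p :: qs1 ++ q1 :: ps1 ++ ex1 ++ rest)) =
    (e \in darts ((p :: ps) ++ (q :: qs) ++ rest))
    || cross (diagonals ps) (diagonals (q :: qs)) e.
  by rewrite -(perm_mem (perm_darts hp1)) hm1 (perm_mem (perm_darts hp)).
have [|p2 [qs2 [ex2 [hq2 kp2 kqs2 sz2 hm2]]]] := join_one (quad_perm hp1 hq1) un2.
  move=> e; rewrite dqs1 => he; rewrite hm1' negb_or; apply/andP; split.
    by apply: nocr; rewrite !diagonals_cons crossUl crossU he orbT.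
  apply/negP => he4; move: un he he4; case: e => u v.
  rewrite !diagonals_cons -catA cat_uniq => /and3P [_ /hasPn h].
  rewrite cat_uniq => /and3P [_ /hasPn h2 _].
  rewrite /cross; move: (h u) (h v) (h2 u) (h2 v); rewrite !mem_cat.
  by do !case: (_ \in _) => //=; intuition.
have hp2 : perm_eq (p2 :: qs2 ++ ex2 ++ q1 :: ps1 ++ ex1 ++ rest)
    ((p2 :: ps1) ++ (q1 :: qs2) ++ (ex2 ++ ex1) ++ rest) by perm_count.
exists (p2 :: ps1), (q1 :: qs2), (ex2 ++ ex1); split.
- exact: quad_perm hp2 hq2.
- by rewrite /= kp2 kps1.
- by rewrite /= kq1 kqs2 kqs1.
- by rewrite size_cat sz1 sz2 -(size_map key qs1) kqs1 size_map /=; lia.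
- move=> e; rewrite -(perm_mem (perm_darts hp2)) hm2 hm1' dqs1.
  split=> [->//|]; rewrite -orbA => /orP [->//|/orP [] h]; apply/orP; right.
    by rewrite (diagonals_cons p) crossUl h orbT.
  by rewrite !diagonals_cons crossUl crossU h !orbT.
Qed.

Lemma darts_labels n fs : all quadface fs ->
  (forall x y, (x, y) \in darts fs -> x < n) -> labels_lt n fs.
Proof.
move=> /allP f4 h; apply/allP => f hf; apply/allP => x hx.
have [y hy] := mem_face_dart (f4 _ hf) hx.
by apply: (h x y); apply/flatten_mapP; exists f.
Qed.

(** The path 1, 0, 2 of the new piece is laid on [d], [z], [c], against the direction [c], [z], [d]
    of the old face, as [glue_quad] requires. The other labels follow the old ones without a gap. *)
Definition glue_label (n c z d i : nat) : nat :=
  match i with 0 => z | 1 => d | 2 => c | i'.+3 => n + i' end.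

Lemma glue_label_inj n c z d : c < n -> z < n -> d < n ->
  c != z -> c != d -> z != d -> injective (glue_label n c z d).
Proof. by move=> cn zn dn cz cd zd [|[|[|i]]] [|[|[|j]]] //=; lia. Qed.

Lemma glue_label_new n c z d i : c < n -> z < n -> d < n ->
  (n <= glue_label n c z d i) = (2 < i).
Proof. by move=> cn zn dn; case: i => [|[|[|i]]] //=; lia. Qed.

Lemma glue_label_lt n c z d m i : c < n -> z < n -> d < n -> i < m ->
  glue_label n c z d i < n + (m - 3).
Proof. by move=> cn zn dn; case: i => [|[|[|i]]] //=; lia. Qed.

Lemma relabel_cat s fs gs : relabel s (fs ++ gs) = relabel s fs ++ relabel s gs.
Proof. exact: map_cat. Qed.

Lemma relabel_diagonals s fs : all quadface fs ->
  diagonals (relabel s fs) = map s (diagonals fs).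
Proof.
elim: fs => //= f fs IH /andP [/quadfaceE [a [b [c [d ->]]]] /IH h].
by rewrite !diagonals_cons h.
Qed.

(** The pair of [c] and [d] takes no part in the joins; its edges to the new vertices have to come
    from [B]. If [z] is paired, the joins give it all its new edges but perhaps those of the skipped
    join, so [B] must then give it none: otherwise an edge could be added twice. *)
Lemma extend n c z d w ps rest nB p qs rB (skip : bool) :
  let A := [:: c; z; d; w] :: ps ++ rest in
  let B := [:: 1; 0; 2; p] :: qs ++ rB in
  let s := glue_label n c z d in
  quad A -> labels_lt n A -> uniq (c :: d :: diagonals ps) ->
  quad B -> labels_lt nB B -> (1, 2) \notin darts B ->
  uniq (diagonals qs) -> all (leq 3) (diagonals qs) ->
  (forall v, 2 < v -> (0, v) \in darts B -> z \notin diagonals ps) ->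
  (skip -> ps != [::] /\ qs != [::]) ->
  exists p' ps' qs' ex,
    let C := [:: c; p'; d; w] :: ps' ++ qs' ++ ex in
    [/\ quad C, labels_lt (n + (nB - 3)) C,
        map key ps' = map key ps, map key qs' = map key (relabel s qs)
      & size ex = size rest + size rB + 2 * (size ps * size qs - skip) /\
        (forall x y, ((x, y) \in darts A -> (x, y) \in darts C) /\
           ((x, y) \in darts B -> (s x, s y) \in darts C))].
Proof.
move=> A B s hA labA undps hB labB n12 unqs qs3 hz hskip.
have [f4A _ syA _] := hA; have [f4B _ syB _] := hB.
have labdA x y : (x, y) \in darts A -> (x < n) && (y < n) by apply: labels_darts.
have labdB x y : (x, y) \in darts B -> (x < nB) && (y < nB) by apply: labels_darts.
have inA x y : (x, y) \in face_darts [:: c; z; d; w] -> (x, y) \in darts A.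
  by rewrite mem_darts_cons => ->.
have /andP [cn zn] : (c < n) && (z < n) by apply: labdA; apply: inA; rewrite !inE eqxx.
have /andP [_ dn] : (z < n) && (d < n).
  by apply: labdA; apply: inA; rewrite !inE eqxx orbT.
have [cz [cd zd]] : c != z /\ c != d /\ z != d.
  move: f4A; rewrite /= /quadface /= !inE !negb_or -!andbA => /and5P [-> -> _ ->]; by [].
have sinj : injective s by apply: glue_label_inj.
have hsB : quad (relabel s B) by apply: relabel_quad hB labB _ => x y _ _; apply: sinj.
have snew i : (n <= s i) = (2 < i) by apply: glue_label_new.
have sold i : s i < n -> s i \in [:: c; z; d].
  by rewrite ltnNge snew -leqNgt; case: i => [|[|[|i]]] //; rewrite !inE eqxx ?orbT.
have slt i : i < nB -> s i < n + (nB - 3) by apply: glue_label_lt.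
have memsB x y : (x, y) \in darts (relabel s B) ->
    exists i j, [/\ (i, j) \in darts B, x = s i & y = s j].
  rewrite relabel_darts // => /mapP [[i j] h [-> ->]]; by exists i, j.
have insB i j : (i, j) \in darts B -> (s i, s j) \in darts (relabel s B).
  by move=> h; rewrite relabel_darts //; apply/mapP; exists (i, j).
have n21 : (2, 1) \notin darts B by apply: contra n12 => /syB.
have [||hglue memglue] :=
  @glue_quad c z d w (s p) (ps ++ rest) (relabel s (qs ++ rB)) hA hsB.
- move=> [x y] /labdA /andP [xn yn] /memsB [i [j [hij ex ey]]].
  have := quad_neq hB hij; move: xn yn; rewrite ex ey => /= xn yn.
  (* A dart common to both pieces has its ends among the labels 0, 1, 2 of [B], and [n12] leaves
     only the darts of the glued path. *)
  have i2 : i < 3 by rewrite ltnNge -snew -ltnNge.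
  have j2 : j < 3 by rewrite ltnNge -snew -ltnNge.
  move: hij; clear ex ey xn yn x y.
  case: i i2 => [|[|[|i]]] //; case: j j2 => [|[|[|j]]] //= _ _ hij _;
    rewrite ?inE ?eqxx ?orbT //; by [move: n12; rewrite hij|move: n21; rewrite hij].
- move=> v x y /labdA /andP [vn _] /memsB [i [j [_ ev _]]].
  by rewrite ev; apply: sold; rewrite -ev.
set G := [:: c; s p; d; w] :: _ ++ _ in hglue memglue.
have hpG : perm_eq G (ps ++ relabel s qs ++ ([:: c; s p; d; w] :: rest ++ relabel s rB)).
  by rewrite /G relabel_cat; perm_count.
have f4qs : all quadface qs.
  by move: f4B => /= /andP [_]; rewrite all_cat => /andP [].
have dqs : diagonals (relabel s qs) = map s (diagonals qs) by apply: relabel_diagonals.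
have psn x : x \in diagonals ps -> x < n.
  move=> /flatten_mapP [f hf hx]; have hfA : f \in A by rewrite inE mem_cat hf orbT.
  have := allP f4A _ hfA => /quadfaceE [a1 [a2 [a3 [a4 ef]]]].
  have /allP := allP labA _ hfA; apply.
  by move: hx; rewrite ef /diagonal /= !inE => /orP [] /eqP ->; rewrite eqxx ?orbT.
have qsn x : x \in diagonals (relabel s qs) -> n <= x.
  by rewrite dqs => /mapP [i /(allP qs3) i3 ->]; rewrite snew.
have un : uniq (diagonals ps ++ diagonals (relabel s qs)).
  rewrite cat_uniq; apply/and3P; split.
  - by move: undps => /= /and3P [].
  - by apply/hasPn => x /qsn nx; apply/negP => /psn; rewrite ltnNge nx.
  - by rewrite dqs map_inj_uniq.
have nocr0 x y : x \in diagonals ps -> y \in diagonals (relabel s qs) ->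
    (x, y) \notin darts G.
  move=> hx hy; rewrite memglue negb_or; apply/andP; split.
    by apply/negP => /labdA /andP [_]; rewrite ltnNge qsn.
  apply/negP => /memsB [i [j [hij ex ey]]].
  have j3 : 2 < j by rewrite -snew -ey; apply: qsn.
  have xn := psn _ hx; have := undps; rewrite /= inE negb_or => /and3P [/andP [_ cps] dps _].
  have : x \in [:: c; z; d] by rewrite ex; apply: sold; rewrite -ex.
  rewrite !inE => /or3P [] /eqP exx.
  - by move: cps; rewrite -exx hx.
  - have i0 : i = 0 by apply: sinj; rewrite -ex exx.
    by have := hz j j3; rewrite -i0 hij => /(_ isT); rewrite -exx hx.
  - by move: dps; rewrite -exx hx.
have syG : forall x y, (x, y) \in darts G -> (y, x) \in darts G by case: hglue.
have hG := quad_perm hpG hglue.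
have hskip' : skip -> ps != [::] /\ relabel s qs != [::].
  by move=> /hskip [-> q0]; split => //; case: (qs) q0.
have [|ps' [qs' [ex [hq kps kqs sz hm]]]] := join_some hG un _ hskip'.
  move=> [x y]; rewrite -(perm_mem (perm_darts hpG)) /cross /= => /orP [] /andP [hx hy].
    exact: nocr0.
  by apply/negP => /syG; apply/negP/nocr0.
exists (s p), ps', qs', (ex ++ rest ++ relabel s rB).
have hpC : perm_eq (ps' ++ qs' ++ ex ++ [:: c; s p; d; w] :: rest ++ relabel s rB)
   ([:: c; s p; d; w] :: ps' ++ qs' ++ ex ++ rest ++ relabel s rB) by perm_count.
have hC := quad_perm hpC hq.
split => //.
- have [f4C _ syC _] := hC; apply: darts_labels => // x y.
  rewrite -(perm_mem (perm_darts hpC)) => /(proj2 (hm _)).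
  rewrite -(perm_mem (perm_darts hpG)) memglue -orbA => /or3P [/labdA /andP [xn _]||].
  + exact: leq_trans xn (leq_addr _ _).
  + by move=> /memsB [i [j [/labdB /andP [hi _] -> _]]]; apply: slt.
  + have hy v : v \in diagonals (relabel s qs) -> v < n + (nB - 3).
      rewrite dqs => /mapP [i hi ->]; apply: slt.
      move: hi => /flatten_mapP [f hf hx]; have hfB : f \in B by rewrite inE mem_cat hf orbT.
      have := allP f4B _ hfB => /quadfaceE [a1 [a2 [a3 [a4 ef]]]].
      have /allP := allP labB _ hfB; apply.
      by move: hx; rewrite ef /diagonal /= !inE => /orP [] /eqP ->; rewrite eqxx ?orbT.
    by rewrite /cross /= => /orP [] /andP [h1 h2]; [exact: leq_trans (psn _ h1) (leq_addr _ _)|exact: hy].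
- split; first by rewrite !size_cat sz !size_map addnC.
  move=> x y; rewrite -!(perm_mem (perm_darts hpC)).
  split=> h; apply: (proj1 (hm _)); rewrite -(perm_mem (perm_darts hpG)) memglue.
    by rewrite h.
  by rewrite insB ?orbT.
Qed.

(* A dominating vertex 0 and disjoint pairs of vertices, each the diagonal of
   its own face, covering all vertices (or all but 0 if [o]); the vertex 0 lies
   on a known side of the first face. *)
Definition paired (o : bool) (n t : nat) (fs : seq face) : Prop :=
  exists c z d w ps rest,
    [/\ fs = [:: c; z; d; w] :: ps ++ rest, quad fs /\ labels_lt n fs,
        perm_eq (nseq o 0 ++ diagonals ([:: c; z; d; w] :: ps)) (iota 0 n),
        (if o then z else c) = 0
      & (forall v, 0 < v < n -> (0, v) \in darts fs) /\
        4 * size fs + 2 * t = n * n.-1].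

Definition pairable o n t := exists fs, paired o n t fs.

(** The first [k.+1] faces carry the pairs. As a number, [o] is the position of the vertex 0 in the
    head face; the default 1 makes the test fail on an empty list. *)
Definition pairedb (o : bool) (n t k : nat) (fs : seq face) :=
  let f0 := head [::] fs in
  [&& quadb n fs, perm_eq (nseq o 0 ++ diagonals (take k.+1 fs)) (iota 0 n),
      nth 1 f0 o == 0, all (fun v => (0, v) \in darts fs) (iota 1 n.-1)
    & 4 * size fs + 2 * t == n * n.-1].

Lemma pairedbP o n t k fs : fs != [::] -> pairedb o n t k fs -> pairable o n t.
Proof.
case: fs => // f0 fs _ /and5P [/quadbP [hq hl] hp /eqP h0 /allP hd /eqP hc].
exists (f0 :: fs); have [/= /andP [f4 _] _ _ _] := hq.
have [c [z [d [w ef]]]] := quadfaceE f4.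
exists c, z, d, w, (take k fs), (drop k fs); rewrite -ef cat_take_drop; split => //.
- by move: h0; rewrite ef; case: (o).
- split => // v /andP [v0 vn]; apply: hd; rewrite mem_iota; lia.
Qed.

Lemma size_diagonals fs : size (diagonals fs) = 2 * size fs.
Proof. by elim: fs => // f fs IH; rewrite diagonals_cons size_cat IH /=; lia. Qed.

(* Found by computer search. K7 lacks the edges 12, 34, 35, K11 lacks 12, and
   K8' lacks four edges; 12 is left out because 1 and 2 get identified with
   vertices that may already be adjacent. *)
Definition K5 : seq face :=
  [:: [:: 1; 0; 2; 3]; [:: 3; 2; 4; 0]; [:: 0; 4; 1; 2]; [:: 3; 4; 2; 1];
      [:: 0; 1; 4; 3]].

Definition K23 : seq face := [:: [:: 1; 0; 2; 4]; [:: 3; 1; 4; 2]; [:: 2; 0; 1; 3]].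

Definition K7 : seq face :=
  [:: [:: 1; 0; 2; 6]; [:: 3; 0; 4; 2]; [:: 5; 4; 6; 2]; [:: 4; 5; 0; 1];
      [:: 1; 5; 2; 4]; [:: 6; 0; 3; 1]; [:: 3; 2; 0; 6]; [:: 6; 5; 1; 3];
      [:: 6; 4; 0; 5]].

Definition K8 : seq face :=
  [:: [:: 0; 3; 1; 7]; [:: 2; 1; 3; 7]; [:: 4; 1; 5; 2]; [:: 6; 2; 7; 4];
      [:: 5; 3; 6; 7]; [:: 6; 3; 0; 1]; [:: 5; 6; 1; 4]; [:: 5; 1; 2; 3];
      [:: 7; 3; 4; 0]; [:: 7; 1; 0; 5]; [:: 3; 2; 5; 4]; [:: 6; 0; 4; 7];
      [:: 2; 0; 6; 4]; [:: 6; 5; 0; 2]].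

Definition K8' : seq face :=
  [:: [:: 0; 3; 1; 4]; [:: 2; 6; 3; 5]; [:: 4; 6; 5; 3]; [:: 6; 2; 7; 5];
      [:: 2; 5; 1; 0]; [:: 2; 4; 1; 7]; [:: 4; 2; 0; 7]; [:: 0; 5; 7; 3];
      [:: 0; 4; 3; 7]; [:: 1; 3; 6; 0]; [:: 6; 4; 7; 1]; [:: 6; 1; 5; 0]].

Definition K11 : seq face :=
  [:: [:: 1; 0; 2; 5]; [:: 3; 0; 4; 2]; [:: 5; 3; 6; 0]; [:: 7; 3; 8; 2];
      [:: 9; 5; 10; 0]; [:: 0; 1; 10; 7]; [:: 10; 1; 4; 6]; [:: 1; 7; 8; 4];
      [:: 7; 1; 6; 4]; [:: 6; 1; 9; 8]; [:: 1; 8; 0; 3]; [:: 8; 1; 5; 4];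
      [:: 1; 3; 10; 9]; [:: 8; 10; 2; 6]; [:: 10; 8; 7; 9]; [:: 0; 8; 3; 2];
      [:: 2; 8; 5; 9]; [:: 8; 9; 3; 5]; [:: 4; 3; 7; 10]; [:: 10; 5; 7; 2];
      [:: 7; 6; 9; 0]; [:: 0; 10; 6; 5]; [:: 0; 6; 7; 4]; [:: 9; 6; 2; 4];
      [:: 4; 10; 3; 9]; [:: 2; 9; 7; 5]; [:: 3; 4; 5; 6]].

Lemma pairable5 : pairable true 5 0.
Proof. exact: (@pairedbP _ _ _ 1 K5). Qed.

Lemma pairable7 : pairable true 7 3.
Proof. exact: (@pairedbP _ _ _ 2 K7). Qed.

Lemma pairable11 : pairable true 11 1.
Proof. by apply: (@pairedbP _ _ _ 4 K11) => //; vm_compute. Qed.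

Lemma pairable8 : pairable false 8 0.
Proof. by apply: (@pairedbP _ _ _ 3 K8) => //; vm_compute. Qed.

Lemma pairable8' : pairable false 8 4.
Proof. by apply: (@pairedbP _ _ _ 3 K8') => //; vm_compute. Qed.

(** * Adding 2, 4 or 8 vertices *)

Lemma perm_pairs o n k A B :
  perm_eq (nseq o 0 ++ A) (iota 0 n) -> perm_eq B (iota n k) ->
  perm_eq (nseq o 0 ++ (A ++ B)) (iota 0 (n + k)).
Proof. by move=> hA hB; rewrite catA iotaD perm_cat. Qed.

Lemma perm_labels n c z d k A : perm_eq A (iota 3 k) ->
  perm_eq (map (glue_label n c z d) A) (iota n k).
Proof.
move=> /(perm_map (glue_label n c z d)) /perm_trans; apply.
have -> : iota 3 k = map (addn 3) (iota 0 k) by rewrite -iotaDl addn0.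
by rewrite -map_comp (@eq_map _ _ _ (addn n)) // -iotaDl addn0.
Qed.

(** [K23] is the complete bipartite graph on the sphere with parts 1, 2 and 0, 3, 4. It makes two
    new vertices adjacent to [c] and [d]; the joins make them adjacent to the rest, including [z].
    Only the edge between the two new vertices is missing, hence the 1. *)
Lemma pairable_even2 n t (skip : bool) : (skip -> 2 < n) ->
  pairable false n t -> pairable false (n + 2) (t + 1 + 4 * skip).
Proof.
move=> hskip [fs [c [z [d [w [ps [rest [efs [hq hl] hp hc [hdom hcnt]]]]]]]]].
rewrite /= in hp; have hun : uniq [:: c, d & diagonals ps].
  by rewrite (perm_uniq hp) iota_uniq.
have hn : n = 2 * (size ps).+1.
  by have := perm_size hp; rewrite size_diagonals size_iota => <-.
have [hB hlB] : quad K23 /\ labels_lt 5 K23 by apply/quadbP.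
rewrite efs in hq hl.
have [||p' [ps' [qs' [ex [hC hlC kps kqs [sz hm]]]]]] :=
  @extend n c z d w ps rest 5 4 [:: [:: 3; 1; 4; 2]] [:: [:: 2; 0; 1; 3]] skip
    hq hl hun hB hlB isT isT isT.
- by case=> [|[|[|[|[|v]]]]].
- move=> /hskip n2; split => //; case: (ps) hn => //=; lia.
exists ([:: c; p'; d; w] :: ps' ++ qs' ++ ex).
exists c, p', d, w, (ps' ++ qs'), ex; split.
- by rewrite catA.
- by split.
- change (perm_eq ([:: c; d] ++ diagonals (ps' ++ qs')) (iota 0 (n + 2))).
  rewrite diagonals_cat catA.
  have -> : diagonals ps' = diagonals ps by apply: keys_diagonals.
  rewrite (keys_diagonals kqs) /=.
  exact: (@perm_pairs false n 2 [:: c, d & diagonals ps] [:: n + 0; n + 1]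
    hp (@perm_labels n c z d 2 [:: 3; 4] isT)).
- by [].
- split.
    move=> v /andP [v0 vn2]; have [vn|nv] := ltnP v n.
      by apply: (proj1 (hm _ _)); rewrite -efs; apply: hdom; rewrite v0.
    have [->|->] : v = n + 0 \/ v = n + 1 by lia.
      by have := proj2 (hm 2 3) isT; rewrite /glue_label hc.
    by have := proj2 (hm 2 4) isT; rewrite /glue_label hc.
  have sps : size ps' = size ps by rewrite -(size_map key) kps size_map.
  have sqs : size qs' = 1 by rewrite -(size_map key) kqs.
  have hsk : skip <= size ps.
    by move: hskip hn; clear; case: skip => //= h hn; have := h isT; lia.
  move: hcnt; rewrite efs /= !size_cat sz sps sqs /= muln1 => hcnt.
  move: hsk hcnt; rewrite hn /=; move: (size ps) (size rest) => a b; clear.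
  by case: skip => /=; nia.
Qed.

(** The graph of [K8] is complete, and all old pairs, including that of 0, are joined to all of its
    pairs, so no further edge is missing. Starting from a disjoint union is harmless because the
    joins connect it. *)
Lemma pairable_even8 n t : 0 < n -> pairable false n t -> pairable false (n + 8) t.
Proof.
move=> n0 [fs [c [z [d [w [ps [rest [efs [hq hl] hp hc [hdom hcnt]]]]]]]]].
rewrite /= in hp.
have [hB hlB] : quad K8 /\ labels_lt 8 K8 by apply/quadbP; vm_compute.
have hsB : quad (relabel (addn n) K8).
  by apply: relabel_quad hB hlB _ => x y _ _ /addnI.
have f4B : all quadface K8 by case: hB.
have hdB x y : (x, y) \in darts (relabel (addn n) K8) -> (n <= x) && (x < n + 8).
  rewrite relabel_darts // => /mapP [[i j] /(labels_darts hlB f4B) /andP [hi _] [-> _]].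
  by rewrite leq_addr ltn_add2l.
have f4A : all quadface fs by case: hq.
have hdA x y : (x, y) \in darts fs -> (x < n) && (y < n) by apply: labels_darts.
have hU : quad (fs ++ relabel (addn n) K8).
  apply: disjoint_quad => // v x y /hdA /andP [vn _].
  by apply/negP => /hdB /andP []; rewrite leqNgt vn.
pose qs := take 4 (relabel (addn n) K8); pose rB := drop 4 (relabel (addn n) K8).
pose f0 := [:: c; z; d; w].
have hpU : perm_eq (fs ++ relabel (addn n) K8) ((f0 :: ps) ++ qs ++ (rest ++ rB)).
  by rewrite efs -(cat_take_drop 4 (relabel _ _)) -/qs -/rB; perm_count.
have dqs : perm_eq (diagonals qs) (iota n 8).
  by rewrite (_ : diagonals qs = map (addn n) (iota 0 8)) // -iotaDl addn0.
have psn x : x \in diagonals (f0 :: ps) -> x < n.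
  by have := perm_mem hp x; rewrite /= mem_iota => ->.
have qsn x : x \in diagonals qs -> n <= x.
  by rewrite (perm_mem dqs) mem_iota => /andP [].
have un : uniq (diagonals (f0 :: ps) ++ diagonals qs).
  rewrite cat_uniq; apply/and3P; split.
  - by have := perm_uniq hp; rewrite iota_uniq.
  - by apply/hasPn => x /qsn nx; apply/negP => /psn; rewrite ltnNge nx.
  - by rewrite (perm_uniq dqs) iota_uniq.
have memU x y : (x, y) \in darts ((f0 :: ps) ++ qs ++ (rest ++ rB)) ->
    (x < n) && (y < n) || (n <= x < n + 8).
  rewrite -(perm_mem (perm_darts hpU)) darts_cat mem_cat => /orP [/hdA ->//|].
  by move=> /hdB ->; rewrite orbT.
have [|ps' [qs' [ex [hC kps kqs sz hm]]]] := join_all (quad_perm hpU hU) un.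
  have syU : forall x y, (x, y) \in darts ((f0 :: ps) ++ qs ++ (rest ++ rB)) ->
    (y, x) \in darts ((f0 :: ps) ++ qs ++ (rest ++ rB)).
    by case: (quad_perm hpU hU).
  have nocr x y : x \in diagonals (f0 :: ps) -> y \in diagonals qs ->
      (x, y) \notin darts ((f0 :: ps) ++ qs ++ (rest ++ rB)).
    move=> /psn xn /qsn ny; apply/negP => /memU.
    by rewrite (leqNgt n x) xn ltnNge ny.
  move=> [x y]; rewrite /cross => /orP [] /andP [hx hy]; first exact: nocr.
  by apply/negP => /syU; apply/negP/nocr.
case: ps' hC kps hm => // f1 ps' hC [kf1 kps] hm.
have f4C : all quadface ((f1 :: ps') ++ qs' ++ ex ++ rest ++ rB) by case: hC.
have [c1 [z1 [d1 [w1 ef1]]]] : exists a b c d, f1 = [:: a; b; c; d].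
  by apply: quadfaceE; move: f4C => /= /andP [].
have ec1 : c1 = c by move: kf1; rewrite ef1 => -[].
have dps : diagonals (f1 :: ps') = diagonals (f0 :: ps).
  by apply: keys_diagonals; rewrite /= kf1 kps.
exists (f1 :: (ps' ++ qs') ++ (ex ++ rest ++ rB)).
exists c1, z1, d1, w1, (ps' ++ qs'), (ex ++ rest ++ rB); rewrite -ef1.
have eC : (f1 :: ps') ++ qs' ++ ex ++ rest ++ rB =
  f1 :: (ps' ++ qs') ++ (ex ++ rest ++ rB) by rewrite /= !catA.
split => //.
- rewrite -eC; split => //; apply: darts_labels => // x y; rewrite hm.
  move=> /orP [/memU /orP [/andP [xn _]|/andP [_ //]]|].
    exact: leq_trans xn (leq_addr _ _).
  rewrite /cross => /orP [] /andP [h1 h2].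
    exact: leq_trans (psn _ h1) (leq_addr _ _).
  by move: h2; rewrite (perm_mem dqs) mem_iota => /andP [].
- rewrite -cat_cons diagonals_cat dps (keys_diagonals kqs).
  exact: (@perm_pairs false).
- by rewrite ec1.
- rewrite -eC; split.
    move=> v /andP [v0 vn8]; rewrite hm; have [vn|nv] := ltnP v n.
      rewrite -(perm_mem (perm_darts hpU)) darts_cat mem_cat hdom ?v0 //.
    apply/orP; right; rewrite /cross; apply/orP; left; apply/andP; split => /=.
      by rewrite (perm_mem hp) mem_iota.
    by rewrite (perm_mem dqs) mem_iota nv.
  have sps : size ps' = size ps by rewrite -(size_map key) kps size_map.
  have sqs : size qs' = 4 by rewrite -(size_map key) kqs.
  have hn : n = 2 * (size ps).+1.
    by have := perm_size hp; rewrite size_diagonals size_iota => <-.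
  move: hcnt; rewrite efs /= !size_cat sz sps sqs /= hn.
  by move: (size ps) (size rest) => a b; clear; nia.
Qed.

(** The piece [B] lacks [tB.+1] edges, but 12 among them becomes the pair of [c] and [d] and is
    already accounted for in the old graph. Since 0 is unpaired, its edges to the new vertices come
    from [B], glued with 0 as the middle of the path. *)
Lemma pairable_odd n t nB tB p q qs rB (skip : bool) :
  let B := [:: 1; 0; 2; p] :: (q :: qs) ++ rB in
  quadb nB B -> (1, 2) \notin darts B ->
  perm_eq (diagonals (q :: qs)) (iota 3 (nB - 3)) -> nth 0 q 1 = 0 ->
  (forall v, 2 < v < nB -> (0, v) \in darts B) ->
  4 * size B + 2 * tB.+1 = nB * nB.-1 -> 3 <= nB -> (skip -> 3 < n) ->
  pairable true n t -> pairable true (n + (nB - 3)) (t + tB + 4 * skip).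
Proof.
move=> B /quadbP [hB hlB] n12 dB q0 domB cntB nB3 hskip.
move=> [fs [c [z [d [w [ps [rest [efs [hq hl] hp hz [hdom hcnt]]]]]]]]].
rewrite /= in hp hz; have hun : uniq [:: 0, c, d & diagonals ps].
  by rewrite (perm_uniq hp) iota_uniq.
have hn : n = (2 * (size ps).+1).+1.
  by have := perm_size hp; rewrite (size_cat [:: 0]) size_diagonals size_iota => <-.
have hnB : nB = 2 * (size qs).+1 + 3.
  have := perm_size dB; rewrite size_diagonals size_iota => h.
  by rewrite -{1}(subnK nB3) -h.
rewrite efs in hq hl.
have [|||||p' [ps' [qs' [ex [hC hlC kps kqs [sz hm]]]]]] :=
  @extend n c z d w ps rest nB p (q :: qs) rB skip hq hl _ hB hlB n12.
- by move: hun => /= /andP [].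
- by rewrite (perm_uniq dB) iota_uniq.
- by rewrite (perm_all _ dB); apply/allP => i; rewrite mem_iota => /andP [].
- move=> v _ _; rewrite hz.
  by move: hun => /= /andP []; rewrite !inE !negb_or => /and3P [].
- move=> /hskip n2; split => //; case: (ps) hn => //=; lia.
case: qs' hC hlC kqs hm => // q1 qs' hC hlC [kq1 kqs] hm.
set C := [:: c; p'; d; w] :: _ in hC hlC hm.
have f4C : all quadface C by case: hC.
have [a1 [b1 [d1 [w1 eq1]]]] : exists a b c d, q1 = [:: a; b; c; d].
  by apply: quadfaceE; apply: (allP f4C); rewrite !inE mem_cat !inE eqxx !orbT.
have f4B : all quadface B by case: hB.
have [a2 [b2 [d2 [w2 eq2]]]] : exists a b c d, q = [:: a; b; c; d].
  by apply: quadfaceE; apply: (allP f4B); rewrite !inE eqxx !orbT.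
have eb1 : b1 = 0.
  move: kq1 q0; rewrite eq1 eq2 => -[_ -> _] /= ->; exact: hz.
(* The face with diagonal [c], [d] has lost its second vertex 0 in the gluing. The first new pair
   becomes the head instead: the second entry of [q] is 0, the relabelling sends it to [z], which is
   0, and the keys preserve it. *)
pose C' := q1 :: ([:: c; p'; d; w] :: ps' ++ qs') ++ ex.
have hpC : perm_eq C C' by rewrite /C /C'; perm_count.
have mC e : (e \in darts C') = (e \in darts C) by rewrite (perm_mem (perm_darts hpC)).
exists C', a1, b1, d1, w1, ([:: c; p'; d; w] :: ps' ++ qs'), ex; rewrite -eq1.
split => //.
- split; first exact: quad_perm hpC hC.
  by rewrite /labels_lt -(perm_all _ hpC).
- have hpd : perm_eq (diagonals (q1 :: [:: c; p'; d; w] :: ps' ++ qs'))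
      ([:: c, d & diagonals ps] ++ diagonals (relabel (glue_label n c z d) (q :: qs))).
    have -> : diagonals (relabel (glue_label n c z d) (q :: qs)) = diagonals (q1 :: qs').
      by apply: keys_diagonals; rewrite /= kq1 kqs.
    have <- : diagonals ps' = diagonals ps by apply: keys_diagonals.
    by rewrite !diagonals_cons diagonals_cat; perm_count.
  rewrite (perm_catl _ hpd); apply: (@perm_pairs true) => //.
  rewrite relabel_diagonals; first exact: perm_labels.
  by move: f4B => /= /and3P [_ ->]; rewrite all_cat => /andP [].
- split.
    move=> v /andP [v0 vn]; rewrite mC; have [vn'|nv] := ltnP v n.
      by apply: (proj1 (hm _ _)); rewrite -efs; apply: hdom; rewrite v0.
    have ev : v = n + (v - n) by rewrite subnKC.
    rewrite -hz ev; apply: (proj2 (hm 0 (v - n).+3)); apply: domB.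
    by move: vn nv nB3; clear; lia.
  have sps : size ps' = size ps by rewrite -(size_map key) kps size_map.
  have sqs : size qs' = size qs by rewrite -(size_map key) kqs !size_map.
  have hsk : skip <= size ps * (size qs).+1.
    move: hskip hn; clear; case: skip => //= h hn; have := h isT; nia.
  move: hcnt cntB; rewrite efs /C' /B /= !size_cat /= ?size_cat sz sps sqs hn hnB /= addnK.
  move: hsk; move: (size ps) (size rest) (size qs) (size rB) => a b e f; clear.
  by case: skip => /=; nia.
Qed.

(** The 2 stands for the edges 34 and 35 missing in [K7]. *)
Lemma pairable_odd4 n t (skip : bool) : (skip -> 3 < n) ->
  pairable true n t -> pairable true (n + 4) (t + 2 + 4 * skip).
Proof.
move=> hs; apply: (@pairable_odd n t 7 2 6 [:: 3; 0; 4; 2] [:: [:: 5; 4; 6; 2]]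
  (drop 3 K7) skip) => //.
by case=> [|[|[|[|[|[|[|v]]]]]]].
Qed.

(** Apart from 12 no edge is missing in [K11], so [t] does not change. *)
Lemma pairable_odd8 n t : pairable true n t -> pairable true (n + 8) t.
Proof.
move=> h; have := @pairable_odd n t 11 0 5 [:: 3; 0; 4; 2] (take 3 (drop 2 K11))
  (drop 5 K11) false; rewrite !addn0; apply => //; try by vm_compute.
by case=> [|[|[|[|[|[|[|[|[|[|[|v]]]]]]]]]]].
Qed.

(* The table lists n (n - 5) / 2 modulo 4, which has period 8 in n, from n = 5. *)
Definition residue n t :=
  t %% 4 == nth 0 [:: 0; 3; 3; 0; 2; 1; 1; 2] ((n - 5) %% 8).

(** * Residues modulo 4 and the induction on the number of vertices *)

Lemma residueP n t : 5 <= n -> t = (n * (n - 5))./2 %[mod 4] -> residue n t.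
Proof.
move=> n5 ht; rewrite /residue ht -{1}(subnK n5); move: (n - 5) => m {ht}.
rewrite {1 2}(divn_eq m 8); have : m %% 8 < 8 by rewrite ltn_mod.
move: (m %/ 8) (m %% 8) => j r.
(* For each [r] below 8 the numbers [a] and [b] are those with r (r + 5) = 8 a + 2 b. *)
have e (a b : nat) : (j * 8 + r + 5) * (j * 8 + r) =
      2 * (4 * (8 * j * j + 2 * j * r + 5 * j + a) + b) ->
    ((j * 8 + r + 5) * (j * 8 + r))./2 %% 4 = b %% 4.
  by move=> ->; rewrite mul2n doubleK mulnC modnMDl.
case: r e => [|[|[|[|[|[|[|[|r]]]]]]]] // e _.
- by rewrite (e 0 0) //; lia.
- by rewrite (e 0 3) //; lia.
- by rewrite (e 1 3) //; lia.
- by rewrite (e 3 0) //; lia.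
- by rewrite (e 4 2) //; lia.
- by rewrite (e 6 1) //; lia.
- by rewrite (e 8 1) //; lia.
- by rewrite (e 10 2) //; lia.
Qed.

Lemma residueD8 n t : 5 <= n -> residue (n + 8) t = residue n t.
Proof. by move=> n5; rewrite /residue -addnBAC // modnDr. Qed.

(** Two more vertices raise n (n - 5) / 2 by 2 n - 3, which is 1 modulo 4 for even [n]. *)
Lemma residueD2 n t k : 5 <= n -> ~~ odd n ->
  residue (n + 2) (t + 1 + 4 * k) = residue n t.
Proof.
move=> n5 on; have : odd ((n - 5) %% 8) by rewrite odd_mod // oddB // (negbTE on).
have e1 : (n + 2 - 5) %% 8 = ((n - 5) %% 8 + 2) %% 8 by rewrite modnDml addnBAC.
have e2 : (t + 1 + 4 * k) %% 4 = (t %% 4 + 1) %% 4.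
  by rewrite modnDml mulnC addnC modnMDl.
rewrite /residue e1 e2.
have : (n - 5) %% 8 < 8 by rewrite ltn_mod.
have : t %% 4 < 4 by rewrite ltn_mod.
case: (t %% 4) => [|[|[|[|s]]]] // _.
all: by case: ((n - 5) %% 8) => [|[|[|[|[|[|[|[|r]]]]]]]].
Qed.

(** Four more vertices raise n (n - 5) / 2 by 4 n - 2, which is 2 modulo 4. *)
Lemma residueD4 n t k : 5 <= n -> odd n ->
  residue (n + 4) (t + 2 + 4 * k) = residue n t.
Proof.
move=> n5 on; have : ~~ odd ((n - 5) %% 8) by rewrite odd_mod // oddB // on.
have e1 : (n + 4 - 5) %% 8 = ((n - 5) %% 8 + 4) %% 8 by rewrite modnDml addnBAC.
have e2 : (t + 2 + 4 * k) %% 4 = (t %% 4 + 2) %% 4.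
  by rewrite modnDml mulnC addnC modnMDl.
rewrite /residue e1 e2.
have : (n - 5) %% 8 < 8 by rewrite ltn_mod.
have : t %% 4 < 4 by rewrite ltn_mod.
case: (t %% 4) => [|[|[|[|s]]]] // _.
all: by case: ((n - 5) %% 8) => [|[|[|[|[|[|[|[|r]]]]]]]].
Qed.

Lemma even_small n t : 5 <= n -> n < 10 -> ~~ odd n -> t <= n - 4 -> residue n t ->
  n = 8 /\ (t = 0 \/ t = 4).
Proof.
do 10?[case: n => [|n] //=] => _ _ _; do 5?[case: t => [|t] //]; by auto.
Qed.

Lemma even_middle n : 10 <= n -> n < 13 -> ~~ odd n -> ~~ residue n 0.
Proof. by do 13?[case: n => [|n] //=]. Qed.

Lemma odd_small n t : 5 <= n -> n < 9 -> odd n -> t <= n - 4 -> residue n t ->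
  (n = 5 /\ t = 0) \/ (n = 7 /\ t = 3).
Proof.
do 9?[case: n => [|n] //=] => _ _ _; do 4?[case: t => [|t] //]; by auto.
Qed.

Lemma odd_middle n t : 9 <= n -> n < 13 -> odd n -> t < 2 -> residue n t ->
  n = 11 /\ t = 1.
Proof.
do 13?[case: n => [|n] //=] => _ _ _; do 2?[case: t => [|t] //]; by auto.
Qed.

(** For [n] = 9 the top values 4 and 5 of [t] have the wrong residue. So whenever a join must be
    skipped, [t] is large enough to be lowered by 6. *)
Lemma odd_nine n t : 9 <= n -> odd n -> 2 <= t -> n - 6 < t -> t <= n - 4 ->
  residue n t -> 11 <= n /\ 6 <= t.
Proof.
move=> n9 on t2 nt tn rs; suff n11 : 11 <= n by split => //; lia.
rewrite ltnNge; apply/negP => n10; have [n9'|n9'] : n = 9 \/ n = 10 by lia.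
  have [ht|ht] : t = 4 \/ t = 5 by lia.
    by move: rs; rewrite n9' ht.
  by move: rs; rewrite n9' ht.
by rewrite n9' in on.
Qed.

Lemma residue_pairable n t : 5 <= n -> t <= n - 4 -> residue n t ->
  pairable (odd n) n t.
Proof.
have [k] := ubnP n; elim: k n t => // k IH n t nk n5 tn res.
case on: (odd n); last first.
  have [n8|n8] := ltnP n 10.
    have [-> [->|->]] := even_small n5 n8 (negbT on) tn res.
      exact: pairable8.
    exact: pairable8'.
  have [t0|t1] := posnP t.
    have [n13|n13] := ltnP n 13.
      by have := even_middle n8 n13 (negbT on); rewrite -t0 res.
    have en : n = n - 8 + 8 by rewrite subnK // (leq_trans _ n13).
    rewrite en; apply: pairable_even8; first by lia.
    have -> : false = odd (n - 8) by rewrite oddB ?on // (leq_trans _ n13).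
    apply: IH; [lia|lia|lia|].
    by rewrite -residueD8 -?en //; lia.
  have e2 : n = n - 2 + 2 by rewrite subnK // (leq_trans _ n8).
  have eo : false = odd (n - 2) by rewrite oddB ?on // (leq_trans _ n8).
  have [tn1|tn1] := leqP t (n - 5).
    have et : t = t - 1 + 1 + 4 * false by rewrite muln0 addn0 subnK.
    rewrite e2 et; apply: (@pairable_even2 _ _ false) => //.
    rewrite eo; apply: IH; [lia|lia|lia|].
    by rewrite -(@residueD2 _ _ false) -?eo -?e2 -?et //; lia.
  (* Here [t] is [n - 4], and lowering it by 1 would exceed the bound for [n - 2] vertices; skipping
     a join lowers it by 5. *)
  have et : t = t - 5 + 1 + 4 * true by rewrite -addnA subnK //; lia.
  rewrite e2 et; apply: (@pairable_even2 _ _ true) => [_|]; first by lia.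
  rewrite eo; apply: IH; [lia|lia|lia|].
  by rewrite -(@residueD2 _ _ true) -?eo -?e2 -?et //; lia.
have [n9|n9] := ltnP n 9.
  have [[-> ->]|[-> ->]] := odd_small n5 n9 on tn res.
    exact: pairable5.
  exact: pairable7.
have [t1|t2] := ltnP t 2.
  have [n13|n13] := ltnP n 13.
    have [-> ->] := odd_middle n9 n13 on t1 res.
    exact: pairable11.
  have en : n = n - 8 + 8 by rewrite subnK // (leq_trans _ n13).
  rewrite en; apply: pairable_odd8.
  have -> : true = odd (n - 8) by rewrite oddB ?on // (leq_trans _ n13).
  apply: IH; [lia|lia|lia|].
  by rewrite -residueD8 -?en //; lia.
have e4 : n = n - 4 + 4 by rewrite subnK // (leq_trans _ n9).
have eo : true = odd (n - 4) by rewrite oddB ?on // (leq_trans _ n9).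
have [tn1|tn1] := leqP t (n - 6).
  have et : t = t - 2 + 2 + 4 * false by rewrite muln0 addn0 subnK.
  rewrite e4 et; apply: (@pairable_odd4 _ _ false) => //.
  rewrite eo; apply: IH; [lia|lia|lia|].
  by rewrite -(@residueD4 _ _ false) -?eo -?e4 -?et //; lia.
have [n11 t6] := odd_nine n9 on t2 tn1 tn res.
have et : t = t - 6 + 2 + 4 * true by rewrite -addnA subnK.
rewrite e4 et; apply: (@pairable_odd4 _ _ true) => [_|]; first by lia.
rewrite eo; apply: IH; [lia|lia|lia|].
by rewrite -(@residueD4 _ _ true) -?eo -?e4 -?et //; lia.
Qed.

Local Open Scope classical_set_scope.
Local Open Scope ring_scope.

(** * Continuity on a subset *)

Section WithinContinuous.
Context {R : realType} {T : topologicalType} (A : set T).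
Implicit Types f g : T -> R.

Lemma within_cst (c : R) : {within A, continuous (fun _ : T => c)}.
Proof. by move=> x; exact: cvg_cst. Qed.

Lemma withinD f g : {within A, continuous f} -> {within A, continuous g} ->
  {within A, continuous (fun x => f x + g x)}.
Proof. by move=> cf cg x; exact: (cvgD (cf x) (cg x)). Qed.

Lemma withinN f : {within A, continuous f} -> {within A, continuous (fun x => - f x)}.
Proof. by move=> cf x; exact: (cvgN (cf x)). Qed.

Lemma withinB f g : {within A, continuous f} -> {within A, continuous g} ->
  {within A, continuous (fun x => f x - g x)}.
Proof. by move=> cf cg x; exact: (cvgB (cf x) (cg x)). Qed.

Lemma withinM f g : {within A, continuous f} -> {within A, continuous g} ->
  {within A, continuous (fun x => f x * g x)}.
Proof. by move=> cf cg x; exact: (cvgM (cf x) (cg x)). Qed.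

Lemma withinX f n : {within A, continuous f} ->
  {within A, continuous (fun x => f x ^+ n)}.
Proof.
move=> cf; elim: n => [|n IH]; first exact: within_cst.
suff -> : (fun x => f x ^+ n.+1) = (fun x => f x * f x ^+ n) by exact: withinM.
by apply/funext => x; rewrite exprS.
Qed.

Lemma within_comp (h : R -> R) f : continuous h -> {within A, continuous f} ->
  {within A, continuous (fun x => h (f x))}.
Proof.
move=> ch cf x; apply: (@continuous_comp (subspace A) _ _ f h); first exact: cf.
exact: ch.
Qed.

Lemma within_norm f : {within A, continuous f} ->
  {within A, continuous (fun x => `|f x|)}.
Proof. by move=> cf; apply: (@within_comp (fun y : R => `|y|)) cf; exact: norm_continuous. Qed.

Lemma withinV f : (forall x, A x -> f x != 0) -> {within A, continuous f} ->
  {within A, continuous (fun x => (f x)^-1)}.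
Proof.
move=> f0 cf; apply/subspace_continuousP => x Ax.
by apply: (cvgV (f0 x Ax)); move/subspace_continuousP : cf; apply.
Qed.

Lemma within_sum (I : Type) (r : seq I) (P : pred I) (F : I -> T -> R) :
  (forall i, {within A, continuous (F i)}) ->
  {within A, continuous (fun x => \sum_(i <- r | P i) F i x)}.
Proof.
move=> cF; elim: r => [|i r IH].
  suff -> : (fun x => \sum_(i <- [::] | P i) F i x) = (fun=> 0) by exact: within_cst.
  by apply/funext => x; rewrite big_nil.
case Pi: (P i).
  suff -> : (fun x => \sum_(j <- i :: r | P j) F j x) =
      (fun x => F i x + \sum_(j <- r | P j) F j x) by exact: withinD.
  by apply/funext => x; rewrite big_cons Pi.
suff -> : (fun x => \sum_(j <- i :: r | P j) F j x) =
    (fun x => \sum_(j <- r | P j) F j x) by [].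
by apply/funext => x; rewrite big_cons Pi.
Qed.

Lemma within_pair (f g : T -> R) : {within A, continuous f} ->
  {within A, continuous g} -> {within A, continuous (fun x => (f x, g x) : plane R)}.
Proof. by move=> cf cg x; exact: (cvg_pair (cf x) (cg x)). Qed.

Lemma within_fst (f : T -> plane R) : {within A, continuous f} ->
  {within A, continuous (fun x => (f x).1)}.
Proof.
move=> cf x; apply: (@continuous_comp (subspace A) (R * R)%type R f fst); first exact: cf.
exact: cvg_fst.
Qed.

Lemma within_snd (f : T -> plane R) : {within A, continuous f} ->
  {within A, continuous (fun x => (f x).2)}.
Proof.
move=> cf x; apply: (@continuous_comp (subspace A) (R * R)%type R f snd); first exact: cf.
exact: cvg_snd.
Qed.

End WithinContinuous.

(** * Sectors, tent functions and winding numbers in the plane *)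

Section Plane.
Context {R : realType}.
Implicit Types (p q m : plane R) (x y a b : R).

Definition dot p q : R := p.1 * q.1 + p.2 * q.2.
Definition det p q : R := p.1 * q.2 - p.2 * q.1.

Lemma cos_sin1 (a : R) : cos a * cos a + sin a * sin a = 1.
Proof. by rewrite -!expr2 cos2Dsin2. Qed.

Lemma polar x y : exists r phi,
  [/\ 0 <= r, 0 <= phi < 2 * pi, x = r * cos phi, y = r * sin phi
    & r ^+ 2 = x ^+ 2 + y ^+ 2].
Proof.
have pi0 : 0 < pi :> R := pi_gt0 R.
pose r := Num.sqrt (x ^+ 2 + y ^+ 2).
have s0 : 0 <= x ^+ 2 + y ^+ 2 by rewrite addr_ge0 ?sqr_ge0.
have r2 : r ^+ 2 = x ^+ 2 + y ^+ 2 by rewrite sqr_sqrtr.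
have r0 : 0 <= r by exact: sqrtr_ge0.
have [rz|rnz] := eqVneq r 0.
  exists 0, 0; move: r2; rewrite rz expr0n /= => r2.
  have x2 : x ^+ 2 = 0 by have := sqr_ge0 x; have := sqr_ge0 y; lra.
  have y2 : y ^+ 2 = 0 by have := sqr_ge0 x; have := sqr_ge0 y; lra.
  move/eqP: x2; rewrite sqrf_eq0 => /eqP ->.
  move/eqP: y2; rewrite sqrf_eq0 => /eqP ->.
  by split=> //; rewrite ?mul0r // ?expr0n /= ?addr0 //; lra.
have rp : 0 < r by rewrite lt_def rnz.
have cr : -1 <= x / r <= 1.
  have /andP [h1 h2] : - r <= x <= r.
    rewrite -ler_norml -(@ler_pXn2r _ 2) ?nnegrE // real_normK ?num_real // r2.
    by have := sqr_ge0 y; lra.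
  by rewrite ler_pdivlMr // ler_pdivrMr // mulN1r mul1r h1 h2.
have hc : cos (acos (x / r)) = x / r by apply: acosK; rewrite in_itv /=.
have a0 := acos_ge0 cr; have api := acos_lepi cr.
have hs : sin (acos (x / r)) ^+ 2 * r ^+ 2 = y ^+ 2.
  have := cos2Dsin2 (acos (x / r)); rewrite hc => h.
  have -> : sin (acos (x / r)) ^+ 2 = 1 - (x / r) ^+ 2 by rewrite -h addrC addKr.
  by rewrite expr_div_n mulrBl divfK ?sqrf_eq0 // mul1r r2; ring.
have s1 : 0 <= sin (acos (x / r)) by apply: sin_ge0_pi; rewrite a0 api.
have hs' : sin (acos (x / r)) * r = `|y|.
  apply/eqP; rewrite -(@eqrXn2 _ 2) // ?mulr_ge0 // exprMn hs real_normK ?num_real //.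
have ex : x = r * (x / r) by rewrite mulrC divfK.
have [y0|y0] := lerP 0 y.
  exists r, (acos (x / r)); split => //.
  - by rewrite a0 /=; lra.
  - by rewrite hc.
  - by rewrite mulrC hs' ger0_norm.
exists r, (2 * pi - acos (x / r)); split => //.
- have : acos (x / r) != 0.
    by apply: contraTneq y0 => a00; move: hs'; rewrite a00 sin0 mul0r => /esym/normr0_eq0 ->; rewrite ltxx.
  move=> an; have a1 : 0 < acos (x / r) by rewrite lt_def an.
  by apply/andP; split; lra.
- have -> : 2 * pi = pi *+ 2 :> R by rewrite mulrC mulr_natr.
  by rewrite cosB cos2pi sin2pi mul1r mul0r addr0 hc.
- have -> : 2 * pi = pi *+ 2 :> R by rewrite mulrC mulr_natr.
  by rewrite sinB cos2pi sin2pi mul1r mul0r sub0r mulrN mulrC hs' ltr0_norm ?opprK.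
Qed.

Definition posp (x : R) : R := (x + `|x|) / 2.

Lemma pospE x : 0 <= x -> posp x = x.
Proof. by move=> x0; rewrite /posp ger0_norm //; lra. Qed.

Lemma posp0 x : x <= 0 -> posp x = 0.
Proof. by move=> x0; rewrite /posp ler0_norm // subrr mul0r. Qed.

Lemma posp_ge0 x : 0 <= posp x.
Proof. by have [x0|x0] := lerP 0 x; [rewrite pospE|rewrite posp0 // ltW]. Qed.

Lemma within_posp (T : topologicalType) (A : set T) (f : T -> R) :
  {within A, continuous f} -> {within A, continuous (fun u => posp (f u))}.
Proof.
move=> cf; apply: withinM; last exact: within_cst.
by apply: withinD => //; exact: within_norm.
Qed.

Definition step (k : nat) : R := 2 * pi / k%:R.

Definition dir (k i : nat) : plane R := (cos (step k * i%:R), sin (step k * i%:R)).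

(* On the sector spanned by two consecutive directions the coordinates along
   them are given by these tent functions. *)
Definition tent (k i : nat) (q : plane R) : R :=
  posp (dot (dir k i) q - `|det (dir k i) q| * (cos (step k) / sin (step k))).

Lemma step_gt0 k : (0 < k)%N -> 0 < step k.
Proof.
by move=> k0; rewrite /step divr_gt0 ?ltr0n // mulr_gt0 ?pi_gt0 // ltr0n.
Qed.

Lemma stepk k : (0 < k)%N -> step k * k%:R = 2 * pi.
Proof. by move=> k0; rewrite /step divfK // pnatr_eq0 -lt0n. Qed.

Lemma step_le k : (4 <= k)%N -> step k <= pi / 2.
Proof.
move=> k4; have k0 : (0 < k)%N by exact: leq_trans k4.
have := stepk k0; have := step_gt0 k0; have : (4 : R) <= k%:R by rewrite (ler_nat R 4 k).
by nra.
Qed.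

Lemma sin_step k : (4 <= k)%N -> 0 < sin (step k).
Proof.
move=> k4; apply: sin_gt0_pi; rewrite step_gt0; last exact: leq_trans k4.
by have := step_le k4; have := pi_gt0 R; lra.
Qed.

Lemma cos_step k : (4 <= k)%N -> 0 <= cos (step k).
Proof.
move=> k4; apply: cos_ge0_pihalf; rewrite step_le // andbT.
have : 0 < step k by apply: step_gt0; exact: leq_trans k4.
by have := pi_gt0 R; lra.
Qed.

Lemma sin_le0_pi x : pi <= x <= 2 * pi -> sin x <= 0.
Proof.
move=> /andP [x1 x2]; have -> : x = (x - pi) + pi by ring.
by rewrite sinDpi oppr_le0; apply: sin_ge0_pi; apply/andP; split; lra.
Qed.

Lemma cosD2pi x : cos (x + 2 * pi) = cos x.
Proof.
have -> : 2 * pi = pi *+ 2 :> R by rewrite mulrC mulr_natr.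
by rewrite cosD cos2pi sin2pi mulr1 mulr0 subr0.
Qed.

Lemma sinD2pi x : sin (x + 2 * pi) = sin x.
Proof.
have -> : 2 * pi = pi *+ 2 :> R by rewrite mulrC mulr_natr.
by rewrite sinD cos2pi sin2pi mulr1 mulr0 addr0.
Qed.

Lemma dir_step k i : dot (dir k i) (dir k i.+1) = cos (step k) /\
  det (dir k i) (dir k i.+1) = sin (step k).
Proof.
rewrite /dot /det /dir /= -natr1 mulrDr mulr1 cosD sinD.
have := cos_sin1 (step k * i%:R).
move: (cos (step k * i%:R)) (sin (step k * i%:R)) => C S h.
split; first by rewrite -[RHS]mul1r -h; ring.
by rewrite -[RHS]mul1r -h; ring.
Qed.

Lemma dirDk k i : (0 < k)%N -> dir k (i + k) = dir k i.
Proof. by move=> k0; rewrite /dir natrD mulrDr stepk // cosD2pi sinD2pi. Qed.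

Lemma dirS_mod k i : (i < k)%N -> dir k (i.+1 %% k) = dir k i.+1.
Proof.
move=> ik; have [->|h] := eqVneq i.+1 k.
  by rewrite modnn -(@dirDk k 0) ?add0n //; exact: leq_trans ik.
by rewrite modn_small // ltn_neqAle h.
Qed.

Definition comb (a b : R) (p q : plane R) : plane R :=
  (a * p.1 + b * q.1, a * p.2 + b * q.2).

Lemma dot_comb p a b q m : dot p (comb a b q m) = a * dot p q + b * dot p m.
Proof. by rewrite /dot /comb /=; ring. Qed.

Lemma det_comb p a b q m : det p (comb a b q m) = a * det p q + b * det p m.
Proof. by rewrite /det /comb /=; ring. Qed.

Lemma dotC p q : dot p q = dot q p.
Proof. by rewrite /dot; ring. Qed.

Lemma detC p q : det p q = - det q p.
Proof. by rewrite /det; ring. Qed.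

Lemma detxx p : det p p = 0.
Proof. by rewrite /det; ring. Qed.

(** In the frame of direction [j] the point has coordinates [X] and, up to sign, [Y]. Off the two
    sectors at this direction the tent function vanishes because the point is outside the wedge of
    half-angle [step k]. The bound on [k] makes the cosine of [step k] nonnegative. *)
Lemma tent_sector k i (m : nat) a b (j := ((i + m) %% k)%N) : (4 <= k)%N -> (m < k)%N ->
  0 <= a -> 0 <= b ->
  tent k j (comb a b (dir k i) (dir k i.+1)) =
  if m == 0%N then a else if m == 1%N then b else 0.
Proof.
move=> k4 mk a0 b0; have k0 : (0 < k)%N by exact: leq_trans k4.
have sp := sin_step k4; have cp := cos_step k4; have tp := step_gt0 k0.
have -> : tent k j (comb a b (dir k i) (dir k i.+1)) =
    tent k (i + m) (comb a b (dir k i) (dir k i.+1)).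
  suff e : dir k j = dir k (i + m) by rewrite /tent e.
  rewrite /j {2}(divn_eq (i + m) k); elim: ((i + m) %/ k)%N => // d IH.
  have -> : (d.+1 * k + (i + m) %% k = d * k + (i + m) %% k + k)%N.
    by rewrite mulSn -addnA addnC.
  by rewrite dirDk.
rewrite /tent; set th := step k in sp cp tp *.
set d := th * m%:R.
have eX : dot (dir k (i + m)) (comb a b (dir k i) (dir k i.+1)) =
    a * cos d + b * cos (d - th).
  rewrite /dot /comb /dir /= -/th natrD -natr1 !mulrDr mulr1 -/d.
  rewrite !cosD !sinD cosN sinN.
  have := cos_sin1 (th * i%:R); set C := cos (th * i%:R); set S := sin (th * i%:R).
  move=> h.
  transitivity ((a * cos d + b * (cos d * cos th + sin d * sin th)) * (C * C + S * S)).
    ring.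
  by rewrite h; ring.
have eY : det (dir k (i + m)) (comb a b (dir k i) (dir k i.+1)) =
    - (a * sin d + b * sin (d - th)).
  rewrite /det /comb /dir /= -/th natrD -natr1 !mulrDr mulr1 -/d.
  rewrite !cosD !sinD cosN sinN.
  have := cos_sin1 (th * i%:R); set C := cos (th * i%:R); set S := sin (th * i%:R).
  move=> h.
  transitivity (- (a * sin d + b * (sin d * cos th - cos d * sin th)) * (C * C + S * S)).
    ring.
  by rewrite h; ring.
rewrite eX eY normrN.
have [m0|m0] := eqVneq m 0%N.
  rewrite /d m0 mulr0 cos0 sin0 sub0r cosN sinN mulr0 add0r mulrN normrN.
  rewrite ger0_norm ?mulr_ge0 ?(ltW sp) // pospE.
    by field; rewrite gt_eqF.
  by rewrite (_ : _ - _ = a) //; field; rewrite gt_eqF.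
have [m1|m1] := eqVneq m 1%N.
  rewrite /d m1 mulr1 subrr cos0 sin0 mulr0 addr0.
  rewrite ger0_norm ?mulr_ge0 ?(ltW sp) // pospE.
    by field; rewrite gt_eqF.
  by rewrite (_ : _ - _ = b) //; field; rewrite gt_eqF.
have m2 : (2 <= m)%N by case: (m) m0 m1 => [|[|]].
have d2 : 2 * th <= d by rewrite /d mulrC ler_pM2l // (ler_nat R 2 m).
have dk : d + th <= 2 * pi.
  have -> : d + th = th * m.+1%:R by rewrite /d -natr1 mulrDr mulr1.
  by rewrite -(stepk k0) -/th ler_pM2l // ler_nat.
apply: posp0; set Y := a * sin d + b * sin (d - th).
set X := a * cos d + b * cos (d - th).
suff h : X * sin th <= `|Y| * cos th.
  by rewrite subr_le0 mulrA ler_pdivlMr.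
(* The two sides of the wedge give one identity each. The right-hand side is nonpositive in the
   first if d - th <= pi, and in the second otherwise. *)
have h1 : X * sin th + Y * - cos th = - (a * sin (d - th) + b * sin (d - th - th)).
  rewrite /X /Y !sinB !cosB; have := cos_sin1 th; move: (cos th) (sin th) => C S h.
  transitivity (- a * (sin d * C - cos d * S) + b * (cos d * S * C + sin d * (S * S) - sin d * C * C + cos d * S * C)).
    by ring.
  by ring.
have h2 : X * sin th + Y * cos th = a * sin (d + th) + b * sin d.
  rewrite /X /Y (sinD d th) (sinB d th) (cosB d th); have := cos_sin1 th; move: (cos th) (sin th) => C S h.
  transitivity (a * (sin d * C + cos d * S) + b * sin d * (C * C + S * S)).
    by ring.
  by rewrite h; ring.
have nY1 : Y * cos th <= `|Y| * cos th by rewrite ler_wpM2r // ler_norm.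
have nY2 : - Y * cos th <= `|Y| * cos th by rewrite ler_wpM2r // -normrN ler_norm.
have [dpi|dpi] := lerP (d - th) pi.
  have s1 : 0 <= a * sin (d - th).
    by apply: mulr_ge0 => //; apply: sin_ge0_pi; apply/andP; split; lra.
  have s2 : 0 <= b * sin (d - th - th).
    by apply: mulr_ge0 => //; apply: sin_ge0_pi; apply/andP; split; lra.
  by move: h1 s1 s2 nY1; lra.
have s1 : a * sin (d + th) <= 0.
  by apply: mulr_ge0_le0 => //; apply: sin_le0_pi; apply/andP; split; lra.
have s2 : b * sin d <= 0.
  by apply: mulr_ge0_le0 => //; apply: sin_le0_pi; apply/andP; split; lra.
by move: h2 s1 s2 nY2; lra.
Qed.

Lemma sector_exists k q : (4 <= k)%N -> exists i a b,
  [/\ (i < k)%N, 0 <= a, 0 <= b & q = comb a b (dir k i) (dir k i.+1)].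
Proof.
move=> k4; have k0 : (0 < k)%N by exact: leq_trans k4.
have sp := sin_step k4; have tp := step_gt0 k0; have tl := step_le k4.
have [r [phi [r0 /andP [p0 p2] ex ey _]]] := polar q.1 q.2.
set th := step k in sp tp tl *.
have pk0 : 0 <= phi / th by rewrite divr_ge0 // ltW.
pose i := Num.truncn (phi / th).
have /andP [i1 i2] := truncn_itv pk0; rewrite -/i in i1 i2.
have j1 : th * i%:R <= phi by rewrite mulrC -ler_pdivlMr.
have j2 : phi <= th * i.+1%:R by rewrite mulrC ltW // -ltr_pdivrMr.
have j3 : th * i.+1%:R = th * i%:R + th by rewrite -natr1 mulrDr mulr1.
(* The coefficients are given by the sine rule in the parallelogram spanned by the two
   directions. *)
exists i, (r * sin (th * i.+1%:R - phi) / sin th), (r * sin (phi - th * i%:R) / sin th).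
have pi0 := pi_gt0 R.
split.
- rewrite -(ltr_nat R) -(ltr_pM2l tp) (le_lt_trans j1) //.
  by rewrite /th stepk.
- apply: divr_ge0 (ltW sp); apply: mulr_ge0 => //; apply: sin_ge0_pi.
  by rewrite j3; apply/andP; split; lra.
- apply: divr_ge0 (ltW sp); apply: mulr_ge0 => //; apply: sin_ge0_pi.
  by apply/andP; split; lra.
- rewrite [q]surjective_pairing ex ey /comb /dir /= -/th j3; congr (_, _).
    rewrite !sinB !sinD !cosD; have := cos_sin1 (th * i%:R).
    have : sin th != 0 by rewrite gt_eqF.
    move: (cos (th * i%:R)) (sin (th * i%:R)) (cos th) (sin th) => C S c s s0 h.
    transitivity (r * cos phi * (C * C + S * S)); first by rewrite h mulr1.
    by field.
  rewrite !sinB !sinD !cosD; have := cos_sin1 (th * i%:R).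
  have : sin th != 0 by rewrite gt_eqF.
  move: (cos (th * i%:R)) (sin (th * i%:R)) (cos th) (sin th) => C S c s s0 h.
  transitivity (r * sin phi * (C * C + S * S)); first by rewrite h mulr1.
  by field.
Qed.

(** The half-angle formula for the tangent gives the argument in (-pi, pi) by an expression that is
    continuous off the closed negative half-axis. *)
Lemma half_angle x y : ~ (y = 0 /\ x <= 0) ->
  let N := Num.sqrt (x ^+ 2 + y ^+ 2) in
  [/\ 0 < N, 0 < N + x, x = N * cos (2 * atan (y / (N + x)))
    & y = N * sin (2 * atan (y / (N + x)))].
Proof.
move=> h N; have s0 : 0 <= x ^+ 2 + y ^+ 2 by rewrite addr_ge0 ?sqr_ge0.
have N2 : N ^+ 2 = x ^+ 2 + y ^+ 2 by rewrite sqr_sqrtr.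
have N0 : 0 <= N by exact: sqrtr_ge0.
have Nx : 0 < N + x.
  have [x0|x0] := ltrP 0 x; first by lra.
  have y0 : y != 0 by apply/eqP => y0; apply: h.
  rewrite -[x]opprK subr_gt0 -(@ltr_pXn2r _ 2) ?nnegrE ?oppr_ge0 // sqrrN N2.
  by rewrite ltrDl lt_def sqr_ge0 sqrf_eq0 y0.
have Np : 0 < N.
  by rewrite lt_def N0 andbT; apply/eqP => N00; move: N2 Nx; rewrite N00; nra.
set t := y / (N + x).
have c2 : cos (atan t) ^+ 2 = (1 + t ^+ 2)^-1.
  rewrite cos_atan exprVn sqr_sqrtr // addr_ge0 ?ler01 ?sqr_ge0 //.
have t1 : 1 + t ^+ 2 = 2 * N / (N + x).
  rewrite /t; transitivity ((N ^+ 2 + 2 * N * x + (x ^+ 2 + y ^+ 2)) / (N + x) ^+ 2).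
    by field; rewrite gt_eqF.
  by rewrite -N2; field; rewrite gt_eqF.
have s2 : sin (atan t) = t * cos (atan t).
  have := atanK t; rewrite /tan => {2}<-; rewrite divfK //.
  rewrite cos_atan invr_eq0 sqrtr_eq0 -ltNge; have := sqr_ge0 t; lra.
split => //.
- have -> : 2 * atan t = atan t *+ 2 by rewrite mulrC mulr_natr.
  rewrite cos_mulr2n c2 t1 -mulr_natr; field; rewrite ?gt_eqF //.
- have -> : 2 * atan t = atan t *+ 2 by rewrite mulrC mulr_natr.
  rewrite sin_mulr2n s2 (_ : cos _ * (t * _) = t * cos (atan t) ^+ 2); last by ring.
  rewrite c2 t1 /t -mulr_natr; field; rewrite ?gt_eqF //.
Qed.

(* Multiplying c - q by minus the conjugate of m and by exp (- i (2 pi s - al))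
   gives a closed curve that avoids the negative real axis. *)
Lemma winds_once_halfplane (c : R -> plane R) q m (al : R) :
  {within `[0, 1]%classic, continuous c} -> c 1 = c 0 ->
  (forall s, 0 <= s <= 1 ->
     let d := ((c s).1 - q.1, (c s).2 - q.2) in
     [/\ 0 < sin (2 * pi * s - al) -> det m d < 0,
         sin (2 * pi * s - al) < 0 -> 0 < det m d
       & sin (2 * pi * s - al) = 0 -> dot m d * cos (2 * pi * s - al) < 0]) ->
  winds_once c q.
Proof.
move=> cc c10 hc.
pose d s : plane R := ((c s).1 - q.1, (c s).2 - q.2).
pose x s := - dot m (d s); pose y s := - det m (d s).
pose C s := cos (2 * pi * s - al); pose S s := sin (2 * pi * s - al).
pose ux s := x s * C s + y s * S s; pose uy s := y s * C s - x s * S s.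
pose N s := Num.sqrt (ux s ^+ 2 + uy s ^+ 2).
have CS s : C s * C s + S s * S s = 1 by exact: cos_sin1.
have xu s : x s = ux s * C s - uy s * S s.
  by rewrite /ux /uy -[LHS]mulr1 -(CS s); ring.
have yu s : y s = ux s * S s + uy s * C s.
  by rewrite /ux /uy -[LHS]mulr1 -(CS s); ring.
have hu s : 0 <= s <= 1 -> ~ (uy s = 0 /\ ux s <= 0).
  move=> s01 [uy0 ux0]; have [h1 h2 h3] := hc s s01.
  have ey := yu s; have ex := xu s; rewrite uy0 mul0r subr0 in ex.
  rewrite uy0 mul0r addr0 in ey.
  have [Sp|Sn|S0] := ltgtP (S s) 0.
  - have := h2 Sp; rewrite -/(d s) -oppr_lt0 -/(y s) ey; nra.
  - have := h1 Sn; rewrite -/(d s) -oppr_gt0 -/(y s) ey; nra.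
  - have := h3 S0; rewrite -/(d s) -/(C s) -[dot _ _]opprK -/(x s) ex; nra.
have [M [phi [M0 _ em1 em2 M2]]] := polar (- m.1) (- m.2).
have Mp : 0 < M.
  rewrite lt_def M0 andbT; apply/eqP => M00; move: em1 em2; rewrite M00 !mul0r.
  move=> /eqP; rewrite oppr_eq0 => /eqP m1 /eqP; rewrite oppr_eq0 => /eqP m2.
  have s01 : 0 <= (0 : R) <= 1 by rewrite lexx ler01.
  apply: (hu 0 s01); rewrite /ux /uy /x /y /dot /det m1 m2.
  by split; [ring|rewrite !mul0r subrr addr0 oppr0 !mul0r addr0].
(* The argument of the curve that avoids the negative axis, plus the rotation that was divided out,
   plus the argument [phi] of the opposite of [m]. Only the middle contribution changes over a full
   turn, by 2 pi. *)
pose theta s := 2 * pi * s - al + phi + 2 * atan (uy s / (N s + ux s)).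
exists (fun s => N s / M), theta; split.
- have cc1 := within_fst cc; have cc2 := within_snd cc.
  have cid : {within `[0, 1]%classic, continuous (fun s : R => s)}.
    by apply: continuous_subspaceT => s; exact: cvg_id.
  have cang : {within `[0, 1]%classic, continuous (fun s : R => 2 * pi * s - al)}.
    by apply: withinB; [apply: withinM => //|]; exact: within_cst.
  have cC : {within `[0, 1]%classic, continuous C}.
    by apply: (within_comp (h := cos)) cang; exact: continuous_cos.
  have cS : {within `[0, 1]%classic, continuous S}.
    by apply: (within_comp (h := sin)) cang; exact: continuous_sin.
  have cd1 : {within `[0, 1]%classic, continuous (fun s => (d s).1)}.
    by apply: withinB => //; exact: within_cst.
  have cd2 : {within `[0, 1]%classic, continuous (fun s => (d s).2)}.
    by apply: withinB => //; exact: within_cst.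
  have cx : {within `[0, 1]%classic, continuous x}.
    by apply: withinN; apply: withinD; apply: withinM => //; exact: within_cst.
  have cy : {within `[0, 1]%classic, continuous y}.
    by apply: withinN; apply: withinB; apply: withinM => //; exact: within_cst.
  have cux : {within `[0, 1]%classic, continuous ux}.
    by apply: withinD; apply: withinM.
  have cuy : {within `[0, 1]%classic, continuous uy}.
    by apply: withinB; apply: withinM.
  have cN : {within `[0, 1]%classic, continuous N}.
    apply: (within_comp (h := Num.sqrt)); first exact: sqrt_continuous.
    by apply: withinD; exact: withinX.
  apply: withinD; first by apply: withinD => //; exact: within_cst.
  apply: withinM; first exact: within_cst.
  apply: (within_comp (h := atan)); first exact: continuous_atan.
  apply: withinM => //; apply: withinV; last exact: withinD.
  move=> s; rewrite /= in_itv /= => /hu /half_angle [_ h _ _].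
  by rewrite gt_eqF.
- have e1 : d 1 = d 0 by rewrite /d c10.
  have eC : C 1 = C 0 by rewrite /C mulr1 mulr0 addrC cosD2pi add0r.
  have eS : S 1 = S 0 by rewrite /S mulr1 mulr0 addrC sinD2pi add0r.
  have eux : ux 1 = ux 0 by rewrite /ux /x /y e1 eC eS.
  have euy : uy 1 = uy 0 by rewrite /uy /x /y e1 eC eS.
  by rewrite /theta /N eux euy; ring.
- move=> s s01; have [Np _ hx hy] := half_angle (hu s s01).
  split; first exact: divr_gt0.
  have ec : c s = (q.1 + (d s).1, q.2 + (d s).2).
    by rewrite /d /= ![_ + (_ - _)]addrC !subrK -surjective_pairing.
  rewrite ec; set beta := 2 * atan _ in hx hy.
  have M2n : M ^+ 2 != 0 by rewrite sqrf_eq0 gt_eqF.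
  have mm : M * M = m.1 ^+ 2 + m.2 ^+ 2 by rewrite -expr2 M2 !sqrrN.
  have ed1 : (d s).1 = (cos phi * x s - sin phi * y s) / M.
    apply: (mulIf M2n).
    transitivity ((d s).1 * (m.1 ^+ 2 + m.2 ^+ 2)); first by rewrite -mm expr2.
    transitivity ((M * cos phi) * x s - (M * sin phi) * y s); last by field; rewrite gt_eqF.
    by rewrite -em1 -em2 /x /y /dot /det; ring.
  have ed2 : (d s).2 = (cos phi * y s + sin phi * x s) / M.
    apply: (mulIf M2n).
    transitivity ((d s).2 * (m.1 ^+ 2 + m.2 ^+ 2)); first by rewrite -mm expr2.
    transitivity ((M * cos phi) * y s + (M * sin phi) * x s); last by field; rewrite gt_eqF.
    by rewrite -em1 -em2 /x /y /dot /det; ring.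
  have hx' : ux s = N s * cos beta := hx; have hy' : uy s = N s * sin beta := hy.
  have eth : theta s = (2 * pi * s - al) + (phi + beta) by rewrite /theta [RHS]addrA.
  rewrite ed1 ed2 eth (xu s) (yu s) hx' hy'.
  rewrite (cosD (_ - al)) (sinD (_ - al)) (cosD phi) (sinD phi) -/(C s) -/(S s).
  congr (_ + _, _ + _); field; rewrite gt_eqF //.
Qed.

End Plane.

(* [rot v] lists the neighbours of v counterclockwise; the triangles are
   (v, w, next (rot v) w). *)
Record triangulation (T : finType) := Triangulation {
  rot :> T -> seq T;
  rot_uniq : forall v, uniq (rot v);
  rot_size : forall v, (4 <= size (rot v))%N;
  rot_irr : forall v, v \notin rot v;
  rot_tri : forall v w, w \in rot v ->
    (next (rot v) w \in rot w) && (next (rot w) (next (rot v) w) == v);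
  rot_conn : forall P : T -> Prop,
    (forall v w, w \in rot v -> P v -> P w) -> forall v w, P v -> P w
}.

Lemma next_nth_mod (T : eqType) (x0 : T) (s : seq T) x : uniq s -> x \in s ->
  next s x = nth x0 s ((index x s).+1 %% size s)%N.
Proof.
case: s => // y s us xs; rewrite next_nth xs.
have := xs; rewrite -index_mem /= -/(index x (y :: s)); set i := index x (y :: s).
rewrite ltnS leq_eqVlt => /orP [/eqP ->|h].
  by rewrite modnn nth_default.
by rewrite modn_small //= (set_nth_default x0).
Qed.

(** * Geometric realization, star charts and orientability *)

Section Surface.
Context {R : realType} {T : finType} (K : triangulation T).
Implicit Types (v w u t x z : T) (q : plane R).

Lemma rot_next v w : w \in K v -> next (K v) w \in K v.
Proof. by rewrite mem_next. Qed.

Lemma rot_sym v w : w \in K v -> v \in K w.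
Proof. by move=> /rot_tri /andP [h /eqP <-]; rewrite mem_next. Qed.

Lemma rot_tri2 v w : w \in K v -> let u := next (K v) w in
  [/\ u \in K w, next (K w) u = v, v \in K u & next (K u) v = w].
Proof.
move=> wv u; have /andP [uw /eqP e1] := rot_tri wv.
by have /andP [vu /eqP e2] := rot_tri uw; rewrite -/u e1 in vu e2 *; split.
Qed.

Lemma rot_neq v w : w \in K v -> (w == v) = false.
Proof. by move=> h; apply: contraTF h => /eqP ->; exact: rot_irr. Qed.

Lemma next_neq v w : w \in K v -> (next (K v) w == w) = false.
Proof. by move=> /rot_tri2 [h _ _ _]; exact: rot_neq. Qed.

Definition supported (p : T -> R) v w :=
  forall t, t != v -> t != w -> t != next (K v) w -> p t = 0.

Definition realization : set (prod_topology (fun _ : T => R)) :=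
  [set p | [/\ forall t, 0 <= p t, \sum_t p t = 1
             & exists v w, w \in K v /\ supported p v w]].

Definition space : topologicalType := set_type realization.

Lemma supported_rot p v w : w \in K v -> supported p v w ->
  supported p w (next (K v) w).
Proof.
move=> wv h t t1 t2 t3; apply: h => //.
by have [_ <- _ _] := rot_tri2 wv.
Qed.

(** A triangle can be listed from any of its vertices, so the one supporting [p] may be taken to
    start at [v]. *)
Lemma star p v : realization p -> 0 < p v ->
  exists2 w, w \in K v & supported p v w.
Proof.
move=> [p0 _ [v' [w' [wv h]]]] pv.
have [uw e1 vu e2] := rot_tri2 wv.
have [->|nv] := eqVneq v v'; first by exists w'.
have hw := supported_rot wv h.
have [->|nw] := eqVneq v w'; first by exists (next (K v') w').
have [->|nu] := eqVneq v (next (K v') w').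
  by exists v' => //; have := supported_rot uw hw; rewrite e1.
by move: pv; rewrite h // ltxx.
Qed.

Lemma sum_two (A : pred T) (F : T -> R) x z : A x -> A z -> (z == x) = false ->
  (forall t, A t -> t != x -> t != z -> F t = 0) ->
  \sum_(t | A t) F t = F x + F z.
Proof.
move=> Ax Az zx h; rewrite (bigD1 x) //= (bigD1 z) /=; last by rewrite Az zx.
by rewrite big1 ?addr0 // => t /andP [/andP [At tx] tz]; exact: h.
Qed.

Lemma supported_sum p v w : w \in K v -> supported p v w -> \sum_t p t = 1 ->
  p v + p w + p (next (K v) w) = 1.
Proof.
move=> wv h <-; rewrite [RHS](bigD1 v) //= -addrA; congr (_ + _).
rewrite (sum_two (x := w) (z := next (K v) w)) ?(rot_neq wv) ?(rot_neq (rot_next wv))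
  ?(next_neq wv) //.
Qed.

Definition sdir v x : plane R := dir (size (K v)) (index x (K v)).

Definition lam v x q : R := tent (size (K v)) (index x (K v)) q.

Lemma index_next v w : w \in K v ->
  index (next (K v) w) (K v) = ((index w (K v)).+1 %% size (K v))%N.
Proof.
move=> wv; rewrite (@next_nth_mod _ v) ?rot_uniq //.
by rewrite index_uniq ?rot_uniq // ltn_mod (leq_trans _ (rot_size K v)).
Qed.

Lemma sdir_next v w : w \in K v ->
  sdir v (next (K v) w) = dir (size (K v)) (index w (K v)).+1.
Proof. by move=> wv; rewrite /sdir index_next // dirS_mod // index_mem. Qed.

Lemma lam_sector v w a b z : w \in K v -> 0 <= a -> 0 <= b -> z \in K v ->
  lam v z (comb a b (sdir v w) (sdir v (next (K v) w))) =
  if z == w then a else if z == next (K v) w then b else 0.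
Proof.
move=> wv a0 b0 zv; rewrite sdir_next // /lam /sdir.
set k := size (K v); set i := index w (K v).
have k4 : (4 <= k)%N := rot_size K v.
have ik : (i < k)%N by rewrite index_mem.
(* The number of steps from [w] to [z] in the rotation at [v], the offset in [tent_sector]. *)
pose m := ((index z (K v) + (k - i)) %% k)%N.
have mk : (m < k)%N by rewrite ltn_mod (leq_trans _ k4).
have zk : (index z (K v) < k)%N by rewrite index_mem.
have ez : index z (K v) = ((i + m) %% k)%N.
  rewrite /m modnDmr addnCA subnKC; last exact: ltnW.
  by rewrite modnDr modn_small.
have ezt : z = nth v (K v) ((i + m) %% k)%N by rewrite -ez nth_index.
rewrite ez tent_sector //.
have -> : (z == w) = (m == 0%N).
  apply/eqP/eqP => [ezw|m0].
    by rewrite /m ezw -/i subnKC ?modnn // ltnW.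
  by rewrite ezt m0 addn0 modn_small // /i nth_index.
case: eqP => // m0; suff -> : (z == next (K v) w) = (m == 1%N) by [].
apply/eqP/eqP => [ezw|m1].
  have : ((i + m) %% k = (i + 1) %% k)%N.
    by rewrite -ez ezw index_next // addn1.
  by move/eqP; rewrite eqn_modDl modn_small // modn_small ?(leq_trans _ k4) // => /eqP.
by rewrite ezt m1 addn1 (@next_nth_mod _ v) ?rot_uniq.
Qed.

Lemma sector v q : exists w a b,
  [/\ w \in K v, 0 <= a, 0 <= b & q = comb a b (sdir v w) (sdir v (next (K v) w))].
Proof.
have [i [a [b [ik a0 b0 eq]]]] := sector_exists q (rot_size K v).
have wv : nth v (K v) i \in K v by rewrite mem_nth.
exists (nth v (K v) i), a, b; split => //.
by rewrite sdir_next // /sdir index_uniq // rot_uniq.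
Qed.

Definition den v q : R := 1 + \sum_(x | x \in K v) lam v x q.

Lemma lam_ge0 v x q : 0 <= lam v x q.
Proof. exact: posp_ge0. Qed.

Lemma den_gt0 v q : 0 < den v q.
Proof. by rewrite ltr_wpDr // sumr_ge0 // => x _; exact: lam_ge0. Qed.

Definition chart_pt v q : prod_topology (fun _ : T => R) := fun t =>
  if t == v then (den v q)^-1 else
  if t \in K v then lam v t q / den v q else 0.

Lemma chart_pt_supported v w a b : w \in K v -> 0 <= a -> 0 <= b ->
  supported (chart_pt v (comb a b (sdir v w) (sdir v (next (K v) w)))) v w.
Proof.
move=> wv a0 b0 t tv tw tu; rewrite /chart_pt (negbTE tv); case: ifP => // tK.
by rewrite lam_sector // (negbTE tw) (negbTE tu) mul0r.
Qed.

Lemma chart_pt_in v q : realization (chart_pt v q).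
Proof.
have d0 := den_gt0 v q; split.
- move=> t; rewrite /chart_pt; case: ifP => _; first by rewrite invr_ge0 ltW.
  by case: ifP => // _; rewrite divr_ge0 ?lam_ge0 // ltW.
- rewrite (bigD1 v) //= {1}/chart_pt eqxx.
  have -> : \sum_(t | t != v) chart_pt v q t = \sum_(t | t \in K v) lam v t q / den v q.
    rewrite [RHS](eq_bigl (fun t => (t != v) && (t \in K v))); last first.
      by move=> t /=; case tK: (t \in K v); rewrite ?andbF // andbT rot_neq.
    rewrite big_mkcondr; apply: eq_bigr => t tv.
    by rewrite /chart_pt (negbTE tv).
  by rewrite -mulr_suml -[X in X + _]mul1r -mulrDl divff // gt_eqF.
- have [w [a [b [wv a0 b0 eq]]]] := sector v q.
  by exists v, w; split => //; rewrite eq; exact: chart_pt_supported.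
Qed.

Definition mkpt (p : prod_topology (fun _ : T => R)) (h : realization p) : space :=
  exist _ p (mem_set h).

Lemma mkptE p (h : realization p) : \val (mkpt h) = p.
Proof. by []. Qed.

Lemma spaceP (p : space) : realization (\val p).
Proof. exact: set_mem (valP p). Qed.

Lemma space_inj (p p' : space) : (forall t, \val p t = \val p' t) -> p = p'.
Proof. by move=> h; apply: val_inj; apply/funext. Qed.

Lemma continuous_coord t : continuous (fun p : space => \val p t : R).
Proof.
move=> p; apply: (@continuous_comp space (prod_topology (fun _ : T => R)) R \val (proj t)).
  exact: initial_continuous.
exact: proj_continuous.
Qed.

(** The topology of the realization is initial for the coordinates, so continuity is checked
    coordinate by coordinate. *)
Lemma within_space (Y : topologicalType) (A : set Y) (f : Y -> space) :
  (forall t, {within A, continuous (fun y => \val (f y) t : R)}) ->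
  {within A, continuous f}.
Proof.
move=> h; apply: (@continuous_comp_initial _ (subspace A) _ (\val : space -> _)) => y.
apply/cvg_sup => t.
exact: (@continuous_comp_initial _ (subspace A) _ (fun p : T -> R => p t) (\val \o f) (h t) y).
Qed.

Definition chart_from v q : space := mkpt (chart_pt_in v q).

(** Division by the coordinate at [v] spreads the open star over the whole plane: each triangle at
    [v] fills the sector between two consecutive directions. *)
Definition chart_to v (p : space) : plane R :=
  (\sum_(x | x \in K v) \val p x / \val p v * (sdir v x).1,
   \sum_(x | x \in K v) \val p x / \val p v * (sdir v x).2).

Definition open_star v : set space := [set p | 0 < \val p v].

Lemma chart_to_tri v w (p : space) : w \in K v -> supported (\val p) v w ->
  chart_to v p = comb (\val p w / \val p v) (\val p (next (K v) w) / \val p v)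
    (sdir v w) (sdir v (next (K v) w)).
Proof.
move=> wv h; rewrite /chart_to /comb; congr (_, _);
  rewrite (sum_two (x := w) (z := next (K v) w)) ?next_neq ?rot_next //;
  by move=> t tK tw tu; rewrite h ?mul0r // rot_neq.
Qed.

Lemma den_sector v w a b : w \in K v -> 0 <= a -> 0 <= b ->
  den v (comb a b (sdir v w) (sdir v (next (K v) w))) = 1 + a + b.
Proof.
move=> wv a0 b0; rewrite /den -addrA; congr (_ + _).
rewrite (sum_two (x := w) (z := next (K v) w)) ?next_neq ?rot_next //.
  by rewrite !lam_sector ?rot_next // eqxx next_neq // eqxx.
by move=> t tK tw tu; rewrite lam_sector // (negbTE tw) (negbTE tu).
Qed.

Lemma chart_pt_sector v w a b : w \in K v -> 0 <= a -> 0 <= b ->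
  let p := chart_pt v (comb a b (sdir v w) (sdir v (next (K v) w))) in
  [/\ p v = (1 + a + b)^-1, p w = a / (1 + a + b)
    & p (next (K v) w) = b / (1 + a + b)].
Proof.
move=> wv a0 b0 p; rewrite /p /chart_pt eqxx den_sector // !rot_neq ?rot_next //.
by rewrite wv !lam_sector ?rot_next // eqxx next_neq // eqxx.
Qed.

Lemma chart_toK v p : open_star v p -> chart_from v (chart_to v p) = p.
Proof.
move=> pv; have [w wv h] := star (spaceP p) pv.
have [p0 p1 _] := spaceP p; have s1 := supported_sum wv h p1.
have pv0 : \val p v != 0 by rewrite gt_eqF.
have a0 : 0 <= \val p w / \val p v by rewrite divr_ge0.
have b0 : 0 <= \val p (next (K v) w) / \val p v by rewrite divr_ge0.
have e1 : (1 + \val p w / \val p v + \val p (next (K v) w) / \val p v)^-1 = \val p v.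
  have -> : 1 + \val p w / \val p v + \val p (next (K v) w) / \val p v = (\val p v)^-1.
    by rewrite -[RHS]mul1r -[X in _ = X * _]s1; field.
  by rewrite invrK.
apply: space_inj => t; rewrite mkptE (chart_to_tri wv h).
have [ev ew eu] := chart_pt_sector wv a0 b0.
have [->|tv] := eqVneq t v; first by rewrite ev.
have [->|tw] := eqVneq t w; first by rewrite ew e1 divfK.
have [->|tu] := eqVneq t (next (K v) w); first by rewrite eu e1 divfK.
by rewrite (chart_pt_supported wv a0 b0) // h.
Qed.

Lemma chart_fromK v q : chart_to v (chart_from v q) = q.
Proof.
have [w [a [b [wv a0 b0 ->]]]] := sector v q.
rewrite (@chart_to_tri v w) //; last exact: chart_pt_supported.
have [ev ew eu] := chart_pt_sector wv a0 b0.
have d0 : 1 + a + b != 0 by rewrite gt_eqF //; lra.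
by rewrite mkptE ev ew eu; congr comb; field.
Qed.

Lemma open_star_open v : open (open_star v).
Proof.
apply: (@open_comp space R (fun p => \val p v) [set y | 0 < y]); last exact: open_gt.
by move=> p _; exact: continuous_coord.
Qed.

Lemma within_coord (A : set space) t : {within A, continuous (fun p : space => \val p t : R)}.
Proof. by apply: continuous_subspaceT; exact: continuous_coord. Qed.

Lemma within_chart_to (Y : topologicalType) (A : set Y) v (f : Y -> space) :
  (forall y, A y -> open_star v (f y)) ->
  (forall t, {within A, continuous (fun y => \val (f y) t : R)}) ->
  {within A, continuous (chart_to v \o f)}.
Proof.
move=> fA cf; apply: within_pair; apply: within_sum => x; apply: withinM;
  try exact: within_cst; apply: withinM => //; apply: withinV => // y Ay;
  by rewrite gt_eqF //; exact: fA.
Qed.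

Lemma within_lam (Y : topologicalType) (A : set Y) (f : Y -> plane R) v x :
  {within A, continuous f} -> {within A, continuous (fun y => lam v x (f y))}.
Proof.
move=> cf; have c1 := within_fst cf; have c2 := within_snd cf.
apply: within_posp; apply: withinB.
  by apply: withinD; apply: withinM => //; exact: within_cst.
apply: withinM; last exact: within_cst.
by apply: within_norm; apply: withinB; apply: withinM => //; exact: within_cst.
Qed.

Lemma within_chart_pt (Y : topologicalType) (A : set Y) (f : Y -> plane R) v t :
  {within A, continuous f} -> {within A, continuous (fun y => chart_pt v (f y) t : R)}.
Proof.
move=> cf.
have cd : {within A, continuous (fun y => (den v (f y))^-1)}.
  apply: withinV => [y _|]; first by rewrite gt_eqF // den_gt0.
  apply: withinD; first exact: within_cst.
  by apply: within_sum => x; exact: within_lam.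
rewrite /chart_pt; case: (t == v); first exact: cd.
case: (t \in K v); last exact: within_cst.
by apply: withinM => //; exact: within_lam.
Qed.

Lemma chart_from_star v q : open_star v (chart_from v q).
Proof. by rewrite /open_star /chart_from /= /chart_pt eqxx invr_gt0 den_gt0. Qed.

Lemma star_homeomorphism v :
  homeomorphism (open_star v) [set: plane R] (chart_to v) (chart_from v).
Proof.
split=> //.
- split.
    apply: (@within_chart_to _ (open_star v) v id) => // t; exact: within_coord.
  apply: within_space => t; apply: within_chart_pt.
  by apply: continuous_subspaceT => q; exact: cvg_id.
- by move=> q _; exact: chart_from_star.
- by move=> p; exact: chart_toK.
- by move=> q _; exact: chart_fromK.
Qed.

Definition star_chart v : chart R space :=
  Chart (open_star_open v) openT (star_homeomorphism v).

Lemma star_cover (p : space) : exists v, open_star v p.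
Proof.
have [p0 p1 _] := spaceP p; apply: contrapT => h.
have : \sum_t \val p t = 0.
  rewrite big1 // => t _; apply/eqP; rewrite eq_le p0 andbT leNgt.
  by apply/negP => ht; apply: h; exists t.
by rewrite p1 => /eqP; rewrite oner_eq0.
Qed.

(** The tent function before truncation. It is positive exactly on the image of the overlap of the
    stars of [v] and [w] and, unlike [lam], changes under small moves by an amount that is easy to
    bound and to compute. *)
Definition height v w q : R := dot (sdir v w) q -
  `|det (sdir v w) q| * (cos (step (size (K v))) / sin (step (size (K v)))).

Lemma lamE v w q : lam v w q = posp (height v w q).
Proof. by []. Qed.

Lemma sdir_step v w : w \in K v ->
  dot (sdir v w) (sdir v (next (K v) w)) = cos (step (size (K v))) :> R /\
  det (sdir v w) (sdir v (next (K v) w)) = sin (step (size (K v))) :> R.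
Proof. by move=> wv; rewrite sdir_next //; exact: dir_step. Qed.

Lemma sdir_unit v w : dot (sdir v w) (sdir v w) = 1 :> R.
Proof. exact: cos_sin1. Qed.

(* In the triangles at the edge vw the coordinates (a, b) along that edge and
   along the third vertex become (1 / a, b / a) in the chart of w. *)
Lemma transition_coord v w q : w \in K v -> 0 < height v w q ->
  let F := chart_to w (chart_from v q) in
  let th := step (size (K v)) in let th' := step (size (K w)) in
  let Y := det (sdir v w) q in
  [/\ dot (sdir w v) F = (1 + `|Y| / sin th * cos th') / height v w q,
      det (sdir w v) F = - (Y / sin th * sin th') / height v w q
    & open_star w (chart_from v q)].
Proof.
move=> wv hp F th th' Y; have sth : 0 < sin th := sin_step (rot_size K v).
have [x [a [b [xv a0 b0 eq]]]] := sector v q.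
have lw : lam v w q = height v w q by rewrite lamE pospE // ltW.
have := lw; rewrite eq lam_sector // -eq => lw'.
have [pv px pu] := chart_pt_sector xv a0 b0; rewrite -eq in pv px pu.
have d0 : 1 + a + b != 0 by rewrite gt_eqF //; lra.
have dp : 0 < 1 + a + b by lra.
have sx : supported (\val (chart_from v q)) v x by rewrite eq; exact: chart_pt_supported.
have [cx sx'] := sdir_step xv.
have [uw e1 vu e2] := rot_tri2 xv.
case: eqVneq lw' => [ewx|nwx].
  move=> ea; have ap : 0 < a by rewrite ea.
  rewrite -ewx in xv eq px pu sx cx sx' uw e1 vu e2.
  have eY : Y = b * sin th.
    by rewrite /Y eq det_comb detxx mulr0 add0r sx'.
  have sw := supported_rot wv sx; have [c1 s1] := sdir_step uw; rewrite e1 -/th' in c1 s1.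
  have FE : F = comb (b / a) a^-1 (sdir w (next (K v) w)) (sdir w v).
    rewrite /F (chart_to_tri uw sw) e1; congr comb; rewrite ?mkptE ?pu ?px ?pv; field;
      by rewrite d0 gt_eqF.
  split.
  - rewrite FE -ea eY ger0_norm; last by rewrite mulr_ge0 // ltW.
    rewrite mulfK ?gt_eqF // dot_comb dotC c1 sdir_unit.
    by field; rewrite gt_eqF.
  - rewrite FE -ea eY mulfK ?gt_eqF // det_comb detC s1 detxx.
    by field; rewrite gt_eqF.
  - by rewrite /open_star /= px divr_gt0.
case: eqVneq => [ewx eb|_ h0]; last by move: hp; rewrite -h0 ltxx.
have bp : 0 < b by rewrite eb.
rewrite -ewx in eq pu cx sx' uw e1 vu e2.
have eY : Y = - (a * sin th).
  by rewrite /Y eq det_comb detxx mulr0 addr0 detC sx' mulrN.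
have := supported_rot xv sx; rewrite -ewx => sx1.
have := supported_rot uw sx1; rewrite e1 => sw.
have vw := rot_sym wv.
have [c1 s1] := sdir_step vw; rewrite e2 -/th' in c1 s1.
have FE : F = comb b^-1 (a / b) (sdir w v) (sdir w x).
  rewrite /F (chart_to_tri vw sw) e2; congr comb; rewrite ?mkptE ?pu ?px ?pv; field;
    by rewrite d0 gt_eqF.
split.
- rewrite FE -eb eY normrN ger0_norm; last by rewrite mulr_ge0 // ltW.
  rewrite mulfK ?gt_eqF // dot_comb c1 sdir_unit.
  by field; rewrite gt_eqF.
- rewrite FE -eb eY !mulNr mulfK ?gt_eqF // det_comb s1 detxx.
  by field; rewrite gt_eqF.
- by rewrite /open_star /= pu divr_gt0.
Qed.

Lemma star_adjacent (p : space) v w : open_star v p -> open_star w p -> w != v ->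
  w \in K v /\ 0 < height v w (chart_to v p).
Proof.
move=> pv pw wv; have [x xv h] := star (spaceP p) pv.
have wK : w \in K v.
  have [->//|wx] := eqVneq w x.
  have [->|wu] := eqVneq w (next (K v) x); first exact: rot_next.
  by move: pw; rewrite /open_star /= h // ltxx.
split => //; rewrite ltNge; apply/negP => hn.
move: pw; rewrite -(chart_toK pv) /open_star /chart_from /= /chart_pt (negbTE wv) wK.
by rewrite lamE posp0 // mul0r ltxx.
Qed.

(** [D] and [A] are the inner product and the absolute determinant at the centre, [e] the change of
    the former on a circle of radius [r], [B] the new value of the latter, and [k] a cotangent. The
    height thus drops by at most r (1 + k). *)
Lemma height_bound (r k D A B e : R) : r * (1 + k) < D - A * k -> - r <= e ->
  B * k <= (A + r) * k -> 0 < D + e - B * k.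
Proof. by rewrite mulrDr mulr1 mulrDl => h1 h2 h3; lra. Qed.

(** The line through the origin and the image of [p] serves as test line. The image of a point of
    the circle lies on it exactly when the point lies on the line through [p] in the direction of
    [w], and on a side determined by the side of the latter: this is the pattern asked for by
    [winds_once_halfplane]. The two bounds on [r] keep the circle in the overlap of the stars, and
    off the line along the edge unless the centre is on it. *)
Lemma transition_winds v w (p : plane R) r : w \in K v -> 0 < height v w p -> 0 < r ->
  r * (1 + cos (step (size (K v))) / sin (step (size (K v)))) < height v w p ->
  (det (sdir v w) p != 0 -> r < `|det (sdir v w) p|) ->
  winds_once (fun s => (chart_to w \o chart_from v) (circle_pt p r s))
    ((chart_to w \o chart_from v) p).
Proof.
move=> wv hp r0 rh rY.
set th := step (size (K v)) in rh; set th' : R := step (size (K w)).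
have sth : 0 < sin th := sin_step (rot_size K v).
have cth : 0 <= cos th := cos_step (rot_size K v).
have sth' : 0 < sin th' := sin_step (rot_size K w).
have cth' : 0 <= cos th' := cos_step (rot_size K w).
pose al : R := step (size (K v)) * (index w (K v))%:R.
pose F := chart_to w \o chart_from v.
have cot0 : 0 <= cos th / sin th by rewrite divr_ge0 // ltW.
have dX s : dot (sdir v w) (circle_pt p r s) =
    dot (sdir v w) p + r * cos (2 * pi * s - al).
  by rewrite cosB /dot /circle_pt /sdir /dir /= -/al; ring.
have dY s : det (sdir v w) (circle_pt p r s) =
    det (sdir v w) p + r * sin (2 * pi * s - al).
  by rewrite sinB /det /circle_pt /sdir /dir /= -/al; ring.
have cb s : `|r * cos (2 * pi * s - al)| <= r.
  rewrite normrM (ger0_norm (ltW r0)) ler_piMr ?(ltW r0) // ler_norml.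
  by rewrite cos_geN1 cos_le1.
have sb s : `|r * sin (2 * pi * s - al)| <= r.
  rewrite normrM (ger0_norm (ltW r0)) ler_piMr ?(ltW r0) // ler_norml.
  by rewrite sin_geN1 sin_le1.
have hs s : 0 < height v w (circle_pt p r s).
  rewrite /height dX dY -/th.
  have h1 := cb s; have h2 := sb s.
  have h3 := ler_normD (det (sdir v w) p) (r * sin (2 * pi * s - al)).
  have h4 : `|det (sdir v w) p + r * sin (2 * pi * s - al)| * (cos th / sin th) <=
      (`|det (sdir v w) p| + r) * (cos th / sin th).
    by apply: ler_wpM2r => //; lra.
  by move: h1; rewrite ler_norml => /andP [h1 _]; apply: height_bound rh h1 h4.
(* Either the centre is on the line along the edge, or the whole circle is on one side of it. Both
   make the cross term in [main] vanish. *)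
have same s : det (sdir v w) (circle_pt p r s) * `|det (sdir v w) p| =
    det (sdir v w) p * `|det (sdir v w) (circle_pt p r s)|.
  have [->|Yn] := eqVneq (det (sdir v w) p) 0; first by rewrite normr0 mulr0 mul0r.
  have := rY Yn; have := sb s; rewrite dY ler_norml => /andP [h1 h2].
  set e := r * _ in h1 h2 *; move: Yn; case: (ltgtP (det (sdir v w) p) 0) => // Y0 _ hr.
    rewrite ltr0_norm // in hr *; rewrite ltr0_norm; [by ring|by lra].
  rewrite gtr0_norm // in hr *; rewrite gtr0_norm; [by ring|by lra].
have [X0 Y0 O0] := transition_coord wv hp; rewrite -/th -/th' in X0 Y0.
have X0p : 0 < dot (sdir w v) (F p).
  rewrite X0 divr_gt0 //; apply: ltr_wpDr => //.
  by rewrite mulr_ge0 // divr_ge0 // ltW.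
have frame (q q' : plane R) : det q q' = dot (sdir w v) q * det (sdir w v) q' -
    det (sdir w v) q * dot (sdir w v) q'.
  by rewrite -[LHS]mul1r -{1}(sdir_unit w v) /det /dot; ring.
have frame' (q q' : plane R) : dot q q' = dot (sdir w v) q * dot (sdir w v) q' +
    det (sdir w v) q * det (sdir w v) q'.
  by rewrite -[LHS]mul1r -{1}(sdir_unit w v) /det /dot; ring.
apply: (@winds_once_halfplane _ _ _ (F p) al).
- apply: (@within_chart_to _ _ w (fun s => chart_from v (circle_pt p r s))) => [s _|t].
    by have [] := transition_coord wv (hs s).
  apply: within_chart_pt; apply: within_pair.
    apply: withinD; first exact: within_cst.
    apply: withinM; first exact: within_cst.
    apply: (within_comp (h := cos)); first exact: continuous_cos.
    apply: withinM; first exact: within_cst.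
    by apply: continuous_subspaceT => s; exact: cvg_id.
  apply: withinD; first exact: within_cst.
  apply: withinM; first exact: within_cst.
  apply: (within_comp (h := sin)); first exact: continuous_sin.
  apply: withinM; first exact: within_cst.
  by apply: continuous_subspaceT => s; exact: cvg_id.
- congr (F _); rewrite /circle_pt mulr1 mulr0 -[2 * pi]add0r.
  by rewrite cosD2pi sinD2pi.
- move=> s _ d; have [Xs Ys _] := transition_coord wv (hs s); rewrite -/th -/th' in Xs Ys.
  set q := circle_pt p r s in Xs Ys *.
  have hq : 0 < height v w q := hs s.
  have ed : det (F p) d = det (F p) (F q) by rewrite /d /det /=; ring.
  have edd : dot (F p) d = dot (F p) (F q) - dot (F p) (F p) by rewrite /d /dot /=; ring.
  have eY : det (sdir v w) q - det (sdir v w) p = r * sin (2 * pi * s - al).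
    by rewrite /q dY addrC addKr.
  have eX : dot (sdir v w) q - dot (sdir v w) p = r * cos (2 * pi * s - al).
    by rewrite /q dX addrC addKr.
  have hS := same s; rewrite -/q in hS.
  have main : det (F p) d = - (sin th' / sin th) / (height v w q * height v w p) *
      (r * sin (2 * pi * s - al)).
    rewrite ed frame X0 Y0 Xs Ys -eY.
    transitivity (- (sin th' / sin th) / (height v w q * height v w p) *
      (det (sdir v w) q - det (sdir v w) p + cos th' / sin th *
       (det (sdir v w) q * `|det (sdir v w) p| -
        det (sdir v w) p * `|det (sdir v w) q|))).
      by field; rewrite !gt_eqF.
    by rewrite hS subrr mulr0 addr0.
  have neg : - (sin th' / sin th) / (height v w q * height v w p) < 0.
    by rewrite mulNr oppr_lt0 !divr_gt0 ?mulr_gt0.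
  split.
  + by move=> h; rewrite main nmulr_rlt0 // mulr_gt0.
  + by move=> h; rewrite main nmulr_rgt0 // pmulr_rlt0.
  + move=> h; have eqY : det (sdir v w) q = det (sdir v w) p.
      by apply/eqP; rewrite -subr_eq0 eY h mulr0.
    have eh : height v w q - height v w p = r * cos (2 * pi * s - al).
      by rewrite -eX /height eqY; ring.
    have c2 : 0 < cos (2 * pi * s - al) ^+ 2.
      by have := cos_sin1 (2 * pi * s - al); rewrite h mul0r addr0 -expr2 => ->; exact: ltr01.
    have nn : 0 < dot (F p) (F p).
      by rewrite frame' ltr_wpDr ?mulr_gt0 // -expr2 sqr_ge0.
    have -> : dot (F p) d = - (r * cos (2 * pi * s - al)) / height v w q * dot (F p) (F p).
      rewrite edd -eh (frame' (F p) (F q)) (frame' (F p) (F p)) X0 Y0 Xs Ys eqY.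
      by field; rewrite !gt_eqF.
    have -> : - (r * cos (2 * pi * s - al)) / height v w q * dot (F p) (F p) *
        cos (2 * pi * s - al) =
      - (r * cos (2 * pi * s - al) ^+ 2 / height v w q * dot (F p) (F p)).
      by field; rewrite gt_eqF.
    by rewrite oppr_lt0 mulr_gt0 // divr_gt0 // mulr_gt0.
Qed.

Lemma orientable_space : orientable R space.
Proof.
exists (range (fun v => star_chart v)); split.
  move=> p; have [v pv] := star_cover p.
  by exists (star_chart v) => //; exists v.
move=> _ _ [v _ <-] [w _ <-] p /= pv pw.
have [->|wv] := eqVneq w v.
  near=> r; have r0 : 0 < r by near: r; exact: nbhs_right_gt.
  have e : (fun s => (chart_to v \o chart_from v) (circle_pt (chart_to v p) r s)) =
      circle_pt (chart_to v p) r by apply/funext => s /=; rewrite chart_fromK.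
  rewrite e /= chart_fromK; exists (fun=> r), (fun s => 2 * pi * s); split.
  - apply: withinM; first exact: within_cst.
    by apply: continuous_subspaceT => s; exact: cvg_id.
  - by rewrite mulr1 mulr0 add0r.
  - by [].
have [wK hp] := star_adjacent pv pw wv.
set q := chart_to v p in hp *.
have cot0 : 0 < 1 + cos (step (size (K v))) / sin (step (size (K v))) :> R.
  rewrite ltr_wpDr // divr_ge0 ?cos_step ?rot_size //.
  by apply: ltW; apply: sin_step; exact: rot_size.
have hY : \forall r \near (0 : R)^'+, det (sdir v w) q != 0 -> r < `|det (sdir v w) q|.
  have [e|Y0] := eqVneq (det (sdir v w) q) 0.
    by apply: nearW => r; rewrite e => /eqP.
  have h : 0 < `|det (sdir v w) q| by rewrite normr_gt0.
  by apply: filterS (nbhs_right_lt h) => r rlt _.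
near=> r; apply: transition_winds => //.
- rewrite -ltr_pdivlMr //; near: r; apply: nbhs_right_lt; exact: divr_gt0.
- by near: r.
Unshelve. all: by end_near.
Qed.

End Surface.

(** * Compactness, connectedness and the arcs of the edges *)

Section Points.
Context {R : realType} {T : finType} (K : triangulation T).
Local Notation space := (@space R T K).
Implicit Types (v w u t x z : T).

Definition vertex_pt v : prod_topology (fun _ : T => R) := fun t => (t == v)%:R.

Lemma rot_ex v : exists w, w \in K v.
Proof.
have := rot_size K v; case: (K v) => // w s _.
by exists w; rewrite mem_head.
Qed.

Lemma sum_delta v (c : R) : \sum_t (t == v)%:R * c = c.
Proof.
rewrite (bigD1 v) //= eqxx mul1r big1 ?addr0 // => t /negbTE ->.
by rewrite mul0r.
Qed.

Lemma vertex_pt_in v : realization K (vertex_pt v).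
Proof.
have [w wv] := rot_ex v; split.
- by move=> t; rewrite ler0n.
- rewrite -[RHS](sum_delta v 1); apply: eq_bigr => t _; by rewrite mulr1.
- by exists v, w; split => // t /negbTE tv _ _; rewrite /vertex_pt tv.
Qed.

Definition vtx v : space := mkpt (vertex_pt_in v).

Lemma vtxE v t : \val (vtx v) t = (t == v)%:R :> R.
Proof. by []. Qed.

(* Functions outside the realization are sent to the default point [d]. *)
Definition mkd (d : space) (p : prod_topology (fun _ : T => R)) : space :=
  match pselect (realization K p) with left h => mkpt h | right _ => d end.

Lemma mkdE d p : realization K p -> \val (mkd d p) = p.
Proof. by rewrite /mkd; case: pselect. Qed.

Lemma within_mkd (Y : topologicalType) (A : set Y) d
    (f : Y -> prod_topology (fun _ : T => R)) :
  (forall y, A y -> realization K (f y)) ->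
  (forall t, {within A, continuous (fun y => f y t : R)}) ->
  {within A, continuous (fun y => mkd d (f y))}.
Proof.
move=> fA cf; apply: within_space => t.
apply: (@subspace_eq_continuous Y A R (fun y => f y t)); last exact: cf.
move=> y /set_mem Ay; exact: (esym (congr1 (fun g => g t) (mkdE d (fA y Ay)))).
Qed.

Lemma hausdorff_realization : hausdorff_space space.
Proof.
move=> p q h; apply: space_inj => t; apply: Rhausdorff => A B nA nB.
have cp := @continuous_coord R T K t p; have cq := @continuous_coord R T K t q.
have [z [Az Bz]] := h _ _ (cp A nA) (cq B nB).
by exists (\val z t).
Qed.

(** There are finitely many triangles, and lying in one of them is a closed condition on the
    coordinates. *)
Lemma closed_realization : closed (realization K : set (prod_topology (fun _ : T => R))).
Proof.
have cpt (t : T) : continuous (fun p : prod_topology (fun _ : T => R) => p t : R).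
  by move=> p; exact: proj_continuous.
have -> : realization K = (\bigcap_(t in [set: T]) ((fun p : prod_topology (fun _ : T => R) => p t) @^-1` [set y : R | 0 <= y]))
   `&` ((fun p : prod_topology (fun _ : T => R) => \sum_t p t) @^-1` [set y : R | y = 1])
   `&` \bigcup_(e in [set e : T * T | e.2 \in K e.1])
      \bigcap_(t in [set t | [/\ t != e.1, t != e.2 & t != next (K e.1) e.2]])
        ((fun p : prod_topology (fun _ : T => R) => p t) @^-1` [set y : R | y = 0]).
  apply/seteqP; split=> p.
    move=> [p0 p1 [v [w [wv h]]]]; split; first by split => // t _; exact: p0.
    by exists (v, w) => // t [tv tw tu]; exact: h.
  move=> [[p0 p1] [[v w] wv h]]; split => //; first by move=> t; exact: p0.
  by exists v, w; split => // t tv tw tu; exact: h.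
apply: closedI; first apply: closedI.
- apply: closed_bigI => t _; apply: preimage_closed; last exact: closed_ge.
  by move=> p _; exact: cpt.
- apply: preimage_closed; last exact: closed_eq.
  have h : continuous (fun p : prod_topology (fun _ : T => R) => \sum_t p t : R).
    apply/continuous_subspace_setT.
    by apply: within_sum => t; apply: continuous_subspaceT; exact: cpt.
  by move=> p _; exact: h.
- apply: closed_bigcup => [|e _]; first exact: finite_finset.
  apply: closed_bigI => t _; apply: preimage_closed; last exact: closed_eq.
  by move=> p _; exact: cpt.
Qed.

Lemma compact_space (v0 : T) : compact [set: space].
Proof.
have cK : compact (realization K : set (prod_topology (fun _ : T => R))).
  apply: (subclosed_compact closed_realization
    (@tychonoff T (fun _ => R) (fun _ => `[0, 1]%classic) (fun _ => @segment_compact R 0 1))).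
  move=> p [p0 p1 _] t /=; rewrite in_itv /= p0 -p1 (bigD1 t) //= lerDl.
  by apply: sumr_ge0.
have -> : [set: space] = mkd (vtx v0) @` realization K.
  apply/seteqP; split=> // p _; exists (\val p); first exact: spaceP.
  by apply: space_inj => t; rewrite mkdE //; exact: spaceP.
apply: continuous_compact cK; apply: (within_mkd (f := id)) => // t.
by apply: continuous_subspaceT => p; exact: proj_continuous.
Qed.

Definition segment v (p : space) (s : R) : prod_topology (fun _ : T => R) :=
  fun t => (1 - s) * (t == v)%:R + s * \val p t.

Lemma segment_in v w (p : space) s : w \in K v -> supported K (\val p) v w ->
  0 <= s <= 1 -> realization K (segment v p s).
Proof.
move=> wv h /andP [s0 s1]; have [p0 p1 _] := spaceP p; split.
- by move=> t; rewrite addr_ge0 // mulr_ge0 // ?subr_ge0 // ler0n.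
- have d1 : \sum_t (t == v)%:R = 1 :> R.
    by rewrite -[RHS](sum_delta v 1); apply: eq_bigr => t _; rewrite mulr1.
  by rewrite /segment big_split /= -!mulr_sumr d1 p1 !mulr1 subrK.
- exists v, w; split => // t tv tw tu.
  by rewrite /segment h // (negbTE tv) !mulr0 addr0.
Qed.

(** The straight segment from the vertex [v] to [p] stays in a triangle that contains both. *)
Lemma segment_component v w (p : space) (A : set space) : w \in K v ->
  supported K (\val p) v w ->
  (forall s, 0 <= s <= 1 -> A (mkd p (segment v p s))) ->
  connected_component A (vtx v) p.
Proof.
move=> wv h hA; have hs (s : R) : 0 <= s <= 1 -> realization K (segment v p s).
  by move=> h01; exact: (segment_in wv h h01).
have e0 : mkd p (segment v p 0) = vtx v.
  apply: space_inj => t; rewrite mkdE ?vtxE ?/segment; last by apply: hs; rewrite lexx ler01.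
  by rewrite subr0 mul1r mul0r addr0.
have e1 : mkd p (segment v p 1) = p.
  apply: space_inj => t; rewrite mkdE ?/segment; last by apply: hs; rewrite lexx ler01.
  by rewrite subrr mul1r mul0r add0r.
have cn : connected ((fun s : R => mkd p (segment v p s)) @` `[0, 1]%classic).
  apply: connected_continuous_connected; first exact: segment_connected.
  apply: within_mkd => [s|t]; first by rewrite /= in_itv /=; exact: hs.
  apply: withinD; apply: withinM; try exact: within_cst.
    by apply: withinB; [exact: within_cst|apply: continuous_subspaceT => s; exact: cvg_id].
  by apply: continuous_subspaceT => s; exact: cvg_id.
apply: (connected_component_max _ _ cn).
- by exists 0 => //; rewrite /= in_itv /= lexx ler01.
- by move=> _ [s s01 <-]; apply: hA; move: s01; rewrite /= in_itv.
- by exists 1 => //; rewrite /= in_itv /= lexx ler01.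
Qed.

Lemma connected_realization (v0 : T) : connected [set: space].
Proof.
suff h p : connected_component [set: space] (vtx v0) p.
  rewrite (_ : [set: space] = connected_component [set: space] (vtx v0)).
    exact: component_connected.
  by apply/seteqP; split.
have hv v : connected_component [set: space] (vtx v0) (vtx v).
  apply: (@rot_conn T K (fun v => connected_component [set: space] (vtx v0) (vtx v)) _ v0).
    move=> {}v w wv h; apply: connected_component_trans h _.
    apply: (@segment_component v w) => // t tv tw _.
    by rewrite vtxE (negbTE tw).
  exact: connected_component_refl.
have [v pv] := star_cover p; have [w wv sp] := star (spaceP p) pv.
by apply: connected_component_trans (hv v) _; exact: segment_component wv sp _.
Qed.

Lemma closed_surface_space (v0 : T) : closed_surface R space.
Proof.
split.
- exact: hausdorff_realization.
- exact: compact_space v0.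
- exact: connected_realization v0.
- by exists (vtx v0).
- by move=> p; have [v pv] := star_cover p; exists (star_chart K v).
Qed.

(** Squares of cosine and sine, rather than a linear parametrization, make the arcs agree pointwise
    with uniform motion along the boundary of the disk in [disk_boundary]. *)
Definition arc_pt v w (s : R) : prod_topology (fun _ : T => R) := fun t =>
  (t == v)%:R * cos (pi / 2 * s) ^+ 2 + (t == w)%:R * sin (pi / 2 * s) ^+ 2.

Lemma arc_pt_in v w s : w \in K v -> realization K (arc_pt v w s).
Proof.
move=> wv; split.
- by move=> t; rewrite addr_ge0 // mulr_ge0 ?ler0n ?sqr_ge0.
- by rewrite big_split /= !sum_delta cos2Dsin2.
- by exists v, w; split => // t /negbTE tv /negbTE tw _; rewrite /arc_pt tv tw !mul0r addr0.
Qed.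

Definition arc v w s : space := mkd (vtx v) (arc_pt v w s).

Lemma arcE v w s : w \in K v -> \val (arc v w s) = arc_pt v w s.
Proof. by move=> wv; rewrite mkdE //; exact: arc_pt_in. Qed.

Lemma arc_angle (s : R) : 0 <= s <= 1 -> 0 <= pi / 2 * s <= pi / 2.
Proof.
have p0 := pi_gt0 R; move=> /andP [s0 s1]; apply/andP; split; first by rewrite mulr_ge0 //; lra.
by rewrite ler_piMr //; lra.
Qed.

Lemma arc_sin_gt0 (s : R) : 0 < s < 1 -> 0 < sin (pi / 2 * s) /\ 0 < cos (pi / 2 * s).
Proof.
have p0 := pi_gt0 R; move=> /andP [s0 s1].
have h1 : 0 < pi / 2 * s by rewrite mulr_gt0 //; lra.
have h2 : pi / 2 * s < pi / 2 by rewrite -[ltRHS]mulr1 ltr_pM2l //; lra.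
split; first by apply: sin_gt0_pi; apply/andP; split; lra.
by apply: cos_gt0_pihalf; apply/andP; split; lra.
Qed.

Lemma arc_rev v w s : w \in K v -> arc w v s = arc v w (1 - s).
Proof.
move=> wv; apply: space_inj => t; rewrite !arcE //; last exact: rot_sym.
have e : pi / 2 * (1 - s) = pi / 2 - pi / 2 * s by ring.
rewrite /arc_pt e cosB sinB cos_pihalf sin_pihalf; ring.
Qed.

Lemma arc_inj v w s s' : w \in K v -> 0 <= s <= 1 -> 0 <= s' <= 1 ->
  arc v w s = arc v w s' -> s = s'.
Proof.
move=> wv s01 s01' /(congr1 (fun p : space => \val p v)); rewrite !arcE // /arc_pt eqxx.
have -> : (v == w) = false by rewrite eq_sym (rot_neq wv).
rewrite !mul1r !mul0r !addr0 => /eqP.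
have /andP [a0 a1] := arc_angle s01; have /andP [b0 b1] := arc_angle s01'.
have p0 := pi_gt0 R.
rewrite eqrXn2 //; try (apply: cos_ge0_pihalf; apply/andP; split; lra).
move=> /eqP /cos_inj h; have : pi / 2 * s = pi / 2 * s'.
  by apply: h; rewrite in_itv /=; apply/andP; split; lra.
by apply: mulfI; rewrite gt_eqF //; lra.
Qed.

Lemma arc_gt0 v w s t : w \in K v -> 0 < s < 1 ->
  (0 < \val (arc v w s) t) = (t \in [:: v; w]).
Proof.
move=> wv /arc_sin_gt0 [h1 h2]; rewrite arcE // /arc_pt !inE.
have [->|tv] := eqVneq t v.
  have -> : (v == w) = false by rewrite eq_sym (rot_neq wv).
  by rewrite mul1r mul0r addr0 exprn_gt0.
have [_|_] := eqVneq t w; first by rewrite mul1r mul0r add0r exprn_gt0.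
by rewrite !mul0r addr0 ltxx.
Qed.

Lemma within_arc v w : w \in K v -> {within `[0, 1]%classic, continuous (arc v w)}.
Proof.
move=> wv; apply: within_mkd => [s _|t]; first exact: arc_pt_in.
have ca : {within `[0, 1]%classic, continuous (fun s : R => pi / 2 * s)}.
  apply: withinM; first exact: within_cst.
  by apply: continuous_subspaceT => s; exact: cvg_id.
apply: withinD; apply: withinM; try exact: within_cst; apply: withinX.
  by apply: (within_comp (h := cos)) ca; exact: continuous_cos.
by apply: (within_comp (h := sin)) ca; exact: continuous_sin.
Qed.

Lemma arc_onto v w (p : space) : w \in K v ->
  (forall t, t != v -> t != w -> \val p t = 0) ->
  exists2 s, 0 <= s <= 1 & p = arc v w s.
Proof.
move=> wv h; have [p0 p1 _] := spaceP p.
have e1 : \val p v + \val p w = 1.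
  rewrite -p1 (sum_two (x := v) (z := w)) ?(rot_neq wv) //.
  by move=> t _; exact: h.
have pw1 : \val p w <= 1 by rewrite -e1 lerDr.
pose a := asin (Num.sqrt (\val p w)).
have sq1 : -1 <= Num.sqrt (\val p w) <= 1.
  apply/andP; split; first by apply: le_trans (sqrtr_ge0 _); rewrite lerN10.
  by rewrite -[leRHS]sqrtr1; exact: ler_wsqrtr.
have sk : sin a = Num.sqrt (\val p w) by apply: asinK; rewrite in_itv.
have sa : sin a ^+ 2 = \val p w by rewrite sk sqr_sqrtr.
have a0 : 0 <= a.
  rewrite leNgt; apply/negP => an; have := asin_geNpi2 sq1; rewrite -/a => ga.
  have : 0 < sin (- a).
    by have ppi := pi_gt0 R; apply: sin_gt0_pi; apply/andP; split; lra.
  by rewrite sinN oppr_gt0 sk ltNge sqrtr_ge0.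
have a1 : a <= pi / 2 by exact: asin_lepi2.
have ph : 0 < pi / 2 :> R by have := pi_gt0 R; lra.
exists (a / (pi / 2)); first by rewrite divr_ge0 ?(ltW ph) //= ler_pdivrMr // mul1r.
apply: space_inj => t; rewrite arcE // /arc_pt [pi / 2 * _]mulrC divfK ?gt_eqF // cos2sin2 sa.
have [->|tv] := eqVneq t v.
  have -> : (v == w) = false by rewrite eq_sym (rot_neq wv).
  by rewrite mul1r mul0r addr0 -e1 addrK.
have [->|tw] := eqVneq t w; first by rewrite mul1r mul0r add0r.
by rewrite !mul0r addr0 h.
Qed.

End Points.

(** * The embedded graph and its faces *)

Section Faces.
Context {R : realType} (G : sgraph) (F : finType) (K : triangulation (G + F)%type).
Hypothesis rot_face : forall f : F, exists a b c d : G,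
  K (inr f) = [:: inl a; inl b; inl c; inl d].
Hypothesis rot_adj : forall x y : G, adj x y = (inl y \in K (inl x)).
Hypothesis rot_between : forall x y : G, adj x y ->
  exists f, next (K (inl x)) (inl y) = inr f.
Local Notation T := (G + F)%type.
Local Notation space := (@space R T K).

Lemma face_rotE f t : t \in K (inr f) -> exists x, t = inl x.
Proof.
have [a [b [c [d ->]]]] := rot_face f; rewrite !inE => /or4P [] /eqP ->.
- by exists a.
- by exists b.
- by exists c.
- by exists d.
Qed.

(** A triangle at a face vertex has graph vertices as its other two corners. *)
Lemma one_face (p : space) f g : @open_star R T K (inr f) p -> 0 < \val p (inr g) -> g = f.
Proof.
move=> pf pg; have [w wf h] := star (spaceP p) pf.
have [x ex] := face_rotE wf; have [y ey] := face_rotE (rot_next wf).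
have [[->]//|gf] := eqVneq (inr g : T) (inr f).
have e0 : \val p (inr g) = 0 by apply: h; rewrite ?ey ?ex.
by move: pg; rewrite e0 ltxx.
Qed.

Program Definition surface_embedding : embedding R G space :=
  @Embedding R G space (fun x => vtx K (inl x)) (fun x y => arc K (inl x) (inl y))
    _ _ _ _ _ _ _.
Next Obligation.
move=> x y /(congr1 (fun p : space => \val p (inl x))); rewrite !vtxE eqxx.
by case: eqP => [[]//|_ /eqP]; rewrite oner_eq0.
Qed.
Next Obligation. by move=> x y; rewrite rot_adj; exact: within_arc. Qed.
Next Obligation.
move=> x y; rewrite rot_adj => yx; apply: space_inj => t.
by rewrite arcE // /arc_pt mulr0 cos0 sin0 expr1n expr0n /= mulr1 mulr0 addr0.
Qed.
Next Obligation. by move=> x y; rewrite rot_adj => yx s _; exact: arc_rev. Qed.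
Next Obligation. by move=> x y; rewrite rot_adj => yx s s'; exact: arc_inj. Qed.
Next Obligation.
move=> x y; rewrite rot_adj => yx s z s01 e.
have := arc_gt0 (inl x) yx s01; have := arc_gt0 (inl y) yx s01.
rewrite e !vtxE !inE !eqxx orbT /=.
case: eqP => [[eyz]|]; last by rewrite ltxx.
case: eqP => [[exz]|]; last by rewrite ltxx.
by move: yx; rewrite eyz exz (negbTE (rot_irr _ _)).
Qed.
Next Obligation.
move=> x y x' y'; rewrite !rot_adj => yx yx' ne s s' s01 s01' e.
move/eqP: ne; apply; apply/setP => z; rewrite !finset.inE.
have h z0 : (z0 == x) || (z0 == y) = (inl z0 \in [:: inl x; inl y : T]) by rewrite !inE.
have h' z0 : (z0 == x') || (z0 == y') = (inl z0 \in [:: inl x'; inl y' : T]) by rewrite !inE.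
by rewrite h h' -(arc_gt0 _ yx s01) -(arc_gt0 _ yx' s01') e.
Qed.

Local Notation m := surface_embedding.

(** By [rot_between] and [face_rotE] every triangle has a face vertex. A point without weight there
    is carried by an edge of the graph. *)
Lemma emb_imageP (p : space) : ~ emb_image m p <-> exists f, @open_star R T K (inr f) p.
Proof.
split=> [h|[f pf] [[x e]|[x [y [s [xy s01 e]]]]]].
- apply: contrapT => nf; apply: h.
  have pF f : \val p (inr f) = 0.
    have [p0 _ _] := spaceP p; apply/eqP; rewrite eq_le p0 andbT leNgt.
    by apply/negP => pf; apply: nf; exists f.
  have [v pv] := star_cover p.
  case: v pv => [x|f]; last by rewrite /open_star /= pF ltxx.
  move=> px; have [w wx sp] := star (spaceP p) px.
  suff [y xy h] : exists2 y, adj x y & forall t, t != inl x -> t != inl y -> \val p t = 0.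
    right; have [s s01 ep] := arc_onto (R := R) (p := p) (etrans (esym (rot_adj x y)) xy) h.
    by exists x, y, s.
  case: w wx sp => [y|f] wx sp.
    have xy : adj x y by rewrite rot_adj.
    exists y => // t tx ty; have [f ef] := rot_between xy.
    have [->|tf] := eqVneq t (inr f); first exact: pF.
    by apply: sp => //; rewrite ef.
  have [uw _ _ _] := rot_tri2 wx; have [y ey] := face_rotE uw.
  exists y; first by rewrite rot_adj -ey rot_next.
  move=> t tx ty; have [->|tf] := eqVneq t (inr f); first exact: pF.
  by apply: sp => //; rewrite ey.
- move: pf; rewrite e => pf0.
  have : (0 : R) < (inr f == inl x :> T)%:R := pf0.
  by rewrite ltxx.
- move: pf; rewrite e => pf0.
  have : 0 < \val (arc K (inl x) (inl y) s : space) (inr f) := pf0.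
  by rewrite arcE -?rot_adj // /arc_pt /= !mul0r addr0 ltxx.
Qed.

(** The star is connected through segments to its centre. It is open, and closed in the complement
    of the graph because by [one_face] it is cut out there by the vanishing of the other face
    coordinates. *)
Lemma star_component (p : space) f : @open_star R T K (inr f) p ->
  connected_component (~` emb_image m) p = @open_star R T K (inr f).
Proof.
move=> pf; set A := ~` emb_image m.
have hv q : @open_star R T K (inr f) q -> connected_component A (vtx K (inr f)) q.
  move=> qf; have [w wf h] := star (spaceP q) qf; apply: (segment_component wf h) => s s01.
  apply/emb_imageP; exists f; rewrite /open_star /= mkdE; last exact: (segment_in wf h s01).
  rewrite /segment eqxx mulr1; move: qf s01; rewrite /open_star /= => qf /andP [s0 s1].
  have [s1'|s1'] := ltrP s 1; first by rewrite ltr_wpDr ?subr_gt0 // mulr_ge0 // ltW.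
  by rewrite ltr_wpDl ?subr_ge0 // mulr_gt0 //; lra.
apply/seteqP; split=> q.
- move=> [C [Cp CA cC] Cq].
  suff e : C `&` @open_star R T K (inr f) = C by move: Cq; rewrite -e => -[].
  apply: cC; first by exists p.
    by exists (@open_star R T K (inr f)) => //; exact: open_star_open.
  exists (\bigcap_(g in [set g | g != f]) [set z : space | \val z (inr g) = 0]).
    apply: closed_bigI => g _.
    apply: (@preimage_closed space R (fun z => \val z (inr g)) [set y | y = 0]); last exact: closed_eq.
    by move=> z _; exact: continuous_coord.
  apply/seteqP; split=> z [Cz hz]; split => //.
    move=> g /= gf; have [z0 _ _] := spaceP z; apply/eqP; rewrite eq_le z0 andbT leNgt.
    by apply/negP => zg; move: gf; rewrite (one_face hz zg) eqxx.
  have /emb_imageP [g zg] := CA z Cz.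
  have [<-//|gf] := eqVneq g f.
  by move: zg; rewrite /open_star /= (hz g gf) ltxx.
- move=> qf; apply: connected_component_trans (hv q qf).
  exact/connected_component_sym/hv.
Qed.

Lemma faceP (A : set space) : is_face m A -> exists f, A = @open_star R T K (inr f).
Proof.
by move=> [p /emb_imageP [f pf] ->]; exists f; exact: star_component.
Qed.

Section Disk.
Variables (f : F) (a b c d : G).
Hypothesis rf : K (inr f) = [:: inl a; inl b; inl c; inl d].
Implicit Types q : plane R.

(** The four quadrants of the disk are sent to the four triangles at [f]. The squares make the
    coordinates add up to 1 and turn the unit circle into the boundary of the face. *)
Definition disk_pt q : prod_topology (fun _ : T => R) := fun t =>
  (t == inr f)%:R * (1 - q.1 ^+ 2 - q.2 ^+ 2) +
  ((t == inl a)%:R * posp q.1 ^+ 2 + (t == inl b)%:R * posp q.2 ^+ 2 +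
   (t == inl c)%:R * posp (- q.1) ^+ 2 + (t == inl d)%:R * posp (- q.2) ^+ 2).

Lemma disk_neq : [/\ (a == b) = false, (a == c) = false & (a == d) = false] /\
  [/\ (b == c) = false, (b == d) = false & (c == d) = false].
Proof.
have := rot_uniq K (inr f); rewrite rf /= !inE !negb_or -!andbA.
by move=> /and5P [/negbTE h1 /negbTE h2 /negbTE h3 /negbTE h4 /and3P [/negbTE h5 /negbTE h6 _]].
Qed.

Lemma inl_eq (x y : G) : (inl x == inl y :> T) = (x == y).
Proof. by []. Qed.

Lemma disk_ptE q : [/\ disk_pt q (inr f) = 1 - q.1 ^+ 2 - q.2 ^+ 2,
    disk_pt q (inl a) = posp q.1 ^+ 2 & disk_pt q (inl b) = posp q.2 ^+ 2] /\
    [/\ disk_pt q (inl c) = posp (- q.1) ^+ 2,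
     disk_pt q (inl d) = posp (- q.2) ^+ 2
    & forall t, t != inr f -> t \notin K (inr f) -> disk_pt q t = 0].
Proof.
have [[h1 h2 h3] [h4 h5 h6]] := disk_neq.
rewrite /disk_pt !inl_eq !eqxx !(eq_sym b a) !(eq_sym c a) !(eq_sym d a) !(eq_sym c b)
  !(eq_sym d b) !(eq_sym d c) h1 h2 h3 h4 h5 h6 /=.
split; split; try ring.
move=> t /negbTE -> ; rewrite rf !inE !negb_or => /and4P [].
by move=> /negbTE -> /negbTE -> /negbTE -> /negbTE ->; rewrite !mul0r !addr0.
Qed.

Lemma posp_sqr (x : R) : posp x ^+ 2 + posp (- x) ^+ 2 = x ^+ 2.
Proof.
have [x0|x0] := lerP 0 x; first by rewrite pospE // posp0 ?oppr_le0 // expr0n addr0.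
by rewrite posp0 ?ltW // pospE ?oppr_ge0 ?ltW // expr0n add0r sqrrN.
Qed.

Lemma disk_next : [/\ next (K (inr f)) (inl a) = inl b, next (K (inr f)) (inl b) = inl c,
  next (K (inr f)) (inl c) = inl d & next (K (inr f)) (inl d) = inl a].
Proof.
have [[h1 h2 h3] [h4 h5 h6]] := disk_neq.
by rewrite rf /next /= !inl_eq !eqxx ?(eq_sym b a) ?(eq_sym c a) ?(eq_sym d a)
  ?(eq_sym c b) ?(eq_sym d b) ?(eq_sym d c) ?h1 ?h2 ?h3 ?h4 ?h5 ?h6.
Qed.

Lemma disk_mem : [/\ inl a \in K (inr f), inl b \in K (inr f), inl c \in K (inr f)
  & inl d \in K (inr f)].
Proof. by rewrite rf !inE !eqxx !orbT. Qed.

Lemma disk_pt_in q : q.1 ^+ 2 + q.2 ^+ 2 <= 1 -> realization K (disk_pt q).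
Proof.
move=> q1; split.
- move=> t; rewrite /disk_pt; do !apply: addr_ge0; apply: mulr_ge0;
    rewrite ?ler0n ?sqr_ge0 //; lra.
- rewrite !big_split /= !sum_delta.
  by have := posp_sqr q.1; have := posp_sqr q.2; lra.
- have [[e1 e2 e3] [e4 e5 e6]] := disk_ptE q.
  have [m1 m2 m3 m4] := disk_mem; have [n1 n2 n3 n4] := disk_next.
  have oth w u t : next (K (inr f)) w = u -> t != inr f -> t != w -> t != next (K (inr f)) w ->
      (forall z, z \in [:: a; b; c; d] -> inl z != w -> inl z != u -> disk_pt q (inl z) = 0) ->
      disk_pt q t = 0.
    move=> nw tf tw tu hz; case tK: (t \in K (inr f)); last by rewrite e6 ?tK.
    have [z ez] := face_rotE tK; rewrite nw in tu; rewrite ez in tw tu tK *; apply: hz => //.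
    by move: tK; rewrite rf !inE !inl_eq.
  have z0 (x : R) : x <= 0 -> posp x ^+ 2 = 0 by move=> /posp0 ->; rewrite expr0n.
  have ng (x : R) : 0 <= x -> - x <= 0 by rewrite oppr_le0.
  have [x0|/ltW x0] := lerP 0 q.1; have [y0|/ltW y0] := lerP 0 q.2.
  + exists (inr f), (inl a); split => // t tf tw tu; apply: oth n1 tf tw tu _ => z.
    rewrite !inE => /or4P [] /eqP ->; rewrite ?eqxx // => _ _.
      by rewrite e4 z0 // ng.
    by rewrite e5 z0 // ng.
  + exists (inr f), (inl d); split => // t tf tw tu; apply: oth n4 tf tw tu _ => z.
    rewrite !inE => /or4P [] /eqP ->; rewrite ?eqxx // => _ _.
      by rewrite e3 z0.
    by rewrite e4 z0 // ng.
  + exists (inr f), (inl b); split => // t tf tw tu; apply: oth n2 tf tw tu _ => z.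
    rewrite !inE => /or4P [] /eqP ->; rewrite ?eqxx // => _ _.
      by rewrite e2 z0.
    by rewrite e5 z0 // ng.
  + exists (inr f), (inl c); split => // t tf tw tu; apply: oth n3 tf tw tu _ => z.
    rewrite !inE => /or4P [] /eqP ->; rewrite ?eqxx // => _ _.
      by rewrite e2 z0.
    by rewrite e3 z0.
Qed.

Definition disk_to q : space := mkd (vtx K (inr f)) (disk_pt q).

(** In the star of [f] at most one of two opposite corners has weight, so the difference of the
    roots recovers a signed coordinate. *)
Definition disk_from (p : space) : plane R :=
  (Num.sqrt (\val p (inl a)) - Num.sqrt (\val p (inl c)),
   Num.sqrt (\val p (inl b)) - Num.sqrt (\val p (inl d))).

Lemma disk_toE q : q.1 ^+ 2 + q.2 ^+ 2 <= 1 -> \val (disk_to q) = disk_pt q.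
Proof. by move=> h; rewrite mkdE //; exact: disk_pt_in. Qed.

Lemma within_disk_to : {within @closed_disk R, continuous disk_to}.
Proof.
apply: within_mkd => [q|t]; first exact: disk_pt_in.
have cid : {within @closed_disk R, continuous (id : plane R -> plane R)}.
  by apply: continuous_subspaceT => q; exact: cvg_id.
have c1 := within_fst cid; have c2 := within_snd cid.
have tm (e : R) (g : plane R -> R) : {within @closed_disk R, continuous g} ->
    {within @closed_disk R, continuous (fun q => e * posp (g q) ^+ 2)}.
  move=> cg; apply: withinM; first exact: within_cst.
  by apply: withinX; exact: within_posp.
apply: withinD.
  apply: withinM; first exact: within_cst.
  apply: withinB; last exact: withinX.
  by apply: withinB; [exact: within_cst|exact: withinX].
by apply: withinD; [apply: withinD; [apply: withinD|]|]; apply: tm => //; exact: withinN.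
Qed.

Lemma star_face_coords (p : space) : @open_star R T K (inr f) p ->
  [/\ \val p (inl a) = 0 \/ \val p (inl c) = 0,
      \val p (inl b) = 0 \/ \val p (inl d) = 0,
      \val p (inr f) + \val p (inl a) + \val p (inl b) + \val p (inl c) + \val p (inl d) = 1
    & forall t, t != inr f -> t \notin K (inr f) -> \val p t = 0].
Proof.
move=> pf; have [w wf h] := star (spaceP p) pf; have [_ p1 _] := spaceP p.
have sm := supported_sum wf h p1.
have [[h1 h2 h3] [h4 h5 h6]] := disk_neq; have [n1 n2 n3 n4] := disk_next.
have hz z : inl z != w -> inl z != next (K (inr f)) w -> \val p (inl z) = 0.
  by move=> zw zu; apply: h.
have oth t : t != inr f -> t \notin K (inr f) -> \val p t = 0.
  move=> tf tK; apply: h => //; apply: contraNneq tK => ->; by rewrite ?rot_next.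
move: wf sm hz; rewrite {1}rf !inE => /or4P [] /eqP ->; rewrite ?n1 ?n2 ?n3 ?n4 => sm hz.
- have -> : \val p (inl c) = 0 by apply: hz; rewrite inl_eq (eq_sym c) ?h2 ?h4.
  have -> : \val p (inl d) = 0 by apply: hz; rewrite inl_eq (eq_sym d) ?h3 ?h5.
  by split; [right|right|rewrite !addr0|].
- have -> : \val p (inl a) = 0 by apply: hz; rewrite inl_eq ?h1 ?h2.
  have -> : \val p (inl d) = 0 by apply: hz; rewrite inl_eq (eq_sym d) ?h5 ?h6.
  by split; [left|right|rewrite !addr0|].
- have -> : \val p (inl a) = 0 by apply: hz; rewrite inl_eq ?h2 ?h3.
  have -> : \val p (inl b) = 0 by apply: hz; rewrite inl_eq ?h4 ?h5.
  by split; [left|left|rewrite !addr0|].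
- have -> : \val p (inl b) = 0.
    by apply: hz; rewrite inl_eq ?h5 // (eq_sym b) h1.
  have -> : \val p (inl c) = 0.
    by apply: hz; rewrite inl_eq ?h6 // (eq_sym c) h2.
  by split; [right|left|rewrite !addr0; move: sm; lra|].
Qed.

Lemma sqrt_sub_sqr (x y : R) : 0 <= x -> 0 <= y -> x = 0 \/ y = 0 ->
  [/\ (Num.sqrt x - Num.sqrt y) ^+ 2 = x + y,
      posp (Num.sqrt x - Num.sqrt y) ^+ 2 = x
    & posp (- (Num.sqrt x - Num.sqrt y)) ^+ 2 = y].
Proof.
have s0 (z : R) : 0 <= z -> [/\ Num.sqrt z ^+ 2 = z, posp (Num.sqrt z) ^+ 2 = z
    & posp (- Num.sqrt z) ^+ 2 = 0].
  move=> z0; rewrite pospE ?sqrtr_ge0 // posp0 ?oppr_le0 ?sqrtr_ge0 //.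
  by rewrite sqr_sqrtr // expr0n.
move=> x0 y0 [->|->]; rewrite sqrtr0 ?sub0r ?subr0 ?opprK ?add0r ?addr0 ?sqrrN.
  by have [? ? ?] := s0 _ y0.
by have [? ? ?] := s0 _ x0.
Qed.

Lemma disk_from_sqr (p : space) : open_star (inr f) p ->
  1 - ((disk_from p).1 ^+ 2 + (disk_from p).2 ^+ 2) = \val p (inr f).
Proof.
move=> pf; have [p0 _ _] := spaceP p; have [h1 h2 h3 _] := star_face_coords pf.
have e1 : (disk_from p).1 ^+ 2 = \val p (inl a) + \val p (inl c).
  by have [e _ _] := sqrt_sub_sqr (p0 _) (p0 _) h1; exact: e.
have e2 : (disk_from p).2 ^+ 2 = \val p (inl b) + \val p (inl d).
  by have [e _ _] := sqrt_sub_sqr (p0 _) (p0 _) h2; exact: e.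
by rewrite e1 e2 -h3; ring.
Qed.

Lemma disk_homeomorphism :
  homeomorphism (@open_disk R) (@open_star R T K (inr f)) disk_to disk_from.
Proof.
have sub q : open_disk q -> q.1 ^+ 2 + q.2 ^+ 2 <= 1 by move=> /ltW.
split.
- split; first by apply: continuous_subspaceW within_disk_to => q; exact: sub.
  have cs t : {within @open_star R T K (inr f), continuous (fun p : space => Num.sqrt (\val p t))}.
    by apply: (within_comp (h := Num.sqrt)); [exact: sqrt_continuous|exact: within_coord].
  by apply: within_pair; apply: withinB.
- move=> q hq; rewrite /open_star /= disk_toE; last exact: sub.
  have [[-> _ _] _] := disk_ptE q; move: hq; rewrite /open_disk /=; lra.
- move=> p pf; rewrite /open_disk /mkset -subr_gt0 disk_from_sqr //.
- move=> q /sub hq; rewrite /disk_from disk_toE //.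
  have [[_ -> ->] [-> -> _]] := disk_ptE q.
  have h (x : R) : Num.sqrt (posp x ^+ 2) - Num.sqrt (posp (- x) ^+ 2) = x.
    rewrite !sqrtr_sqr !ger0_norm ?posp_ge0 //.
    have [x0|x0] := lerP 0 x; first by rewrite pospE // posp0 ?oppr_le0 // subr0.
    by rewrite posp0 ?ltW // pospE ?oppr_ge0 ?ltW // sub0r opprK.
  by rewrite !h -surjective_pairing.
- move=> p pf; have [p0 _ _] := spaceP p; have [h1 h2 h3 h4] := star_face_coords pf.
  have [e1 e1' e1''] := sqrt_sub_sqr (p0 _) (p0 _) h1.
  have [e2 e2' e2''] := sqrt_sub_sqr (p0 _) (p0 _) h2.
  have hd : (disk_from p).1 ^+ 2 + (disk_from p).2 ^+ 2 <= 1.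
    by rewrite -subr_ge0 disk_from_sqr.
  apply: space_inj => t; rewrite disk_toE //.
  have [[d1 d2 d3] [d4 d5 d6]] := disk_ptE (disk_from p).
  have [->|tf] := eqVneq t (inr f); first by rewrite d1 -addrA -opprD disk_from_sqr.
  case tK: (t \in K (inr f)); last by rewrite d6 ?tK // h4 ?tK.
  move: tK; rewrite rf !inE => /or4P [] /eqP ->.
  + by rewrite d2 /= e1'.
  + by rewrite d3 /= e2'.
  + by rewrite d4 /= e1''.
  + by rewrite d5 /= e2''.
Qed.

Lemma disk_boundary (i : 'I_4) s : 0 <= s <= 1 ->
  let w := nth a [:: a; b; c; d] in
  disk_to (circle_pt (0, 0) 1 ((i%:R + s) / 4%:R)) =
  arc K (inl (w i)) (inl (w (ordS i))) s :> space.
Proof.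
move=> s01 w; set q := circle_pt _ _ _.
have hq : q.1 ^+ 2 + q.2 ^+ 2 <= 1.
  by rewrite /q /circle_pt /= !add0r !mul1r cos2Dsin2.
have [m1 m2 m3 m4] := disk_mem; have [n1 n2 n3 n4] := disk_next.
have [r1 _ _ _] := rot_tri2 m1; have [r2 _ _ _] := rot_tri2 m2.
have [r3 _ _ _] := rot_tri2 m3; have [r4 _ _ _] := rot_tri2 m4.
rewrite n1 n2 n3 n4 in r1 r2 r3 r4.
have /andP [a0 a1] := arc_angle s01; have pp := pi_gt0 R.
have c0 : 0 <= cos (pi / 2 * s) by apply: cos_ge0_pihalf; apply/andP; split; lra.
have s0 : 0 <= sin (pi / 2 * s) by apply: sin_ge0_pi; apply/andP; split; lra.
(* The side of index [i] starts at the angle i pi / 2, where the whole weight is on the corner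
   [w i]. *)
have ca : 2 * pi * ((i%:R + s) / 4%:R) = pi / 2 * s + pi / 2 * i%:R by field.
apply: space_inj => t; rewrite disk_toE // arcE; last first.
  by case: i {q hq ca} => [[|[|[|[|i]]]] hi] //=; rewrite ?r1 ?r2 ?r3 ?r4.
rewrite /disk_pt; set Y := _ - _ - _.
have -> : Y = 0.
  rewrite /Y /q /circle_pt /= !add0r !mul1r.
  by have := cos2Dsin2 (2 * pi * ((i%:R + s) / 4%:R)); lra.
rewrite mulr0 add0r /q /circle_pt /= !add0r !mul1r ca /arc_pt.
move: (pi / 2 * s) c0 s0 => x c0 s0.
have pz (y : R) : 0 <= y -> posp (- y) = 0 by move=> y0; rewrite posp0 // oppr_le0.
case: i {q hq ca Y} => [[|[|[|[|i]]]] hi] //=.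
- by rewrite mulr0 addr0 !pz // !pospE // expr0n /=; ring.
- by rewrite mulr1 cosDpihalf sinDpihalf opprK !pz // !pospE // expr0n /=; ring.
- have -> : x + pi / 2 * 2 = x + pi by field.
  by rewrite cosDpi sinDpi !opprK !pz // !pospE // expr0n /=; ring.
- have -> : x + pi / 2 * 3 = x + pi / 2 + pi by field.
  rewrite cosDpi sinDpi cosDpihalf sinDpihalf !opprK !pz // !pospE // expr0n /=; ring.
Qed.

End Disk.

Lemma surface_quadrangular : quadrangular m.
Proof.
split=> A /faceP [f ->]; have [a [b [c [d rf]]]] := rot_face f.
  exists (disk_from a b c d), (disk_to f a b c d).
  have [[c1 c2] h1 h2 k1 k2] := disk_homeomorphism rf.
  by split.
exists (fun i => nth a [:: a; b; c; d] i); split.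
  have [m1 m2 m3 m4] := disk_mem rf; have [n1 n2 n3 n4] := disk_next rf.
  have [r1 _ _ _] := rot_tri2 m1; have [r2 _ _ _] := rot_tri2 m2.
  have [r3 _ _ _] := rot_tri2 m3; have [r4 _ _ _] := rot_tri2 m4.
  rewrite n1 n2 n3 n4 in r1 r2 r3 r4.
  by case=> [[|[|[|[|i]]]] hi] //=; rewrite rot_adj.
exists (disk_to f a b c d); split.
- exact: within_disk_to.
- by exists (disk_from a b c d); exact: disk_homeomorphism.
- by move=> i s; exact: disk_boundary.
Qed.

End Faces.

(** * The triangulation with one more vertex in every face *)

Section QuadSystem.
Context {V F : finType} (fo : F -> seq V).
Local Notation T := (V + F)%type.
Implicit Types (x y z : V) (i j : F).

Definition dart x y := [exists i, (x \in fo i) && (next (fo i) x == y)].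

Hypothesis fo_uniq : forall i, uniq (fo i).
Hypothesis fo_size : forall i, size (fo i) = 4%N.
Hypothesis fo_inj : forall i j x, x \in fo i -> x \in fo j ->
  next (fo i) x = next (fo j) x -> i = j.
Hypothesis dart_sym : symmetric dart.
Hypothesis fo_link : forall x (P : pred V),
  (forall i, x \in fo i -> P (next (fo i) x) -> P (prev (fo i) x)) ->
  forall y z, dart x y -> dart x z -> P y -> P z.
Variable x0 : V.
Hypothesis x0_dom : forall y, y != x0 -> dart x0 y.
Hypothesis x0_nontriv : exists y, y != x0.

Lemma dartP x y : reflect (exists2 i, x \in fo i & next (fo i) x = y) (dart x y).
Proof.
apply: (iffP existsP) => [[i /andP [h /eqP e]]|[i h e]]; first by exists i.
by exists i; rewrite h e eqxx.
Qed.

Lemma dart_next x i : x \in fo i -> dart x (next (fo i) x).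
Proof. by move=> h; apply/dartP; exists i. Qed.

Lemma dart_prev x i : x \in fo i -> dart x (prev (fo i) x).
Proof.
move=> h; rewrite dart_sym; apply/dartP; exists i; first by rewrite mem_prev.
exact: next_prev.
Qed.

Lemma next_neq_prev x i : x \in fo i -> next (fo i) x != x /\ next (fo i) x != prev (fo i) x.
Proof.
move=> h; have u := fo_uniq i; have s4 := fo_size i.
have hx : (index x (fo i) < 4)%N by rewrite -s4 index_mem.
have e1 : next (fo i) x = nth x (fo i) ((index x (fo i)).+1 %% 4)%N.
  by rewrite (@next_nth_mod _ x) // s4.
have e2 : next (fo i) (next (fo i) x) = nth x (fo i) ((index x (fo i)).+2 %% 4)%N.
  rewrite (@next_nth_mod _ x) ?mem_next // s4 e1 index_uniq ?s4 ?ltn_mod //.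
  by rewrite -addn1 modnDml addn1.
split.
  rewrite e1 -[X in _ != X](nth_index x h) nth_uniq ?s4 ?ltn_mod //.
  by case: (index _ _) hx => [|[|[|[|]]]].
apply/eqP => e; have : next (fo i) (next (fo i) x) = x by rewrite e next_prev.
rewrite e2 -[X in _ = X](nth_index x h) => /eqP; rewrite nth_uniq ?s4 ?ltn_mod //.
by case: (index _ _) hx => [|[|[|[|]]]].
Qed.

Lemma dart_irr x : dart x x = false.
Proof.
by apply/dartP => -[i h e]; have [] := next_neq_prev h; rewrite e eqxx.
Qed.

(* Rotation at a vertex: an edge is followed by the face on its left, and a
   face by the edge preceding it at x. *)
Definition turn x (t : T) : T :=
  match t with
  | inl y => if [pick i | (x \in fo i) && (next (fo i) x == y)] is Some i
             then inr i else inl y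
  | inr i => if x \in fo i then inl (prev (fo i) x) else inr i
  end.

Definition incident x (t : T) : bool :=
  match t with inl y => dart x y | inr i => x \in fo i end.

Lemma turn_next x i : x \in fo i -> turn x (inl (next (fo i) x)) = inr i.
Proof.
move=> h /=; case: pickP => [j /andP [hj /eqP e]|/(_ i)]; last by rewrite h eqxx.
by rewrite (fo_inj h hj).
Qed.

Lemma turn_face x i : x \in fo i -> turn x (inr i) = inl (prev (fo i) x).
Proof. by move=> /= ->. Qed.

Lemma incident_turn x t : incident x (turn x t) = incident x t.
Proof.
case: t => [y|i]; last first.
  case h: (x \in fo i); first by rewrite turn_face //= h dart_prev.
  by rewrite /= h /= h.
case h: (dart x y); last first.
  rewrite /=; case: pickP => [i hi|_ /=]; last by rewrite h.
  by move/dartP: h => []; case/andP: hi => h1 /eqP h2; exists i.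
by have /dartP [i hi <-] := h; rewrite turn_next //= hi dart_next.
Qed.

Lemma turn_id x t : ~~ incident x t -> turn x t = t.
Proof.
case: t => [y|i] /= h; last by rewrite (negbTE h).
by case: pickP => // i hi; case/negP: h; apply/existsP; exists i.
Qed.

Lemma turn_inj x : injective (turn x).
Proof.
move=> t t' e; have := incident_turn x t; rewrite e incident_turn.
case ht': (incident x t') => ht; last first.
  by move: e; rewrite !turn_id ?ht' -?ht.
case: t t' ht' ht e => [y|i] [y'|i'].
- move=> /dartP [i' hi' <-] /esym /dartP [i hi <-].
  by rewrite !turn_next // => -[->].
- move=> hi' /esym /dartP [i hi <-]; have {}hi' : x \in fo i' := hi'.
  by rewrite turn_next // turn_face.
- move=> /dartP [i' hi' <-] /esym hi; have {}hi : x \in fo i := hi.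
  by rewrite turn_next // turn_face.
- move=> hi' /esym hi; have {}hi' : x \in fo i' := hi'; have {}hi : x \in fo i := hi.
  rewrite !turn_face // => -[e]; congr inr.
  have e1 := next_prev (fo_uniq i) x; have e2 := next_prev (fo_uniq i') x.
  (* The face is recovered from the dart that enters [x], which starts at the common predecessor. *)
  apply: (@fo_inj i i' (prev (fo i) x)); rewrite ?mem_prev // ?e ?mem_prev //.
  by rewrite e2 -e e1.
Qed.

Lemma dart_ex x : exists y, dart x y.
Proof.
have [->|nx] := eqVneq x x0.
  by have [y hy] := x0_nontriv; exists y; exact: x0_dom.
by exists x0; rewrite dart_sym; exact: x0_dom.
Qed.

Definition some_nbr x : V := odflt x0 [pick y | dart x y].

Lemma some_nbrP x : dart x (some_nbr x).
Proof.
rewrite /some_nbr; case: pickP => [y //|h].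
by have [y hy] := dart_ex x; move: (h y); rewrite hy.
Qed.

Definition rotation (t : T) : seq T :=
  match t with
  | inl x => orbit (turn x) (inl (some_nbr x))
  | inr i => [seq inl x | x <- fo i]
  end.

(** Two turns lead from the successor of [x] in a face to its predecessor, so by [fo_link] all edges
    at [x] lie in a single orbit, and the faces between them as well. *)
Lemma mem_rotation x t : (t \in rotation (inl x)) = incident x t.
Proof.
rewrite /= -fconnect_orbit; apply/idP/idP.
  move=> /iter_findex <-; elim: findex => [|k IH] /=; first exact: some_nbrP.
  by rewrite incident_turn.
have step t1 t2 : turn x t1 = t2 -> fconnect (turn x) (inl (some_nbr x)) t1 ->
    fconnect (turn x) (inl (some_nbr x)) t2.
  by move=> <- h; apply: connect_trans h _; exact: fconnect1.
have hl y : dart x y -> fconnect (turn x) (inl (some_nbr x)) (inl y).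
  move=> hy; apply: (@fo_link x (fun y => fconnect (turn x) (inl (some_nbr x)) (inl y))
    _ _ _ (some_nbrP x) hy); last exact: connect0.
  move=> i hi h; apply: (step (inr i)); first exact: turn_face.
  by apply: step h; exact: turn_next.
case: t => [y|i] /=; first exact: hl.
by move=> hi; apply: (step _ _ (turn_next hi)); apply: hl; exact: dart_next.
Qed.

Lemma mem_rotation_face i t : (t \in rotation (inr i)) =
  match t with inl x => x \in fo i | inr _ => false end.
Proof.
case: t => [x|j] /=; first by rewrite mem_map //; exact: inl_inj.
by apply/negP => /mapP [].
Qed.

Lemma next_rotation x t : incident x t -> next (rotation (inl x)) t = turn x t.
Proof.
rewrite -mem_rotation => h; apply/eqP; rewrite eq_sym.
by have := next_cycle (cycle_orbit (@turn_inj x) (inl (some_nbr x))) h.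
Qed.

Lemma next_rotation_face i x : x \in fo i ->
  next (rotation (inr i)) (inl x) = inl (next (fo i) x).
Proof. by move=> h; rewrite /= next_map //; exact: inl_inj. Qed.

Lemma rotation_uniq v : uniq (rotation v).
Proof.
case: v => [x|i]; first exact: orbit_uniq.
by rewrite map_inj_uniq //; exact: inl_inj.
Qed.

Lemma rotation_size v : (4 <= size (rotation v))%N.
Proof.
case: v => [x|i]; last by rewrite size_map fo_size.
have /dartP [i hi _] := some_nbrP x.
have [hx np] := next_neq_prev hi.
(* [j] is the face across the edge from [x] to its predecessor in [i]. Two edges and two faces are
   four distinct entries of the rotation. *)
have /dartP [j hj ej] := dart_prev hi.
have ij : i != j by apply: contraNneq np => ij; rewrite -ej ij.
pose s : seq T := [:: inl (next (fo i) x); inl (prev (fo i) x); inr i; inr j].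
have us : uniq s.
  rewrite /= !inE !negb_or /= andbT; apply/and3P; split => //.
have ss : {subset s <= rotation (inl x)}.
  move=> t; rewrite mem_rotation !inE => /or4P [] /eqP -> //=.
    exact: dart_next.
  exact: dart_prev.
exact: uniq_leq_size us ss.
Qed.

Lemma rotation_irr v : v \notin rotation v.
Proof. by case: v => [x|i]; rewrite ?mem_rotation ?mem_rotation_face //= dart_irr. Qed.

Lemma rotation_tri v w : w \in rotation v ->
  (next (rotation v) w \in rotation w) && (next (rotation w) (next (rotation v) w) == v).
Proof.
case: v => [x|i]; rewrite ?mem_rotation ?mem_rotation_face; last first.
  case: w => // x hx; rewrite next_rotation_face // mem_rotation /= dart_next //.
  by rewrite next_rotation ?turn_next //= dart_next.
case: w => [y|i] h; rewrite next_rotation //.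
  have /dartP [i hi ey] := h; rewrite -ey turn_next // mem_rotation /= mem_next hi.
  by rewrite next_rotation /= mem_next hi // prev_next.
have hx : x \in fo i := h.
by rewrite turn_face // mem_rotation_face mem_prev hx next_rotation_face ?mem_prev //
  next_prev // eqxx.
Qed.

Lemma rotation_conn (P : T -> Prop) :
  (forall v w, w \in rotation v -> P v -> P w) -> forall v w, P v -> P w.
Proof.
move=> h v w Pv.
have fo_ex i : exists x, x \in fo i.
  by have := fo_size i; case: (fo i) => // x s _; exists x; rewrite mem_head.
have to0 x : P (inl x) -> P (inl x0).
  have [->//|nx] := eqVneq x x0.
  by apply: h; rewrite mem_rotation /= dart_sym x0_dom.
have P0 : P (inl x0).
  case: v Pv => [x|i] Pv; first exact: to0 Pv.
  have [x xi] := fo_ex i; apply: (to0 x); apply: h Pv.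
  by rewrite mem_rotation_face.
have from0 x : P (inl x).
  have [->//|nx] := eqVneq x x0.
  by apply: h P0; rewrite mem_rotation /= x0_dom.
case: w => [x|i]; first exact: from0.
by have [x xi] := fo_ex i; apply: h (from0 x); rewrite mem_rotation.
Qed.

Definition quad_triangulation : triangulation T :=
  Triangulation rotation_uniq rotation_size rotation_irr rotation_tri rotation_conn.

Definition quad_graph : sgraph := @SGraph V dart dart_sym dart_irr.

(** Darts are counted twice: four on each face and two on each edge. *)
Lemma card_edges : (2 * #|edges quad_graph| = 4 * #|F|)%N.
Proof.
pose D := [set p : V * V | dart p.1 p.2]%SET.
have cD : #|D| = (4 * #|F|)%N.
  pose s := flatten [seq [seq (x, next (fo i) x) | x <- fo i] | i <- enum F].
  have ms p : (p \in s) = dart p.1 p.2.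
    case: p => x y; rewrite [RHS]/=; apply/flatten_mapP/dartP => [[i _ /mapP [z zi [-> ->]]]|[i xi <-]].
      by exists i.
    by exists i; rewrite ?mem_enum //; apply/mapP; exists x.
  have us : uniq s.
    rewrite /s; have : uniq (enum F) by exact: enum_uniq.
    elim: (enum F) => //= i e IH /andP [ie ue]; rewrite cat_uniq IH // andbT.
    rewrite map_inj_uniq ?fo_uniq /=; last by move=> x y [].
    apply/hasPn => p /flatten_mapP [j je /mapP [x xj ->]]; apply/mapP => -[y yi [exy e2]].
    by move: ie; rewrite -exy in yi e2; rewrite (fo_inj yi xj (esym e2)) je.
  have -> : #|D| = #|s| by apply: eq_card => p; rewrite finset.inE ms.
  rewrite (card_uniqP us) /s size_flatten /shape -map_comp.
  rewrite (@eq_map _ _ _ (fun=> 4%N)); last by move=> i; rewrite /= size_map fo_size.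
  by rewrite cardE; elim: (enum F) => //= i e IH; rewrite IH mulnS.
rewrite -cD -[#|D|]sum1_card (partition_big (fun p => [set p.1; p.2]%SET) (mem (edges quad_graph))) /=.
  rewrite mulnC -sum_nat_const; apply: eq_bigr => e /imset2P [x y _].
  rewrite finset.inE => /andP [_ xy] ->; rewrite sum1dep_card.
  have nxy : x != y by apply: contraTneq xy => ->; rewrite /= dart_irr.
  have -> : [set p in D | [set p.1; p.2]%SET == [set x; y]%SET]%SET =
      [set (x, y); (y, x)]%SET.
    apply/setP => -[a b]; rewrite !finset.inE /= !xpair_eqE; apply/idP/idP.
      move=> /andP [ab /eqP e1].
      have : a \in [set x; y]%SET by rewrite -e1 !finset.inE eqxx.
      have : b \in [set x; y]%SET by rewrite -e1 !finset.inE eqxx orbT.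
      have nab : a != b by apply: contraTneq ab => ->; rewrite dart_irr.
      rewrite !finset.inE => /orP [] /eqP eb /orP [] /eqP ea; move: nab;
        by rewrite ea eb ?eqxx ?orbT.
    move=> /orP [] /andP [/eqP -> /eqP ->]; first by rewrite [dart _ _]xy eqxx.
    by rewrite dart_sym [dart _ _]xy /= finset.setUC.
  rewrite cards2 xpair_eqE (negbTE nxy) //.
move=> p; rewrite finset.inE => hp; apply/imset2P; exists p.1 p.2 => //.
by rewrite finset.inE.
Qed.

End QuadSystem.

(** * From lists of faces to embedded graphs *)

Lemma next_face_dart (f : face) x : quadface f -> x \in f ->
  (x, next f x) \in face_darts f /\ (x, (next f x, prev f x)) \in face_corners f.
Proof.
move=> qf xf; have [a [b [c [d ef]]]] := quadfaceE qf; move: qf xf.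
rewrite ef /quadface /= !inE !negb_or -!andbA.
move=> /and5P [/negbTE h1 /negbTE h2 /negbTE h3 /negbTE h4 /and3P [/negbTE h5 /negbTE h6 _]].
by move=> /or4P [] /eqP ->; rewrite /next /prev /= ?eqxx ?(eq_sym b a) ?(eq_sym c a)
  ?(eq_sym d a) ?(eq_sym c b) ?(eq_sym d b) ?(eq_sym d c) ?h1 ?h2 ?h3 ?h4 ?h5 ?h6 ?eqxx ?orbT.
Qed.

Lemma face_dart_next (f : face) x y : quadface f -> (x, y) \in face_darts f ->
  x \in f /\ next f x = y.
Proof.
move=> qf; have [a [b [c [d ef]]]] := quadfaceE qf; move: qf.
rewrite ef /quadface /= !inE !negb_or -!andbA.
move=> /and5P [/negbTE h1 /negbTE h2 /negbTE h3 /negbTE h4 /and3P [/negbTE h5 /negbTE h6 _]].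
by move=> /or4P [] /eqP [-> ->]; rewrite /next /= ?eqxx ?(eq_sym b a) ?(eq_sym c a)
  ?(eq_sym d a) ?(eq_sym c b) ?(eq_sym d b) ?(eq_sym d c) ?h1 ?h2 ?h3 ?h4 ?h5 ?h6 ?eqxx ?orbT.
Qed.

Lemma face_corner_next (f : face) x y z : quadface f -> (x, (y, z)) \in face_corners f ->
  [/\ x \in f, next f x = y & prev f x = z].
Proof.
move=> qf; have [a [b [c [d ef]]]] := quadfaceE qf; move: qf.
rewrite ef /quadface /= !inE !negb_or -!andbA.
move=> /and5P [/negbTE h1 /negbTE h2 /negbTE h3 /negbTE h4 /and3P [/negbTE h5 /negbTE h6 _]].
by move=> /or4P [] /eqP [-> -> ->]; rewrite /next /prev /= ?eqxx ?(eq_sym b a) ?(eq_sym c a)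
  ?(eq_sym d a) ?(eq_sym c b) ?(eq_sym d b) ?(eq_sym d c) ?h1 ?h2 ?h3 ?h4 ?h5 ?h6 ?eqxx ?orbT.
Qed.

Lemma uniq_flatten_nth (X : eqType) (ss : seq (seq X)) i j x : uniq (flatten ss) ->
  (i < size ss)%N -> (j < size ss)%N ->
  x \in nth [::] ss i -> x \in nth [::] ss j -> i = j.
Proof.
elim: ss i j => // s ss IH [|i] [|j] //=; rewrite cat_uniq => /and3P [_ /hasPn h us].
- move=> _ js xs xj; have : x \in flatten ss.
    by apply/flattenP; exists (nth [::] ss j) => //; exact: mem_nth.
  by move/h; rewrite /= xs.
- move=> is_ _ xi xs; have : x \in flatten ss.
    by apply/flattenP; exists (nth [::] ss i) => //; exact: mem_nth.
  by move/h; rewrite /= xs.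
- by move=> hi hj xi xj; congr S; exact: IH.
Qed.

Section FromFaces.
Variables (n : nat) (fs : seq face).
Hypothesis n_gt0 : (0 < n)%N.
Hypothesis fs_quad : quad fs.
Hypothesis fs_labels : labels_lt n.+1 fs.
Hypothesis fs_dom : forall v, (0 < v < n.+1)%N -> (0%N, v) \in darts fs.

Definition face_nat (i : 'I_(size fs)) : face := nth [::] fs i.
Definition face_ord (i : 'I_(size fs)) : seq 'I_n.+1 := map inord (face_nat i).

Lemma face_nat_mem i : face_nat i \in fs.
Proof. by rewrite mem_nth. Qed.

Lemma face_nat_quad i : quadface (face_nat i).
Proof. by have [/allP f4 _ _ _] := fs_quad; apply: f4; exact: face_nat_mem. Qed.

Lemma face_ordK i : map val (face_ord i) = face_nat i.
Proof.
rewrite /face_ord -map_comp map_id_in // => x hx; rewrite /= inordK //.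
by have /allP := allP fs_labels _ (face_nat_mem i); apply.
Qed.

Lemma mem_face_ord i x : (x \in face_ord i) = (val x \in face_nat i).
Proof. by rewrite -face_ordK mem_map //; exact: val_inj. Qed.

Lemma face_ord_uniq i : uniq (face_ord i).
Proof.
by rewrite -(map_inj_uniq val_inj) face_ordK; have /andP [] := face_nat_quad i.
Qed.

Lemma face_ord_size i : size (face_ord i) = 4%N.
Proof. by rewrite size_map; have /andP [/eqP] := face_nat_quad i. Qed.

Lemma next_face_ord i x : val (next (face_ord i) x) = next (face_nat i) (val x).
Proof. by rewrite -face_ordK (next_map val_inj) ?face_ord_uniq. Qed.

Lemma prev_face_ord i x : val (prev (face_ord i) x) = prev (face_nat i) (val x).
Proof. by rewrite -face_ordK (prev_map val_inj) ?face_ord_uniq. Qed.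

Lemma dart_nat x y : dart face_ord x y = ((val x, val y) \in darts fs).
Proof.
apply/dartP/flatten_mapP => [[i xi <-]|[f ff xy]].
  exists (face_nat i); first exact: face_nat_mem.
  rewrite next_face_ord; move: xi; rewrite mem_face_ord => xi.
  by have [] := next_face_dart (face_nat_quad i) xi.
have fi : (index f fs < size fs)%N by rewrite index_mem.
have ef : face_nat (Ordinal fi) = f by rewrite /face_nat /= nth_index.
have qf : quadface f by rewrite -ef face_nat_quad.
have [xf nf] := face_dart_next qf xy.
exists (Ordinal fi); first by rewrite mem_face_ord ef.
by apply: val_inj; rewrite next_face_ord ef.
Qed.

Lemma face_ord_inj i j x : x \in face_ord i -> x \in face_ord j ->
  next (face_ord i) x = next (face_ord j) x -> i = j.
Proof.
rewrite !mem_face_ord => xi xj /(congr1 val); rewrite !next_face_ord => e.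
have [di _] := next_face_dart (face_nat_quad i) xi.
have [dj _] := next_face_dart (face_nat_quad j) xj.
have [_ un _ _] := fs_quad; apply: val_inj.
apply: (@uniq_flatten_nth _ (map face_darts fs) (val i) (val j)
  (val x, next (face_nat i) (val x)) un); rewrite ?size_map ?ltn_ord //.
  by rewrite (nth_map ([::] : face)) ?ltn_ord.
by rewrite (nth_map ([::] : face)) ?ltn_ord // e.
Qed.

Lemma dart_ord_sym : symmetric (dart face_ord).
Proof.
have [_ _ sy _] := fs_quad.
by move=> x y; rewrite !dart_nat; apply/idP/idP; exact: sy.
Qed.

Lemma face_ord_link x (P : pred 'I_n.+1) :
  (forall i, x \in face_ord i -> P (next (face_ord i) x) -> P (prev (face_ord i) x)) ->
  forall y z, dart face_ord x y -> dart face_ord x z -> P y -> P z.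
Proof.
move=> h y z; rewrite !dart_nat => xy xz Py.
have [_ _ _ ln] := fs_quad.
have := ln (val x) (fun k => P (inord k)) _ (val y) (val z) xy xz.
rewrite !inord_val; apply => // u v /flatten_mapP [f ff c].
have fi : (index f fs < size fs)%N by rewrite index_mem.
have ef : face_nat (Ordinal fi) = f by rewrite /face_nat /= nth_index.
have qf : quadface f by rewrite -ef face_nat_quad.
have [xf <- <-] := face_corner_next qf c.
have := h (Ordinal fi); rewrite mem_face_ord ef xf => /(_ isT).
have -> : next f (val x) = val (next (face_ord (Ordinal fi)) x) by rewrite next_face_ord ef.
have -> : prev f (val x) = val (prev (face_ord (Ordinal fi)) x) by rewrite prev_face_ord ef.
by rewrite !inord_val.
Qed.

Lemma dart_ord0 (y : 'I_n.+1) : y != ord0 -> dart face_ord ord0 y.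
Proof.
move=> y0; rewrite dart_nat; apply: fs_dom; rewrite ltn_ord andbT lt0n.
by apply: contraNneq y0 => e; apply/eqP/val_inj.
Qed.

Lemma ord_nontriv : exists y : 'I_n.+1, y != ord0.
Proof. by exists ord_max; rewrite -val_eqE /= -lt0n. Qed.

Definition faces_graph : sgraph := quad_graph face_ord_uniq face_ord_size dart_ord_sym.

Definition faces_triangulation : triangulation (faces_graph + 'I_(size fs))%type :=
  quad_triangulation face_ord_uniq face_ord_size face_ord_inj dart_ord_sym face_ord_link
    dart_ord0 ord_nontriv.

Lemma faces_rot_face (f : 'I_(size fs)) : exists a b c d : faces_graph,
  faces_triangulation (inr f) = [:: inl a; inl b; inl c; inl d].
Proof.
rewrite /faces_triangulation /=; have := face_ord_size f.
by case: (face_ord f) => [|a [|b [|c [|d []]]]] //= _; exists a, b, c, d.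
Qed.

Lemma faces_rot_adj (x y : faces_graph) :
  adj x y = (inl y \in faces_triangulation (inl x)).
Proof.
apply/esym; exact: (mem_rotation face_ord_uniq face_ord_inj dart_ord_sym face_ord_link dart_ord0 ord_nontriv).
Qed.

Lemma faces_rot_between (x y : faces_graph) : adj x y ->
  exists f, next (faces_triangulation (inl x)) (inl y) = inr f.
Proof.
move=> /dartP [i xi <-]; exists i.
apply: etrans (turn_next face_ord_inj xi).
apply: (next_rotation face_ord_uniq face_ord_inj dart_ord_sym face_ord_link dart_ord0 ord_nontriv).
exact: dart_next.
Qed.

Lemma quadrangulation_of_faces (R : realType) t :
  (4 * size fs + 2 * t = n.+1 * n)%N ->
  exists (G : sgraph) (S : topologicalType) (m : embedding R G S),
    [/\ nt_quadrangulation n.+1 t m, orientable R S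
      & exists v : G, dominating_vertex v].
Proof.
move=> cnt; exists faces_graph, (@space R _ faces_triangulation).
exists (surface_embedding (R := R) faces_rot_adj); split.
- split.
  + exact: closed_surface_space (inl (ord0 : 'I_n.+1)).
  + exact: card_ord.
  + have := card_edges face_ord_uniq face_ord_size face_ord_inj dart_ord_sym.
    rewrite card_ord bin2 /= -cnt -/faces_graph; move: #|edges faces_graph| => e ce.
    by rewrite -ce; lia.
  + apply: surface_quadrangular; [exact: faces_rot_face|exact: faces_rot_between].
- exact: orientable_space.
- by exists (ord0 : 'I_n.+1) => w w0; exact: dart_ord0.
Qed.

End FromFaces.

Theorem theorem4p3 (R : realType) (n t : nat) :
  (5 <= n)%N -> (t <= n - 4)%N -> t = (n * (n - 5))./2 %[mod 4] ->
  exists (G : sgraph) (S : topologicalType) (m : embedding R G S),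
    [/\ nt_quadrangulation n t m, orientable R S
      & exists v : G, dominating_vertex v].
Proof.
move=> n5 tn res; have [fs] := residue_pairable n5 tn (residueP n5 res).
case=> [c [z [d [w [ps [rest [_ [hq hl] _ _ [hdom cnt]]]]]]]].
case: n n5 {tn res} hl hdom cnt => // n n5 hl hdom cnt.
have n0 : (0 < n)%N by rewrite -ltnS (leq_trans _ n5).
exact: (@quadrangulation_of_faces n fs n0 hq hl hdom R t cnt).
Qed.
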